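(* The system $\mathsf{RCA}_0^\omega+\mathsf{QF\text{-}AC}^{0,1}$ proves $\mathsf{NBI}$, while $\mathsf{Z}_2^\omega$ does not prove $\mathsf{NBI}$. Here $\mathsf{NBI}$ is the statement: for any $Y:[0,1]\to\mathbb{N}$, either there are $x,y\in[0,1]$ such that $x\neq_{\mathbb{R}}y$ and $Y(x)=Y(y)$, or there is $N\in\mathbb{N}$ such that $(\forall x\in[0,1])(Y(x)\neq N)$.
   Context: Finite types: $0$ is a type (natural numbers), and if $\sigma,\tau$ are types then so is $\sigma\to\tau$; $1:=0\to 0$ and $n+1:=n\to 0$; superscripts indicate types. $\mathsf{L}_\omega$ is the many-sorted language with variables of every finite type, constants $0,1,<_0,+_0,\times_0,=_0$ (with usual meaning), typed combinators $\Pi,\Sigma$, and recursor constants $\mathbf{R}_\sigma$. For $\tau=(\tau_1\to\dots\to\tau_k\to 0)$, $x=_\tau y$ abbreviates $\forall z_1^{\tau_1}\dots z_k^{\tau_k}(xz_1\dots z_k=_0 yz_1\dots z_k)$. $\mathsf{QF\text{-}AC}^{\sigma,\tau}$ is the schema $(\forall x^\sigma)(\exists y^\tau)A(x,y)\to(\exists Y^{\sigma\to\tau})(\forall x^\sigma)A(x,Y(x))$ for quantifier-free $A$ of $\mathsf{L}_\omega$ (parameters of any type allowed). $\mathsf{RCA}_0^\omega$ (Kohlenbach's base theory, classical logic) has the following axioms: ordered semi-ring axioms for $0,1,<_0,+_0,\times_0$; defining axioms of $\Pi,\Sigma$ (giving $\lambda$-abstraction); $\mathbf{R}_0(f,m,0)=m$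 and $\mathbf{R}_0(f,m,n+1)=f(n,\mathbf{R}_0(f,m,n))$; extensionality $x=_\rho y\to\varphi(x)=_\tau\varphi(y)$ for all types $\rho,\tau$; induction for quantifier-free formulas of $\mathsf{L}_\omega$; and $\mathsf{QF\text{-}AC}^{1,0}$. Finite sequences are coded as usual. For $g^1$, $\overline{g}n$ is the (code of the) sequence $\langle g(0),\dots,g(n-1)\rangle$. $(\mathsf{S}_k^2)$ is the axiom stating the existence of a type 2 functional $\mathsf{S}_k^2$ with values in $\{0,1\}$ deciding the truth of $\Sigma^1_k$-formulas of second-order arithmetic (function parameters allowed), e.g. for $k=1$: $(\forall f^1)[(\exists g^1)(\forall n^0)(f(\overline{g}n)=0)\leftrightarrow \mathsf{S}_1(f)=0]$, and for general $k$ the same with the normal form of $\Sigma^1_k$-formulas. $\mathsf{Z}_2^\omega:=\bigcup_k(\mathsf{RCA}_0^\omega+(\mathsf{S}_k^2))$. Inside these theories a real is a sequence of rationals $(q_n)$ with $|q_n-q_{n+i}|<2^{-n}$ for all $n,i$; reals $x,y$ represented by $(q_n),(r_n)$ satisfy $x=_{\mathbb{R}}y$ iff $|q_n-r_n|\le 2^{-n+1}$ for all $n$. Functions on $[0,1]$ or $\mathbb{R}$ with values in $\mathbb{N}$ or $\mathbb{R}$ are objects of the corresponding finite type that map $=_{\mathbb{R}}$-equal reals to equal values. *)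

(* Defs.v *)
From Stdlib Require Import List.
Import ListNotations.

Set Implicit Arguments.
Unset Strict Implicit.

Inductive ty : Type :=
| N : ty
| Arr : ty -> ty -> ty.

Declare Scope ty_scope.
Delimit Scope ty_scope with ty.
Bind Scope ty_scope with ty.
Infix "⇒" := Arr (at level 60, right associativity) : ty_scope.
Open Scope ty_scope.

Notation ty1 := (N ⇒ N).
Notation ty2 := (ty1 ⇒ N).

(** A context lists the types of the free variables (de Bruijn indices);
    terms and formulas are well typed by construction. *)
Definition ctx : Type := list ty.

Inductive var : ctx -> ty -> Type :=
| vz : forall (G : ctx) (s : ty), var (s :: G) s
| vs : forall (G : ctx) (s r : ty), var G s -> var (r :: G) s.
Arguments vz {G s}.
Arguments vs {G s r} _.

Inductive cst : ty -> Type :=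
| CZero : cst N
| COne : cst N
| CAdd : cst (N ⇒ N ⇒ N)
| CMul : cst (N ⇒ N ⇒ N)
| CPi : forall s r : ty, cst (s ⇒ r ⇒ s)
| CSigma : forall r s t : ty, cst ((r ⇒ s ⇒ t) ⇒ (r ⇒ s) ⇒ r ⇒ t)
| CRec : forall s : ty, cst ((N ⇒ s ⇒ s) ⇒ s ⇒ N ⇒ s).

Inductive term (G : ctx) : ty -> Type :=
| tvar : forall s : ty, var G s -> term G s
| tcst : forall s : ty, cst s -> term G s
| tapp : forall s r : ty, term G (s ⇒ r) -> term G s -> term G r.
Arguments tvar {G s} _.
Arguments tcst {G s} _.
Arguments tapp {G s r} _ _.

(** The prime formulas are the equations and inequalities of type [N]. *)
Inductive form : ctx -> Type :=
| Eq : forall G : ctx, term G N -> term G N -> form G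
| Lt : forall G : ctx, term G N -> term G N -> form G
| Bot : forall G : ctx, form G
| And : forall G : ctx, form G -> form G -> form G
| Or : forall G : ctx, form G -> form G -> form G
| Imp : forall G : ctx, form G -> form G -> form G
| All : forall (G : ctx) (s : ty), form (s :: G) -> form G
| Ex : forall (G : ctx) (s : ty), form (s :: G) -> form G.
Arguments Eq {G} _ _.
Arguments Lt {G} _ _.
Arguments Bot {G}.
Arguments And {G} _ _.
Arguments Or {G} _ _.
Arguments Imp {G} _ _.
Arguments All {G} s _.
Arguments Ex {G} s _.

Definition Not {G : ctx} (A : form G) : form G := Imp A Bot.
Definition Iff {G : ctx} (A B : form G) : form G := And (Imp A B) (Imp B A).

Fixpoint qf {G : ctx} (A : form G) : Prop :=
  match A with
  | Eq _ _ | Lt _ _ | Bot => True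
  | And B C | Or B C | Imp B C => qf B /\ qf C
  | All _ _ | Ex _ _ => False
  end.

Definition subst (G D : ctx) : Type := forall s : ty, var G s -> term D s.

Fixpoint tsubst {G D : ctx} (f : subst G D) {s : ty} (t : term G s) : term D s :=
  match t with
  | tvar x => f _ x
  | tcst c => tcst c
  | tapp u v => tapp (tsubst f u) (tsubst f v)
  end.

Definition wk {G : ctx} {r s : ty} (t : term G s) : term (r :: G) s :=
  tsubst (fun _ x => tvar (vs x)) t.

Definition scons {G D : ctx} {s : ty} (t : term D s) (f : subst G D) :
  subst (s :: G) D :=
  fun r x =>
    match x in var G' r'
      return match G' with
             | [] => unit
             | s' :: G'' => term D s' -> subst G'' D -> term D r'
             end
    with
    | vz => fun t' _ => t'
    | vs y => fun _ f' => f' _ y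
    end t f.

Definition snil {D : ctx} : subst [] D :=
  fun r x =>
    match x in var G' r'
      return match G' with [] => term D r' | _ :: _ => unit end
    with
    | vz => tt
    | vs _ => tt
    end.

Definition up {G D : ctx} {s : ty} (f : subst G D) : subst (s :: G) (s :: D) :=
  scons (tvar vz) (fun r x => wk (f r x)).

Fixpoint fsubst {G D : ctx} (f : subst G D) (A : form G) : form D :=
  match A in form G' return subst G' D -> form D with
  | Eq t u => fun f => Eq (tsubst f t) (tsubst f u)
  | Lt t u => fun f => Lt (tsubst f t) (tsubst f u)
  | Bot => fun _ => Bot
  | And B C => fun f => And (fsubst f B) (fsubst f C)
  | Or B C => fun f => Or (fsubst f B) (fsubst f C)
  | Imp B C => fun f => Imp (fsubst f B) (fsubst f C)
  | All s B => fun f => All s (fsubst (up f) B)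
  | Ex s B => fun f => Ex s (fsubst (up f) B)
  end f.

Definition fwk {G : ctx} {r : ty} (A : form G) : form (r :: G) :=
  fsubst (fun _ x => tvar (vs x)) A.

Definition inst {G : ctx} {s : ty} (A : form (s :: G)) (t : term G s) : form G :=
  fsubst (scons t (fun _ x => tvar x)) A.

(** Universal closure; the parameters of an axiom scheme are bound this way. *)
Fixpoint closure {G : ctx} : form G -> form [] :=
  match G return form G -> form [] with
  | [] => fun A => A
  | s :: G' => fun A => closure (All s A)
  end.

Declare Scope form_scope.
Delimit Scope form_scope with form.
Bind Scope form_scope with form.
Bind Scope form_scope with term.
Open Scope form_scope.

Notation "t · u" := (tapp t u) (at level 25, left associativity) : form_scope.
Notation "t ⊕ u" := (tcst CAdd · t · u) (at level 50, left associativity) : form_scope.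
Notation "t ⊗ u" := (tcst CMul · t · u) (at level 40, left associativity) : form_scope.
Notation zero := (tcst CZero).
Notation one := (tcst COne).
Notation two := (one ⊕ one).
Infix "≐" := Eq (at level 70, no associativity) : form_scope.
Infix "≺" := Lt (at level 70, no associativity) : form_scope.
Notation "t ≼ u" := (Or (Lt t u) (Eq t u)) (at level 70, no associativity) : form_scope.
Notation "A ∧ B" := (And A B) (at level 80, right associativity) : form_scope.
Notation "A ∨ B" := (Or A B) (at level 85, right associativity) : form_scope.
Notation "A ⟶ B" := (Imp A B) (at level 90, right associativity) : form_scope.
Notation "A ⟷ B" := (Iff A B) (at level 95, no associativity) : form_scope.

Notation v0 := (tvar vz).
Notation v1 := (tvar (vs vz)).
Notation v2 := (tvar (vs (vs vz))).
Notation v3 := (tvar (vs (vs (vs vz)))).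
Notation v4 := (tvar (vs (vs (vs (vs vz))))).
Notation v5 := (tvar (vs (vs (vs (vs (vs vz)))))).

Fixpoint eqT {G : ctx} (s : ty) : term G s -> term G s -> form G :=
  match s return term G s -> term G s -> form G with
  | N => fun t u => t ≐ u
  | s' ⇒ r => fun t u => All s' (eqT (wk t · v0) (wk u · v0))
  end.

(** Lambda-abstraction, defined from the combinators. *)
Fixpoint lam {G : ctx} (s : ty) {r : ty} (t : term (s :: G) r) : term G (s ⇒ r) :=
  match t with
  | @tvar _ r' x =>
      match x in var G' r''
        return match G' with
               | [] => unit
               | s' :: G'' => term G'' (s' ⇒ r'')
               end
      with
      | @vz _ s' => tcst (CSigma s' (s' ⇒ s') s') · tcst (CPi s' (s' ⇒ s')) · tcst (CPi s' s')
      | @vs _ r'' s' y => tcst (CPi r'' s') · tvar y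
      end
  | @tcst _ r' c => tcst (CPi r' s) · tcst c
  | @tapp _ p q u w => tcst (CSigma s p q) · lam u · lam w
  end.
Arguments lam {G} s {r} _.

Definition theory : Type := form [] -> Prop.

Definition union (T U : theory) : theory := fun A => T A \/ U A.

(** Classical many-sorted natural deduction with logical equality at type [N]
    only; equality at higher types is the abbreviation [eqT]. *)
Inductive prv (T : theory) : forall G : ctx, list (form G) -> form G -> Prop :=
| Ax : forall G (H : list (form G)) A, T A -> prv T H (fsubst snil A)
| Hyp : forall G (H : list (form G)) A, In A H -> prv T H A
| ImpI : forall G (H : list (form G)) A B, prv T (A :: H) B -> prv T H (A ⟶ B)
| ImpE : forall G (H : list (form G)) A B, prv T H (A ⟶ B) -> prv T H A -> prv T H B
| AndI : forall G (H : list (form G)) A B, prv T H A -> prv T H B -> prv T H (A ∧ B)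
| AndE1 : forall G (H : list (form G)) A B, prv T H (A ∧ B) -> prv T H A
| AndE2 : forall G (H : list (form G)) A B, prv T H (A ∧ B) -> prv T H B
| OrI1 : forall G (H : list (form G)) A B, prv T H A -> prv T H (A ∨ B)
| OrI2 : forall G (H : list (form G)) A B, prv T H B -> prv T H (A ∨ B)
| OrE : forall G (H : list (form G)) A B C,
    prv T H (A ∨ B) -> prv T (A :: H) C -> prv T (B :: H) C -> prv T H C
| RAA : forall G (H : list (form G)) A, prv T (Not A :: H) Bot -> prv T H A
| AllI : forall G (H : list (form G)) s (A : form (s :: G)),
    prv T (map fwk H) A -> prv T H (All s A)
| AllE : forall G (H : list (form G)) s (A : form (s :: G)) (t : term G s),
    prv T H (All s A) -> prv T H (inst A t)
| ExI : forall G (H : list (form G)) s (A : form (s :: G)) (t : term G s),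
    prv T H (inst A t) -> prv T H (Ex s A)
| ExE : forall G (H : list (form G)) s (A : form (s :: G)) (B : form G),
    prv T H (Ex s A) -> prv T (A :: map fwk H) (fwk B) -> prv T H B
| EqRefl : forall G (H : list (form G)) (t : term G N), prv T H (t ≐ t)
| EqSubst : forall G (H : list (form G)) (t u : term G N) (A : form (N :: G)),
    prv T H (t ≐ u) -> prv T H (inst A t) -> prv T H (inst A u).

Definition provable (T : theory) (A : form []) : Prop := prv T [] A.
Infix "⊢" := provable (at level 99, no associativity).

(** The axioms of discretely ordered semirings, i.e. Peano arithmetic without
    induction. *)
Inductive semiring_ax : theory :=
| add_assoc : semiring_ax (All N (All N (All N ((v2 ⊕ v1) ⊕ v0 ≐ v2 ⊕ (v1 ⊕ v0)))))
| add_comm : semiring_ax (All N (All N (v1 ⊕ v0 ≐ v0 ⊕ v1)))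
| mul_assoc : semiring_ax (All N (All N (All N ((v2 ⊗ v1) ⊗ v0 ≐ v2 ⊗ (v1 ⊗ v0)))))
| mul_comm : semiring_ax (All N (All N (v1 ⊗ v0 ≐ v0 ⊗ v1)))
| distr : semiring_ax (All N (All N (All N (v2 ⊗ (v1 ⊕ v0) ≐ v2 ⊗ v1 ⊕ v2 ⊗ v0))))
| add_zero : semiring_ax (All N (v0 ⊕ zero ≐ v0))
| mul_zero : semiring_ax (All N (v0 ⊗ zero ≐ zero))
| mul_one : semiring_ax (All N (v0 ⊗ one ≐ v0))
| lt_trans : semiring_ax (All N (All N (All N (v2 ≺ v1 ∧ v1 ≺ v0 ⟶ v2 ≺ v0))))
| lt_irrefl : semiring_ax (All N (Not (v0 ≺ v0)))
| lt_total : semiring_ax (All N (All N (v1 ≺ v0 ∨ v1 ≐ v0 ∨ v0 ≺ v1)))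
| lt_add : semiring_ax (All N (All N (All N (v2 ≺ v1 ⟶ v2 ⊕ v0 ≺ v1 ⊕ v0))))
| lt_mul : semiring_ax (All N (All N (All N (zero ≺ v0 ∧ v2 ≺ v1 ⟶ v2 ⊗ v0 ≺ v1 ⊗ v0))))
| lt_sub : semiring_ax (All N (All N (v1 ≺ v0 ⟶ Ex N (v2 ⊕ v0 ≐ v1))))
| zero_lt_one : semiring_ax (zero ≺ one)
| lt_discrete : semiring_ax (All N (zero ≺ v0 ⟶ one ≼ v0))
| zero_le : semiring_ax (All N (zero ≼ v0)).

(** In [A], index 0 is the variable [y] of type [t] and index 1 the variable
    [x] of type [s]. *)
Inductive QFAC (s t : ty) : theory :=
| qfac : forall (G : ctx) (A : form (t :: s :: G)), qf A ->
    QFAC s t (closure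
      (All s (Ex t A) ⟶
       Ex (s ⇒ t) (All s
         (fsubst (scons (v1 · v0) (scons v0 (fun _ x => tvar (vs (vs x))))) A)))).

(** As in Kohlenbach's base theory, only the recursor [CRec N] has axioms. *)
Inductive RCA0w : theory :=
| rca_semiring : forall A, semiring_ax A -> RCA0w A
| rca_Pi : forall s r : ty,
    RCA0w (All s (All r (eqT (tcst (CPi s r) · v1 · v0) v1)))
| rca_Sigma : forall r s t : ty,
    RCA0w (All (r ⇒ s ⇒ t) (All (r ⇒ s) (All r
      (eqT (tcst (CSigma r s t) · v2 · v1 · v0) (v2 · v0 · (v1 · v0))))))
| rca_rec_zero :
    RCA0w (All (N ⇒ N ⇒ N) (All N (tcst (CRec N) · v1 · v0 · zero ≐ v0)))
| rca_rec_succ :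
    RCA0w (All (N ⇒ N ⇒ N) (All N (All N
      (tcst (CRec N) · v2 · v1 · (v0 ⊕ one) ≐ v2 · v0 · (tcst (CRec N) · v2 · v1 · v0)))))
| rca_ext : forall r t : ty,
    RCA0w (All (r ⇒ t) (All r (All r (eqT v1 v0 ⟶ eqT (v2 · v1) (v2 · v0)))))
| rca_ind : forall (G : ctx) (A : form (N :: G)), qf A ->
    RCA0w (closure
      (inst A zero ∧
       All N (A ⟶ fsubst (scons (v0 ⊕ one) (fun _ x => tvar (vs x))) A) ⟶
       All N A))
| rca_qfac : forall A, QFAC ty1 N A -> RCA0w A.

(** The injective pairing [(a + b)^2 + a]. *)
Definition code_pair {G : ctx} (a b : term G N) : term G N :=
  (a ⊕ b) ⊗ (a ⊕ b) ⊕ a.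

(** Sequence codes: [<>] is [0] and [s * <a>] is [code_pair s a + 1]. *)
Definition append_value {G : ctx} : term G (ty1 ⇒ N ⇒ N ⇒ N) :=
  lam ty1 (lam N (lam N (code_pair v0 (v2 · v1) ⊕ one))).

Definition bar {G : ctx} (g : term G ty1) (n : term G N) : term G N :=
  tcst (CRec N) · (append_value · g) · zero · n.

Fixpoint code_tuple {G : ctx} (l : list (term G N)) : term G N :=
  match l with
  | [] => zero
  | [a] => a
  | a :: l' => code_pair a (code_tuple l')
  end.

(** [k] alternating function quantifiers, the first one existential iff [ex],
    followed by a number quantifier that continues the alternation and the matrix
    [f <bar g_1 n, ..., bar g_m n> = 0]; [gs] are the functions already
    quantified. *)
Fixpoint alternation (ex : bool) (k : nat) {G : ctx}
    (f : term G ty1) (gs : list (term G ty1)) : form G :=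
  match k with
  | O =>
      (if ex then Ex N else All N)
        (wk f · code_tuple (map (fun g => bar (wk g) v0) gs) ≐ zero)
  | S k' =>
      (if ex then Ex ty1 else All ty1)
        (alternation (negb ex) k' (wk f) (map wk gs ++ [v0]))
  end.

Definition Sigma1 (k : nat) {G : ctx} (f : term G ty1) : form G :=
  alternation true k f [].

Definition S_ax (k : nat) : form [] :=
  Ex ty2 (All ty1
    ((v1 · v0 ≐ zero ∨ v1 · v0 ≐ one) ∧ (Sigma1 k v0 ⟷ v1 · v0 ≐ zero))).

Definition Z2w : theory :=
  fun A => exists k : nat, 1 <= k /\ union RCA0w (eq (S_ax k)) A.

Definition pow2 {G : ctx} (n : term G N) : term G N :=
  tcst (CRec N) · lam N (lam N (v0 ⊕ v0)) · one · n.

(** [rat_code a b c] codes the rational number [(a - b) / (c + 1)]. *)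
Definition rat_code {G : ctx} (a b c : term G N) : term G N :=
  code_pair (code_pair a b) c.

Definition wk6 {G : ctx} {s : ty} (t : term G s) :
  term (N :: N :: N :: N :: N :: N :: G) s :=
  wk (wk (wk (wk (wk (wk t))))).

(** [q] and [r] code rationals [(a - b) / (c + 1)] and [(a' - b') / (c' + 1)]
    such that [q R r + e / 2^n], where [R] is [Lt] or [≼]: the inequality is
    multiplied out to one between natural numbers. *)
Definition rat_cmp (R : forall G : ctx, term G N -> term G N -> form G)
    {G : ctx} (q r e n : term G N) : form G :=
  Ex N (Ex N (Ex N (Ex N (Ex N (Ex N (
    let a := v5 in let b := v4 in let c := v3 in
    let a' := v2 in let b' := v1 in let c' := v0 in
    wk6 q ≐ rat_code a b c ∧
    wk6 r ≐ rat_code a' b' c' ∧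
    R _ (pow2 (wk6 n) ⊗ (a ⊗ (c' ⊕ one) ⊕ b' ⊗ (c ⊕ one)))
        (pow2 (wk6 n) ⊗ (a' ⊗ (c ⊕ one) ⊕ b ⊗ (c' ⊕ one))
           ⊕ wk6 e ⊗ ((c ⊕ one) ⊗ (c' ⊕ one))))))))).

Definition rat_lt {G : ctx} (q r e n : term G N) : form G :=
  rat_cmp (fun _ t u => t ≺ u) q r e n.
Definition rat_le {G : ctx} (q r e n : term G N) : form G :=
  rat_cmp (fun _ t u => t ≼ u) q r e n.

(** [|q_n - q_(n+i)| < 2^(-n)] for all [n] and [i]. *)
Definition is_real {G : ctx} (x : term G ty1) : form G :=
  All N (All N (
    let x := wk (wk x) in let n := v1 in let i := v0 in
    rat_lt (x · n) (x · (n ⊕ i)) one n ∧ rat_lt (x · (n ⊕ i)) (x · n) one n)).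

(** [|q_n - r_n| <= 2^(-n+1)] for all [n]. *)
Definition real_eq {G : ctx} (x y : term G ty1) : form G :=
  All N (rat_le (wk x · v0) (wk y · v0) two v0 ∧ rat_le (wk y · v0) (wk x · v0) two v0).

(** [q_n <= r_n + 2^(-n+1)] for all [n]. *)
Definition real_le {G : ctx} (x y : term G ty1) : form G :=
  All N (rat_le (wk x · v0) (wk y · v0) two v0).

Definition real_zero {G : ctx} : term G ty1 := lam N (rat_code zero zero zero).
Definition real_one {G : ctx} : term G ty1 := lam N (rat_code one zero zero).

Definition in_I {G : ctx} (x : term G ty1) : form G :=
  is_real x ∧ real_le real_zero x ∧ real_le x real_one.

(** [Y] maps equal reals in [0,1] to equal natural numbers. *)
Definition fun_I_N {G : ctx} (Y : term G ty2) : form G :=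
  All ty1 (All ty1 (
    in_I v1 ⟶ in_I v0 ⟶ real_eq v1 v0 ⟶ wk (wk Y) · v1 ≐ wk (wk Y) · v0)).

Definition NBI : form [] :=
  All ty2 (fun_I_N v0 ⟶
    Ex ty1 (Ex ty1 (
      in_I v1 ∧ in_I v0 ∧ Not (real_eq v1 v0) ∧ v2 · v1 ≐ v2 · v0)) ∨
    Ex N (All ty1 (in_I v0 ⟶ Not (v2 · v0 ≐ v1)))).

(* Main.v *)
(** The logic is complete for extensional Tarski models (Henkin), so the first half may be
    argued inside such a model: if [Y] takes every value on the unit interval, QF-AC^(0,1)
    yields a sequence of reals [X] with [Y (X n) = n]; Cantor's diagonal real [y] of [X] then
    has the same value as [X (Y y)] but differs from it. To make "[x] is a real of the unit
    interval with [Y x = n]" quantifier-free, every [x] is first normalized to such a real.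

    For the second half, let [E] be a countable set of functions closed under Skolem functions
    of second-order arithmetic and countably many further operations. Call the elements of [E]
    the plots of the numbers, and interpret the finite types hereditarily by the functionals
    that map plots to plots. The functions of this model are the elements of [E], all [S_k]
    belong to it, and [Y] of type 2 belongs to it as soon as [Y (g 0), Y (g 1), ...] is in [E]
    for every sequence [g] in [E]. As each such sequence omits a real of [E], an enumeration of
    [E] in order type omega allows one to build a bijection [Y] with this property in stages,
    each fixing the values of [Y] on one sequence while keeping infinitely many numbers free. *)

From HB Require Import structures.
From mathcomp Require ssreflect ssrfun ssrbool eqtype choice ssrnat order ssralg ssrnum ring lra.
From Stdlib Require Import List Lia PeanoNat Wf_nat Cantor.
From Stdlib Require Import Classical ClassicalEpsilon FunctionalExtensionality
  PropExtensionality ProofIrrelevance Eqdep Ring.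
Require Import Defs.
Import ListNotations.

Unset Asymmetric Patterns.
Local Opaque to_nat of_nat.


(** The numbers of a model in the first half may be nonstandard and satisfy only quantifier-free
    induction. Estimates on reals are therefore carried out in the ordered field of fractions of
    these numbers, and whatever is proved by induction must first be shown to be decided by a
    definable function; [Def], [DefK] and [Dec] keep track of this. As equality is primitive at type
    [N] only, the Henkin term model has to be collapsed by extensional equality before it is an
    extensional model.

    In the second half the numbers are standard. A functional of type 2 belongs to the model if it
    behaves well on each sequence of [E]; these are countably many tasks, one per stage. The danger
    is that the values chosen at a stage form a sequence outside [E], so that [Y] along it is no
    plot. For this reason the selection of new values is itself an operation ([renumber]), fixed
    before [E] is generated, under which [E] is closed. The other danger, that the numbers run out
    before the reals do, is met by demanding a coinfinite range of values at every stage. *)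

(** * Substitution calculus and structural rules of the deduction system *)

Lemma var_case (G : ctx) (s : ty) (P : forall r, var (s :: G) r -> Prop) :
  P s vz -> (forall r (y : var G r), P r (vs y)) -> forall r x, P r x.
Proof.
  intros Hz Hs r x.
  refine (match x as x' in var G' r' return
    match G' return var G' r' -> Prop with
    | [] => fun _ => True
    | s' :: G'' => fun x' => forall P : forall r, var (s' :: G'') r -> Prop,
        P s' vz -> (forall r y, P r (vs y)) -> P r' x'
    end x' with
    | vz => _ | vs y => _ end P Hz Hs); auto.
Qed.

Lemma var_nil (r : ty) (x : var [] r) : False.
Proof.
  exact (match x in var G' r' return
    match G' with [] => False | _ :: _ => True end with
    | vz => I | vs _ => I end).
Qed.

Definition sid {G : ctx} : subst G G := fun s x => tvar x.
Definition scomp {G D E : ctx} (f : subst G D) (g : subst D E) : subst G E :=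
  fun s x => tsubst g (f s x).
Definition swk {G : ctx} {r : ty} : subst G (r :: G) := fun s x => tvar (vs x).

Lemma subst_ext {G D : ctx} (f g : subst G D) :
  (forall s x, f s x = g s x) -> f = g.
Proof.
  intros H. apply functional_extensionality_dep; intros s.
  apply functional_extensionality; intros x. apply H.
Qed.

Lemma subst_ext_cons {G D : ctx} {s : ty} (f g : subst (s :: G) D) :
  f s vz = g s vz -> (forall r x, f r (vs x) = g r (vs x)) -> f = g.
Proof.
  intros Hz Hs. apply subst_ext. intros r x. revert r x.
  apply var_case; auto.
Qed.

Lemma tsubst_tsubst {G D E : ctx} (f : subst G D) (g : subst D E) s (t : term G s) :
  tsubst g (tsubst f t) = tsubst (scomp f g) t.
Proof. induction t; simpl; [reflexivity..|congruence]. Qed.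

Lemma tsubst_id {G : ctx} s (t : term G s) : tsubst sid t = t.
Proof. induction t; simpl; [reflexivity..|congruence]. Qed.

Lemma tsubst_wk {G D : ctx} (f : subst G D) r s (u : term D r) (t : term G s) :
  tsubst (scons u f) (wk t) = tsubst f t.
Proof. unfold wk. now rewrite tsubst_tsubst. Qed.

Lemma scomp_assoc {G D E F : ctx} (f : subst G D) (g : subst D E) (h : subst E F) :
  scomp f (scomp g h) = scomp (scomp f g) h.
Proof. apply subst_ext. intros s x. unfold scomp. now rewrite tsubst_tsubst. Qed.

Lemma scomp_idr {G D : ctx} (f : subst G D) : scomp f sid = f.
Proof. apply subst_ext. intros. apply tsubst_id. Qed.

Lemma scomp_up {G D E : ctx} (f : subst G D) (g : subst D E) (s : ty) :
  scomp (up (s := s) f) (up g) = up (scomp f g).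
Proof.
  apply subst_ext_cons; [reflexivity|]. intros r x.
  unfold scomp, up; simpl. unfold wk. now rewrite !tsubst_tsubst.
Qed.

Lemma up_id {G : ctx} (s : ty) : up (s := s) (@sid G) = sid.
Proof. now apply subst_ext_cons. Qed.

Lemma fsubst_fsubst {G : ctx} (A : form G) : forall D E (f : subst G D) (g : subst D E),
  fsubst g (fsubst f A) = fsubst (scomp f g) A.
Proof.
  induction A; intros D E f g; simpl; try congruence;
    rewrite ?tsubst_tsubst, ?IHA, ?scomp_up; reflexivity.
Qed.

Lemma fsubst_id {G : ctx} (A : form G) : fsubst sid A = A.
Proof.
  induction A; simpl; rewrite ?tsubst_id, ?up_id; congruence.
Qed.

Lemma scons_scomp {G D E : ctx} s (t : term D s) (f : subst G D) (g : subst D E) :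
  scomp (scons t f) g = scons (tsubst g t) (scomp f g).
Proof. now apply subst_ext_cons. Qed.

Lemma up_scons {G D E : ctx} s (t : term E s) (f : subst G D) (g : subst D E) :
  scomp (up f) (scons t g) = scons t (scomp f g).
Proof.
  apply subst_ext_cons; [reflexivity|]. intros r x.
  unfold scomp, up; simpl. apply tsubst_wk.
Qed.

Lemma fsubst_fwk {G D : ctx} (f : subst G D) r (u : term D r) (A : form G) :
  fsubst (scons u f) (fwk A) = fsubst f A.
Proof. unfold fwk. now rewrite fsubst_fsubst. Qed.

Lemma fsubst_up_fwk {G D : ctx} (f : subst G D) r (A : form G) :
  fsubst (up (s := r) f) (fwk A) = fwk (fsubst f A).
Proof. unfold fwk. now rewrite !fsubst_fsubst. Qed.

Lemma fsubst_inst {G D : ctx} (f : subst G D) s (A : form (s :: G)) (t : term G s) :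
  fsubst f (inst A t) = inst (fsubst (up f) A) (tsubst f t).
Proof.
  unfold inst. rewrite !fsubst_fsubst. f_equal.
  rewrite scons_scomp. etransitivity; [|symmetry; apply up_scons].
  f_equal. symmetry. apply scomp_idr.
Qed.

Lemma fsubst_snil {G D : ctx} (f : subst G D) (A : form []) :
  fsubst f (fsubst snil A) = fsubst snil A.
Proof.
  rewrite fsubst_fsubst. f_equal. apply subst_ext. intros s x. destruct (var_nil _ x).
Qed.

Lemma prv_weaken (T : theory) (G : ctx) (H : list (form G)) (A : form G) :
  prv T H A -> forall H', incl H H' -> prv T H' A.
Proof.
  assert (incl_cons2 : forall G (a : form G) l l', incl l l' -> incl (a :: l) (a :: l'))
    by (intros G0 a l l' i x [->|h]; [now left|right; auto]).
  induction 1; intros H' HI.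
  - now apply Ax.
  - apply Hyp; auto.
  - apply ImpI, IHprv; auto.
  - eapply ImpE; eauto.
  - apply AndI; auto.
  - eapply AndE1; eauto.
  - eapply AndE2; eauto.
  - apply OrI1; auto.
  - apply OrI2; auto.
  - eapply OrE; [apply IHprv1|apply IHprv2|apply IHprv3]; auto.
  - apply RAA, IHprv; auto.
  - apply AllI, IHprv, incl_map; auto.
  - apply AllE; auto.
  - eapply ExI; eauto.
  - eapply ExE; [apply IHprv1; auto|apply IHprv2, incl_cons2, incl_map; auto].
  - apply EqRefl.
  - eapply EqSubst; eauto.
Qed.

Lemma map_fwk_fsubst {G D : ctx} (f : subst G D) r (H : list (form G)) :
  map (fsubst (up (s := r) f)) (map fwk H) = map fwk (map (fsubst f) H).
Proof.
  rewrite !map_map. apply map_ext. intros. apply fsubst_up_fwk.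
Qed.

(** Moves derivations to later Henkin stages and to elements of the term model; the quantifier cases
    rest on the commutation laws [fsubst_inst] and [fsubst_up_fwk]. *)
Lemma prv_subst (T : theory) (G : ctx) (H : list (form G)) (A : form G) :
  prv T H A -> forall D (f : subst G D), prv T (map (fsubst f) H) (fsubst f A).
Proof.
  induction 1; intros D f; simpl in *.
  - rewrite fsubst_snil. now apply Ax.
  - apply Hyp, in_map; auto.
  - apply ImpI, IHprv.
  - eapply ImpE; eauto.
  - apply AndI; auto.
  - eapply AndE1; eauto.
  - eapply AndE2; eauto.
  - apply OrI1; auto.
  - apply OrI2; auto.
  - eapply OrE; [apply IHprv1|apply IHprv2|apply IHprv3].
  - apply RAA, IHprv.
  - apply AllI. rewrite <- map_fwk_fsubst. apply IHprv.
  - rewrite fsubst_inst. apply AllE. apply IHprv.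
  - apply ExI with (t := tsubst f t). rewrite <- fsubst_inst. apply IHprv.
  - eapply ExE; [apply IHprv1|]. specialize (IHprv2 _ (up f)).
    now rewrite map_fwk_fsubst, fsubst_up_fwk in IHprv2.
  - apply EqRefl.
  - rewrite fsubst_inst. eapply EqSubst; [apply IHprv1|].
    specialize (IHprv2 _ f). now rewrite fsubst_inst in IHprv2.
Qed.

Lemma prv_cut (T : theory) (G : ctx) (H : list (form G)) (L : list (form G)) (A : form G) :
  (forall B, In B L -> prv T H B) -> prv T (L ++ H) A -> prv T H A.
Proof.
  revert A. induction L as [|B L IH]; intros A HL HA; [exact HA|].
  apply ImpE with (A := B); [|apply HL; now left].
  apply IH; [intros C hC; apply HL; now right|]. now apply ImpI.
Qed.

(** * Tarski semantics *)

Record structure := {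
  Dom : ty -> Type;
  ap : forall {s r : ty}, Dom (s ⇒ r) -> Dom s -> Dom r;
  interp : forall s : ty, cst s -> Dom s;
  ltD : Dom N -> Dom N -> Prop }.
Arguments ap {_ _ _} _ _.
Arguments interp _ {_} _.
Arguments ltD {_} _ _.

Definition env (D : ty -> Type) (G : ctx) : Type := forall s, var G s -> D s.

Definition econs {D : ty -> Type} {G : ctx} {s : ty} (d : D s) (e : env D G) :
  env D (s :: G) :=
  fun r x =>
    match x in var G' r'
      return match G' with
             | [] => unit
             | s' :: G'' => D s' -> env D G'' -> D r'
             end
    with
    | vz => fun d' _ => d'
    | vs y => fun _ e' => e' _ y
    end d e.

Definition enil {D : ty -> Type} : env D [] := fun r x => False_rect _ (var_nil r x).

Definition etail {D : ty -> Type} {G : ctx} {s : ty} (e : env D (s :: G)) : env D G :=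
  fun r x => e r (vs x).

Lemma env_ext {D G} (e e' : env D G) : (forall s x, e s x = e' s x) -> e = e'.
Proof.
  intros H. apply functional_extensionality_dep; intros s.
  apply functional_extensionality; intros x. apply H.
Qed.

Lemma env_ext_cons {D G s} (e e' : env D (s :: G)) :
  e s vz = e' s vz -> (forall r x, e r (vs x) = e' r (vs x)) -> e = e'.
Proof.
  intros Hz Hs. apply env_ext. intros r x. revert r x. apply var_case; auto.
Qed.

Lemma econs_eta {D G s} (e : env D (s :: G)) : econs (e s vz) (etail e) = e.
Proof. now apply env_ext_cons. Qed.

Lemma env_nil {D} (e : env D []) : e = enil.
Proof. apply env_ext. intros s x. destruct (var_nil _ x). Qed.

Fixpoint eval (M : structure) {G : ctx} {s : ty} (e : env (Dom M) G) (t : term G s) : Dom M s :=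
  match t with
  | tvar x => e _ x
  | tcst c => interp M c
  | tapp u v => ap (eval M e u) (eval M e v)
  end.

(** The equality of type [N] is interpreted by an arbitrary relation [E], which is
    Leibniz equality except in the term model. *)
Fixpoint satR (M : structure) (E : Dom M N -> Dom M N -> Prop) {G : ctx} (A : form G) :
  env (Dom M) G -> Prop :=
  match A in form G' return env (Dom M) G' -> Prop with
  | Eq t u => fun e => E (eval M e t) (eval M e u)
  | Lt t u => fun e => ltD (eval M e t) (eval M e u)
  | Bot => fun _ => False
  | And B C => fun e => satR M E B e /\ satR M E C e
  | Or B C => fun e => satR M E B e \/ satR M E C e
  | Imp B C => fun e => satR M E B e -> satR M E C e
  | All s B => fun e => forall d, satR M E B (econs d e)
  | Ex s B => fun e => exists d, satR M E B (econs d e)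
  end.

Notation sat M A e := (satR M eq A e).

Definition models (M : structure) (T : theory) : Prop := forall A, T A -> sat M A enil.

Definition extensional (M : structure) : Prop :=
  forall s r (f g : Dom M (s ⇒ r)), (forall x, ap f x = ap g x) -> f = g.

Definition esubst (M : structure) {G D} (f : subst G D) (e : env (Dom M) D) : env (Dom M) G :=
  fun s x => eval M e (f s x).

Lemma eval_tsubst M {G D} (f : subst G D) s (t : term G s) (e : env (Dom M) D) :
  eval M e (tsubst f t) = eval M (esubst M f e) t.
Proof. induction t; simpl; [reflexivity..|congruence]. Qed.

Lemma eval_wk M {G} r s (t : term G s) (d : Dom M r) (e : env (Dom M) G) :
  eval M (econs d e) (wk t) = eval M e t.
Proof. unfold wk. now rewrite eval_tsubst. Qed.

Lemma esubst_up M {G D} s (f : subst G D) (d : Dom M s) (e : env (Dom M) D) :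
  esubst M (up f) (econs d e) = econs d (esubst M f e).
Proof.
  apply env_ext_cons; [reflexivity|]. intros r x. unfold esubst, up; simpl. apply eval_wk.
Qed.

Lemma esubst_scons M {G D} s (f : subst G D) (t : term D s) (e : env (Dom M) D) :
  esubst M (scons t f) e = econs (eval M e t) (esubst M f e).
Proof. now apply env_ext_cons. Qed.

Lemma satR_fsubst M E {G} (A : form G) : forall D (f : subst G D) (e : env (Dom M) D),
  satR M E (fsubst f A) e <-> satR M E A (esubst M f e).
Proof.
  induction A; intros D f e; simpl;
    rewrite ?eval_tsubst, ?IHA1, ?IHA2; try reflexivity.
  - split; intros H d; specialize (H d); rewrite IHA, esubst_up in *; exact H.
  - split; intros [d H]; exists d; rewrite IHA, esubst_up in *; exact H.
Qed.

Lemma satR_fwk M E {G} r (A : form G) (d : Dom M r) e :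
  satR M E (fwk A) (econs d e) <-> satR M E A e.
Proof. unfold fwk. now rewrite satR_fsubst. Qed.

Lemma satR_inst M E {G} r (A : form (r :: G)) (t : term G r) e :
  satR M E (inst A t) e <-> satR M E A (econs (eval M e t) e).
Proof. unfold inst. rewrite satR_fsubst, esubst_scons. reflexivity. Qed.

Lemma satR_closure M E {G} (A : form G) :
  satR M E (closure A) enil <-> forall e, satR M E A e.
Proof.
  induction G as [|s G IH]; simpl.
  - split; [intros H e; now rewrite (env_nil e)|auto].
  - rewrite IH. simpl. split; intros H e.
    + rewrite <- (econs_eta e). apply H.
    + intros d. apply H.
Qed.

Lemma soundness (M : structure) (T : theory) (G : ctx) (H : list (form G)) (A : form G) :
  models M T -> prv T H A ->
  forall e, (forall B, In B H -> sat M B e) -> sat M A e.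
Proof.
  intros HT. induction 1; intros e HH; simpl in *.
  - rewrite satR_fsubst, (env_nil (esubst _ _ _)). auto.
  - auto.
  - intros a. apply IHprv. intros C [<-|h]; auto.
  - apply IHprv1; auto.
  - auto.
  - now apply IHprv.
  - now apply IHprv.
  - auto.
  - auto.
  - destruct (IHprv1 e HH); [apply IHprv2|apply IHprv3]; intros D [<-|h]; auto.
  - apply NNPP. intros n. apply (IHprv e). intros C [<-|h]; auto.
  - intros d. apply IHprv. intros B hB. apply in_map_iff in hB as (C & <- & hC).
    apply satR_fwk; auto.
  - apply satR_inst. apply IHprv; auto.
  - specialize (IHprv e HH). rewrite satR_inst in IHprv. eauto.
  - destruct (IHprv1 e HH) as [d hd].
    rewrite <- (satR_fwk M eq s B d e). apply IHprv2.
    intros C [<-|h]; auto. apply in_map_iff in h as (C' & <- & hC').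
    apply satR_fwk; auto.
  - reflexivity.
  - rewrite satR_inst. rewrite <- (IHprv1 e HH). specialize (IHprv2 e HH).
    now rewrite satR_inst in IHprv2.
Qed.

(** * Countability of the syntax *)

Definition countable (X : Type) : Prop := exists f : X -> nat, forall x y, f x = f y -> x = y.

Lemma countable_surj (X Y : Type) (e : Y -> X) :
  (forall x, exists y, e y = x) -> countable Y -> countable X.
Proof.
  intros He [f Hf].
  pose (g x := proj1_sig (constructive_indefinite_description _ (He x))).
  assert (Hg : forall x, e (g x) = x)
    by (intros x; unfold g; now destruct constructive_indefinite_description).
  exists (fun x => f (g x)). intros x y h. rewrite <- (Hg x), <- (Hg y). f_equal. auto.
Qed.

Lemma countable_inj (X Y : Type) (e : X -> Y) :
  (forall x y, e x = e y -> x = y) -> countable Y -> countable X.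
Proof. intros He [f Hf]. exists (fun x => f (e x)). auto. Qed.

Lemma countable_nat : countable nat.
Proof. now exists (fun n => n). Qed.

Lemma countable_sigT (I : Type) (X : I -> Type) :
  countable I -> (forall i, countable (X i)) -> countable {i : I & X i}.
Proof.
  intros [f Hf] HX.
  pose (g i := proj1_sig (constructive_indefinite_description _ (HX i))).
  assert (Hg : forall i x y, g i x = g i y -> x = y)
    by (intros i; unfold g; now destruct constructive_indefinite_description).
  exists (fun p => to_nat (f (projT1 p), g _ (projT2 p))).
  intros [i x] [j y] h. apply to_nat_inj in h. simpl in h. injection h as h1 h2.
  apply Hf in h1. subst j. now apply Hg in h2; subst.
Qed.

Lemma countable_prod (X Y : Type) : countable X -> countable Y -> countable (X * Y).
Proof.
  intros [f Hf] [g Hg]. exists (fun p => to_nat (f (fst p), g (snd p))).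
  intros [x y] [x' y'] h. apply to_nat_inj in h. injection h as h1 h2.
  apply Hf in h1. apply Hg in h2. now subst.
Qed.

(** The values are options because [X] may be empty. *)
Lemma countable_enum (X : Type) :
  countable X -> exists e : nat -> option X, forall x, exists n, e n = Some x.
Proof.
  intros [f Hf].
  exists (fun n => match excluded_middle_informative (exists x, f x = n) with
    | left h => Some (proj1_sig (constructive_indefinite_description _ h))
    | right _ => None end).
  intros x. exists (f x).
  destruct excluded_middle_informative as [h|h]; [|destruct h; eauto].
  f_equal. apply Hf. now destruct constructive_indefinite_description.
Qed.

Lemma countable_ty : countable ty.
Proof.
  exists (fix c s := match s with N => 0 | Arr a b => S (to_nat (c a, c b)) end).
  induction x as [|a IHa b IHb]; destruct y as [|a' b']; intros h; try discriminate; auto.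
  apply eq_add_S, to_nat_inj in h. injection h as h1 h2.
  f_equal; auto.
Qed.

(** The type [s] is an index, so the constants of one type cannot be listed directly; they are
    embedded into the sum over all types, where seven tags with type parameters reach everything. *)
Lemma countable_cst s : countable (cst s).
Proof.
  apply countable_inj with (e := fun c => existT cst s c);
    [intros x y; apply inj_pair2|].
  apply countable_surj with (Y := (nat * (ty * (ty * ty)))%type)
    (e := fun p => match p with
      | (0, _) => existT cst _ CZero
      | (1, _) => existT cst _ COne
      | (2, _) => existT cst _ CAdd
      | (3, _) => existT cst _ CMul
      | (4, (s, (r, _))) => existT cst _ (CPi s r)
      | (5, (r, (s, t))) => existT cst _ (CSigma r s t)
      | (_, (s, _)) => existT cst _ (CRec s)
      end).
  - intros [r c]. destruct c.
    + now exists (0, (N, (N, N))).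
    + now exists (1, (N, (N, N))).
    + now exists (2, (N, (N, N))).
    + now exists (3, (N, (N, N))).
    + now exists (4, (s0, (r, N))).
    + now exists (5, (r, (s0, t))).
    + now exists (6, (s0, (N, N))).
  - auto using countable_prod, countable_nat, countable_ty.
Qed.

Lemma countable_var G s : countable (var G s).
Proof.
  apply countable_inj with (e := fun c => existT (var G) s c);
    [intros x y; apply inj_pair2|].
  clear s. induction G as [|r G [f Hf]].
  - exists (fun _ => 0). intros [s x]. destruct (var_nil _ x).
  - apply countable_surj with (Y := option {s & var G s})
      (e := fun o => match o with
        | None => existT (var (r :: G)) _ vz
        | Some (existT _ _ y) => existT (var (r :: G)) _ (vs y) end).
    + intros [s x]. revert s x. apply var_case.
      * now exists None.
      * intros s y. now exists (Some (existT _ s y)).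
    + exists (fun o => match o with None => 0 | Some y => S (f y) end).
      intros [x|] [y|] h; try discriminate; auto. f_equal. apply Hf. congruence.
Qed.

Definition choose_code (X : Type) (H : countable X) : X -> nat :=
  proj1_sig (constructive_indefinite_description _ H).

Lemma choose_code_inj X H x y : @choose_code X H x = choose_code X H y -> x = y.
Proof. unfold choose_code. destruct constructive_indefinite_description; auto. Qed.

Fixpoint term_code {G s} (t : term G s) : nat :=
  match t with
  | @tvar _ r x => to_nat (0, choose_code _ (countable_var G r) x)
  | @tcst _ r c => to_nat (1, choose_code _ (countable_cst r) c)
  | @tapp _ r _ u v =>
      to_nat (2, to_nat (choose_code _ countable_ty r, to_nat (term_code u, term_code v)))
  end.

Lemma term_code_inj G s (t : term G s) : forall t', term_code t = term_code t' -> t = t'.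
Proof.
  induction t as [s x|s c|r s u IHu v IHv]; intros t';
    [revert x|revert c|revert u v IHu IHv];
    destruct t' as [? y|? d|r' ? u' v']; intros; cbn [term_code] in H;
    apply to_nat_inj in H; try discriminate; injection H as H.
  - apply choose_code_inj in H. congruence.
  - apply choose_code_inj in H. congruence.
  - apply to_nat_inj in H. injection H as H1 H2. apply choose_code_inj in H1. subst r'.
    apply to_nat_inj in H2. injection H2 as H2 H3. f_equal; auto.
Qed.

Fixpoint form_code {G} (A : form G) : nat :=
  match A with
  | Eq t u => to_nat (0, to_nat (term_code t, term_code u))
  | Lt t u => to_nat (1, to_nat (term_code t, term_code u))
  | Bot => to_nat (2, 0)
  | And B C => to_nat (3, to_nat (form_code B, form_code C))
  | Or B C => to_nat (4, to_nat (form_code B, form_code C))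
  | Imp B C => to_nat (5, to_nat (form_code B, form_code C))
  | All s B => to_nat (6, to_nat (choose_code _ countable_ty s, form_code B))
  | Ex s B => to_nat (7, to_nat (choose_code _ countable_ty s, form_code B))
  end.

Lemma form_code_inj G (A : form G) : forall A', form_code A = form_code A' -> A = A'.
Proof.
  induction A; intros A';
    [revert t t0|revert t t0| |revert A1 A2 IHA1 IHA2|revert A1 A2 IHA1 IHA2
    |revert A1 A2 IHA1 IHA2|revert A IHA|revert A IHA];
    destruct A'; intros; cbn [form_code] in H; apply to_nat_inj in H; try discriminate;
    try reflexivity; injection H as H; apply to_nat_inj in H; injection H as H1 H2;
    try (apply choose_code_inj in H1; subst); try apply term_code_inj in H1;
    try apply term_code_inj in H2; f_equal; auto.
Qed.

Lemma countable_form G : countable (form G).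
Proof. exists form_code. apply form_code_inj. Qed.

(** * Henkin completeness *)

(** A closed term of every type. It makes all sorts inhabited, so that a fresh variable can be
    eliminated again. *)
Fixpoint dummy {G : ctx} (s : ty) : term G s :=
  match s with
  | N => tcst CZero
  | s' ⇒ r => tapp (tcst (CPi r s')) (dummy r)
  end.

Section Henkin.
Variable T : theory.
Variable A0 : form [].
Hypothesis unprovable : ~ provable T A0.

Lemma ty_enum_ex : exists e : nat -> ty, forall s, exists n, e n = s.
Proof.
  destruct (countable_enum _ countable_ty) as [e He].
  exists (fun n => match e n with Some s => s | None => N end).
  intros s. destruct (He s) as [n hn]. exists n. now rewrite hn.
Qed.

Definition ty_enum := proj1_sig (constructive_indefinite_description _ ty_enum_ex).
Lemma ty_enumP s : exists n, ty_enum n = s.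
Proof. unfold ty_enum. destruct constructive_indefinite_description; auto. Qed.

(** Stage [n] adds a variable of type [stage_ty n]; it becomes the witness of the
    existential formula treated at that stage. *)
Definition stage_ty (n : nat) : ty := ty_enum (fst (of_nat n)).

(** The variables of growing contexts play the role of Henkin constants, so neither the syntax nor
    [prv] has to be extended. *)
Fixpoint Gs (n : nat) : ctx :=
  match n with 0 => [] | S n' => stage_ty n' :: Gs n' end.

Lemma todo_ex (s : ty) : exists e : nat -> option {m : nat & form (s :: Gs m)},
  forall x, exists n, e n = Some x.
Proof.
  apply countable_enum, countable_sigT; auto using countable_nat, countable_form.
Qed.

Definition todo (s : ty) := proj1_sig (constructive_indefinite_description _ (todo_ex s)).
Lemma todoP s x : exists n, todo s n = Some x.
Proof. unfold todo. destruct constructive_indefinite_description; simpl; auto. Qed.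

(** The embedding of stage [n] into stage [m]. It is made total by default terms for [m < n], which
    keeps proofs of [n <= m] out of the formulas. *)
Fixpoint W (n m : nat) {struct m} : subst (Gs n) (Gs m) :=
  match Nat.eq_dec n m with
  | left e => eq_rect n (fun k => subst (Gs n) (Gs k)) sid m e
  | right _ =>
      match m as m' return subst (Gs n) (Gs m') with
      | 0 => fun s _ => dummy s
      | S m' => scomp (W n m') swk
      end
  end.

Lemma W_refl n : W n n = sid.
Proof.
  destruct n; simpl; [reflexivity|].
  destruct Nat.eq_dec as [e|ne]; [|congruence].
  now rewrite (UIP_refl _ _ e).
Qed.

Lemma W_S n m : n <= m -> W n (S m) = scomp (W n m) swk.
Proof.
  intros h. cbn [W]. destruct (Nat.eq_dec n (S m)) as [e|ne]; [lia|reflexivity].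
Qed.

Lemma W_comp n m k : n <= m -> m <= k -> scomp (W n m) (W m k) = W n k.
Proof.
  intros h1 h2. induction h2 as [|k h2 IH].
  - now rewrite W_refl, scomp_idr.
  - rewrite !W_S by lia. now rewrite scomp_assoc, IH.
Qed.

(** The number [n] codes a type, an index into the list of formulas for that type, and a padding
    component, so that every formula is treated at arbitrarily late stages. *)
Definition pick (n : nat) : option (form (Gs (S n))) :=
  match todo (stage_ty n) (fst (of_nat (snd (of_nat n)))) with
  | Some (existT _ m B) => Some (fsubst (up (W m n)) B)
  | None => None
  end.

Fixpoint Hs (n : nat) : list (form (Gs n)) :=
  match n return list (form (Gs n)) with
  | 0 => [Not A0]
  | S n' =>
      let H := Hs n' in
      match pick n' with
      | Some B =>
          if excluded_middle_informative (prv T (Ex (stage_ty n') B :: H) Bot)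
          then map fwk H else B :: map fwk H
      | None => map fwk H
      end
  end.

Lemma prv_strengthen (G : ctx) (H : list (form G)) r (A : form G) :
  prv T (map (@fwk G r) H) (fwk A) -> prv T H A.
Proof.
  intros h. apply AllI, (AllE (dummy r)) in h. unfold inst in h.
  now rewrite fsubst_fwk, fsubst_id in h.
Qed.

Lemma Hs_consistent n : ~ prv T (Hs n) Bot.
Proof.
  induction n as [|n IH]; simpl.
  - intros h. apply unprovable, RAA, h.
  - assert (h0 : ~ prv T (map (@fwk _ (stage_ty n)) (Hs n)) Bot)
      by (intros h; apply IH; apply prv_strengthen with (r := stage_ty n); exact h).
    destruct (pick n) as [B|]; [|exact h0].
    destruct excluded_middle_informative as [h|h]; [exact h0|].
    (* The new variable is fresh, so [ExE] turns an inconsistency caused by [B] into one caused by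
       its existential closure, which the test has excluded. *)
    intros hB. apply h. eapply ExE; [apply Hyp; now left|].
    apply prv_weaken with (1 := hB). intros C [<-|hC]; [now left|right; now right].
Qed.

Lemma Hs_incl n : incl (map fwk (Hs n)) (Hs (S n)).
Proof.
  simpl. destruct (pick n) as [B|]; [|apply incl_refl].
  destruct excluded_middle_informative; [apply incl_refl|apply incl_tl, incl_refl].
Qed.

Lemma Hs_mono n m (B : form (Gs n)) :
  n <= m -> prv T (Hs n) B -> prv T (Hs m) (fsubst (W n m) B).
Proof.
  intros h hB. induction h as [|m h IH].
  - now rewrite W_refl, fsubst_id.
  - rewrite W_S by lia. rewrite <- fsubst_fsubst.
    apply prv_weaken with (2 := Hs_incl m). apply (prv_subst _ _ _ _ IH _ swk).
Qed.

Definition PreD (s : ty) : Type := {n : nat & term (Gs n) s}.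
Definition lf {s} (x : PreD s) (n : nat) : term (Gs n) s := tsubst (W (projT1 x) n) (projT2 x).
Definition lfe {G} (e : env PreD G) (n : nat) : subst G (Gs n) := fun s x => lf (e s x) n.
Definition le_env {G} (e : env PreD G) (n : nat) : Prop := forall s x, projT1 (e s x) <= n.

Lemma lf_W {s} (x : PreD s) n m :
  projT1 x <= n -> n <= m -> tsubst (W n m) (lf x n) = lf x m.
Proof. intros. unfold lf. now rewrite tsubst_tsubst, W_comp. Qed.

Lemma lfe_W {G} (e : env PreD G) n m :
  le_env e n -> n <= m -> scomp (lfe e n) (W n m) = lfe e m.
Proof. intros h1 h2. apply subst_ext. intros s x. apply lf_W; auto. Qed.

Lemma le_env_mono {G} (e : env PreD G) n m : le_env e n -> n <= m -> le_env e m.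
Proof. intros h1 h2 s x. specialize (h1 s x). lia. Qed.

Lemma le_env_ex {G} (e : env PreD G) : exists n, le_env e n.
Proof.
  induction G as [|s G IH].
  - exists 0. intros s x. destruct (var_nil _ x).
  - destruct (IH (etail e)) as [n hn]. exists (max n (projT1 (e s vz))).
    intros r x. revert r x. apply var_case; [lia|].
    intros r y. specialize (hn r y). unfold etail in hn. lia.
Qed.

Lemma le_env_econs {G s} (d : PreD s) (e : env PreD G) n :
  projT1 d <= n -> le_env e n -> le_env (econs d e) n.
Proof. intros h1 h2 r x. revert r x. apply var_case; auto. Qed.

Lemma lfe_econs {G s} (d : PreD s) (e : env PreD G) n :
  lfe (econs d e) n = scons (lf d n) (lfe e n).
Proof. now apply subst_ext_cons. Qed.

(** Truth in the term model: derivability at one stage that contains all parameters. By [Tr_ev] it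
    persists at all later stages. *)
Definition Tr {G} (A : form G) (e : env PreD G) : Prop :=
  exists n, le_env e n /\ prv T (Hs n) (fsubst (lfe e n) A).

Lemma Tr_ev {G} (A : form G) e : Tr A e ->
  exists n, forall m, n <= m -> le_env e m /\ prv T (Hs m) (fsubst (lfe e m) A).
Proof.
  intros (n & h1 & h2). exists n. intros m h. split; [eapply le_env_mono; eauto|].
  apply (Hs_mono n m) in h2; [|exact h]. now rewrite fsubst_fsubst, lfe_W in h2.
Qed.

Lemma Tr_closed {G} (L : list (form G)) (A : form G) e :
  (forall B, In B L -> Tr B e) -> prv T L A -> Tr A e.
Proof.
  intros HL HA.
  assert (h : exists n, forall m, n <= m ->
    le_env e m /\ forall B, In B L -> prv T (Hs m) (fsubst (lfe e m) B)).
  { clear HA. induction L as [|B L IH].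
    - destruct (le_env_ex e) as [n hn]. exists n. intros m h.
      split; [eapply le_env_mono; eauto|intros B []].
    - destruct IH as [n hn]; [intros; apply HL; now right|].
      destruct (Tr_ev B e) as [k hk]; [apply HL; now left|].
      exists (max n k). intros m h. split; [apply hn; lia|].
      intros C [<-|hC]; [apply hk; lia|apply hn; [lia|exact hC]]. }
  destruct h as [n hn]. destruct (hn n (le_n n)) as [h1 h2].
  exists n. split; [exact h1|].
  apply prv_cut with (L := map (fsubst (lfe e n)) L).
  - intros B hB. apply in_map_iff in hB as (C & <- & hC). auto.
  - apply prv_weaken with (1 := prv_subst _ _ _ _ HA _ (lfe e n)).
    apply incl_appl, incl_refl.
Qed.

Lemma Tr_Bot {G} (e : env PreD G) : ~ Tr Bot e.
Proof. intros (n & _ & h). now apply (Hs_consistent n). Qed.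

Lemma Henkin_stage s m (B : form (s :: Gs m)) : exists n, m <= n /\
  (prv T (Ex s (fsubst (up (W m n)) B) :: Hs n) Bot \/
   exists t : term (Gs (S n)) s,
     prv T (Hs (S n)) (fsubst (scons t (W m (S n))) B)).
Proof.
  destruct (ty_enumP s) as [i hi]. subst s.
  destruct (todoP (ty_enum i) (existT _ m B)) as [j hj].
  assert (hn : exists n, m <= n /\ fst (of_nat n) = i /\ fst (of_nat (snd (of_nat n))) = j).
  { exists (to_nat (i, to_nat (j, m))).
    pose proof (to_nat_non_decreasing j m). pose proof (to_nat_non_decreasing i (to_nat (j, m))).
    rewrite !cancel_of_to. simpl. rewrite cancel_of_to. simpl. split; [lia|auto]. }
  destruct hn as (n & h1 & h2 & h3). exists n. split; [exact h1|]. subst i j.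
  change (ty_enum (fst (of_nat n))) with (stage_ty n) in *.
  assert (hp : pick n = Some (fsubst (up (W m n)) B)) by (unfold pick; now rewrite hj).
  destruct (classic (prv T (Ex (stage_ty n) (fsubst (up (W m n)) B) :: Hs n) Bot))
    as [h|h]; [now left|right].
  exists (tvar vz). cbn [Hs]. rewrite hp.
  destruct excluded_middle_informative as [h'|_]; [contradiction|].
  apply Hyp. left. f_equal. rewrite W_S by lia. now apply subst_ext_cons.
Qed.

Lemma Tr_Henkin {G s} (B : form (s :: G)) e :
  Tr (Not (Ex s B)) e \/ exists d, Tr B (econs d e).
Proof.
  destruct (le_env_ex e) as [m hm].
  destruct (Henkin_stage s m (fsubst (up (lfe e m)) B)) as (n & hn & [h|[t h]]).
  - left. exists n. split; [eapply le_env_mono; eauto|]. simpl. apply ImpI.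
    now rewrite fsubst_fsubst, scomp_up, lfe_W in h.
  - right. exists (existT _ (S n) t). exists (S n). split.
    + apply le_env_econs; [simpl; lia|]. apply le_env_mono with (1 := hm). lia.
    + rewrite fsubst_fsubst in h.
      rewrite up_scons, lfe_W in h by (auto; lia).
      rewrite lfe_econs. unfold lf. simpl projT1. now rewrite W_refl, tsubst_id.
Qed.

Lemma Tr_fwk {G s} (A : form G) (d : PreD s) e : Tr (fwk A) (econs d e) -> Tr A e.
Proof.
  intros (n & h1 & h2). exists n. split.
  - intros r x. apply (h1 r (vs x)).
  - now rewrite lfe_econs, fsubst_fwk in h2.
Qed.

Lemma Tr_Ex {G s} (B : form (s :: G)) e : Tr (Ex s B) e <-> exists d, Tr B (econs d e).
Proof.
  split.
  - intros h. destruct (Tr_Henkin B e) as [h'|h']; [exfalso|exact h'].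
    apply (Tr_Bot e). apply Tr_closed with (L := [Not (Ex s B); Ex s B]).
    + intros C [<-|[<-|[]]]; auto.
    + apply ImpE with (A := Ex s B); apply Hyp; simpl; auto.
  - intros (d & n & h1 & h2). exists n. split; [intros r x; apply (h1 r (vs x))|].
    simpl. apply ExI with (t := lf d n). unfold inst.
    rewrite fsubst_fsubst, up_scons, scomp_idr. now rewrite lfe_econs in h2.
Qed.

(** A vacuous quantifier turns the Henkin alternative into a decision of [A]. Hence the stages never
    have to decide formulas separately to reach a maximal theory. *)
Lemma Tr_complete {G} (A : form G) e : Tr (Not A) e \/ Tr A e.
Proof.
  destruct (Tr_Henkin (s := N) (fwk A) e) as [h|[d h]].
  - left. apply Tr_closed with (L := [Not (Ex N (fwk A))]); [intros B [<-|[]]; auto|].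
    apply ImpI. apply ImpE with (A := Ex N (fwk A)); [apply Hyp; simpl; auto|].
    apply ExI with (t := dummy N). unfold inst. rewrite fsubst_fwk, fsubst_id.
    apply Hyp; simpl; auto.
  - right. eapply Tr_fwk; eauto.
Qed.

Lemma Tr_Imp {G} (A B : form G) e : Tr (A ⟶ B) e <-> (Tr A e -> Tr B e).
Proof.
  split.
  - intros h1 h2. apply Tr_closed with (L := [A ⟶ B; A]).
    + intros C [<-|[<-|[]]]; auto.
    + apply ImpE with (A := A); apply Hyp; simpl; auto.
  - intros h. destruct (Tr_complete A e) as [h1|h1].
    + apply Tr_closed with (L := [Not A]); [intros C [<-|[]]; auto|].
      apply ImpI, RAA. apply ImpE with (A := A); apply Hyp; simpl; auto.
    + apply Tr_closed with (L := [B]); [intros C [<-|[]]; auto|].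
      apply ImpI, Hyp; simpl; auto.
Qed.

Lemma Tr_And {G} (A B : form G) e : Tr (A ∧ B) e <-> Tr A e /\ Tr B e.
Proof.
  split.
  - intros h. split; (apply Tr_closed with (L := [A ∧ B]); [intros C [<-|[]]; auto|]).
    + apply AndE1 with (B := B); apply Hyp; simpl; auto.
    + apply AndE2 with (A := A); apply Hyp; simpl; auto.
  - intros [h1 h2]. apply Tr_closed with (L := [A; B]).
    + intros C [<-|[<-|[]]]; auto.
    + apply AndI; apply Hyp; simpl; auto.
Qed.

Lemma Tr_Or {G} (A B : form G) e : Tr (A ∨ B) e <-> Tr A e \/ Tr B e.
Proof.
  split.
  - intros h. destruct (Tr_complete A e) as [h1|h1]; [right|now left].
    apply Tr_closed with (L := [A ∨ B; Not A]).
    + intros C [<-|[<-|[]]]; auto.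
    + apply OrE with (A := A) (B := B); [apply Hyp; simpl; auto| |apply Hyp; simpl; auto].
      apply RAA. apply ImpE with (A := A); apply Hyp; simpl; auto.
  - intros [h|h].
    + apply Tr_closed with (L := [A]); [intros C [<-|[]]; auto|].
      apply OrI1, Hyp; simpl; auto.
    + apply Tr_closed with (L := [B]); [intros C [<-|[]]; auto|].
      apply OrI2, Hyp; simpl; auto.
Qed.

Lemma Tr_All_E {G s} (B : form (s :: G)) e d : Tr (All s B) e -> Tr B (econs d e).
Proof.
  intros h. apply Tr_ev in h as [n hn].
  exists (max n (projT1 d)). destruct (hn (max n (projT1 d))) as [h1 h2]; [lia|].
  split; [apply le_env_econs; [lia|exact h1]|].
  simpl in h2. apply (AllE (lf d (max n (projT1 d)))) in h2. unfold inst in h2.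
  rewrite fsubst_fsubst, up_scons, scomp_idr in h2. now rewrite lfe_econs.
Qed.

Lemma Tr_All {G s} (B : form (s :: G)) e : Tr (All s B) e <-> forall d, Tr B (econs d e).
Proof.
  split; [intros h d; now apply Tr_All_E|intros h].
  destruct (Tr_Henkin (Not B) e) as [h1|[d hd]].
  - apply Tr_closed with (L := [Not (Ex s (Not B))]); [intros C [<-|[]]; auto|].
    apply AllI, RAA. simpl.
    eapply ImpE; [apply Hyp; simpl; right; left; reflexivity|].
    apply ExI with (t := tvar vz). unfold inst. rewrite fsubst_fsubst.
    apply Hyp. left. rewrite up_scons. rewrite (subst_ext_cons _ sid); [|reflexivity..].
    now rewrite fsubst_id.
  - exfalso. apply (Tr_Bot (econs d e)). apply (proj1 (Tr_Imp B Bot _) hd), h.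
Qed.

Definition pre_app {s r} (f : PreD (s ⇒ r)) (x : PreD s) : PreD r :=
  let n := max (projT1 f) (projT1 x) in existT _ n (tapp (lf f n) (lf x n)).

Definition pre : structure := {|
  Dom := PreD;
  ap := @pre_app;
  interp s c := existT _ 0 (tcst c);
  ltD x y := Tr (v1 ≺ v0) (econs y (econs x enil)) |}.

Definition pre_eq (x y : PreD N) : Prop := Tr (v1 ≐ v0) (econs y (econs x enil)).

Lemma eval_pre_le {G s} (t : term G s) (e : env PreD G) n :
  le_env e n -> projT1 (eval pre e t) <= n.
Proof. intros h. induction t; simpl; auto; lia. Qed.

Lemma eval_pre {G s} (t : term G s) (e : env PreD G) n :
  le_env e n -> lf (eval pre e t) n = tsubst (lfe e n) t.
Proof.
  intros h. induction t; simpl.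
  - reflexivity.
  - reflexivity.
  - pose proof (eval_pre_le t1 e n h). pose proof (eval_pre_le t2 e n h).
    unfold lf at 1. unfold pre_app; simpl. rewrite !lf_W by lia. congruence.
Qed.

(** The relations of [pre] evaluate a fixed two-variable formula at the values of the terms; this is
    compared with substituting the terms themselves. *)
Lemma Tr_atom {G} (B : form [N; N]) (t u : term G N) (e : env PreD G) :
  Tr B (econs (eval pre e u) (econs (eval pre e t) enil)) <->
  Tr (fsubst (scons u (scons t snil)) B) e.
Proof.
  set (e' := econs (eval pre e u) (econs (eval pre e t) enil)).
  assert (hs : forall n, le_env e n ->
    scomp (scons u (scons t snil)) (lfe e n) = lfe e' n).
  { intros n hn. unfold e'. rewrite !lfe_econs.
    change (Dom pre N) with (PreD N). rewrite !eval_pre by exact hn.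
    rewrite !scons_scomp. do 2 f_equal.
    apply subst_ext; intros s x; destruct (var_nil _ x). }
  split; intros h.
  - apply Tr_ev in h as [n hn]. destruct (le_env_ex e) as [k hk].
    exists (max n k). assert (le_env e (max n k)) by (apply le_env_mono with (1 := hk); lia).
    split; [assumption|]. rewrite fsubst_fsubst, hs by assumption. apply hn. lia.
  - destruct h as (n & h1 & h2). exists n.
    rewrite fsubst_fsubst, hs in h2 by assumption. split; [|exact h2].
    repeat apply le_env_econs; auto using eval_pre_le.
    intros s x; destruct (var_nil _ x).
Qed.

Lemma pre_truth {G} (A : form G) : forall e, satR pre pre_eq A e <-> Tr A e.
Proof.
  induction A; intros e; simpl.
  - apply (Tr_atom (v1 ≐ v0)).
  - apply (Tr_atom (v1 ≺ v0)).
  - split; [tauto|apply Tr_Bot].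
  - rewrite Tr_And, IHA1, IHA2. reflexivity.
  - rewrite Tr_Or, IHA1, IHA2. reflexivity.
  - rewrite Tr_Imp, IHA1, IHA2. reflexivity.
  - rewrite Tr_All. split; intros h d; apply IHA, h.
  - rewrite Tr_Ex. split; intros [d h]; exists d; apply IHA, h.
Qed.

Lemma pre_axioms A : T A -> satR pre pre_eq A enil.
Proof.
  intros h. apply pre_truth. apply Tr_closed with (L := []); [intros B []|].
  rewrite <- (fsubst_id A).
  replace (@sid []) with (@snil []) by (apply subst_ext; intros s x; destruct (var_nil _ x)).
  now apply Ax.
Qed.

Lemma pre_A0 : ~ satR pre pre_eq A0 enil.
Proof.
  rewrite pre_truth. intros h. apply (Tr_Bot (@enil PreD)).
  apply Tr_closed with (L := [A0; Not A0]).
  - intros B [<-|[<-|[]]]; [exact h|]. exists 0. split; [intros s x; destruct (var_nil _ x)|].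
    apply Hyp. left. rewrite <- (fsubst_id (Not A0)) at 1. f_equal.
    apply subst_ext; intros s x; destruct (var_nil _ x).
  - apply ImpE with (A := A0); apply Hyp; simpl; auto.
Qed.

End Henkin.

(** * Quotients by chosen representatives *)

Section Quotient.
Variable X : Type.
Variable R : X -> X -> Prop.
Hypothesis R_refl : forall x, R x x.
Hypothesis R_sym : forall x y, R x y -> R y x.
Hypothesis R_trans : forall x y z, R x y -> R y z -> R x z.

Definition canon (x : X) : X := epsilon (inhabits x) (fun y => R x y).

Lemma canon_R x : R x (canon x).
Proof. unfold canon. apply epsilon_spec. now exists x. Qed.

(** Equivalent elements have the same class as a predicate, by propositional extensionality, and
    [epsilon] then makes the same choice for both. *)
Lemma canon_eq x y : R x y -> canon x = canon y.
Proof.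
  intros h. unfold canon. rewrite (proof_irrelevance _ (inhabits x) (inhabits y)).
  f_equal. apply functional_extensionality; intros z.
  apply propositional_extensionality. split; eauto.
Qed.

Definition quot : Type := {x : X | canon x = x}.
Definition cls (x : X) : quot :=
  exist _ (canon x) (eq_sym (canon_eq x (canon x) (canon_R x))).
Definition rep (q : quot) : X := proj1_sig q.

Lemma cls_rep q : cls (rep q) = q.
Proof.
  destruct q as [x h]. unfold cls, rep; simpl.
  apply eq_sig_hprop; [intros; apply proof_irrelevance|exact h].
Qed.

Lemma rep_cls x : R x (rep (cls x)).
Proof. apply canon_R. Qed.

Lemma cls_eq x y : cls x = cls y <-> R x y.
Proof.
  split; intros h.
  - apply R_trans with (rep (cls x)); [apply rep_cls|]. rewrite h. apply R_sym, rep_cls.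
  - apply eq_sig_hprop; [intros; apply proof_irrelevance|]. now apply canon_eq.
Qed.
End Quotient.

(** * The extensional collapse and the completeness theorem *)

Definition ext_ax (r t : ty) : form [] :=
  All (r ⇒ t) (All r (All r (eqT v1 v0 ⟶ eqT (v2 · v1) (v2 · v0)))).

Section ExtensionalCollapse.
Variable P : structure.
Variable E : Dom P N -> Dom P N -> Prop.
Hypothesis E_refl : forall x, E x x.
Hypothesis E_sym : forall x y, E x y -> E y x.
Hypothesis E_trans : forall x y z, E x y -> E y z -> E x z.
Hypothesis E_lt : forall x x' y y', E x x' -> E y y' -> ltD x y -> ltD x' y'.
Hypothesis E_ext : forall r t, satR P E (ext_ax r t) enil.

Fixpoint EQ (s : ty) : Dom P s -> Dom P s -> Prop :=
  match s with
  | N => E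
  | s' ⇒ r => fun f g => forall x : Dom P s', EQ r (ap f x) (ap g x)
  end.

Lemma EQ_refl s : forall x, EQ s x x.
Proof. induction s; simpl; auto. Qed.
Lemma EQ_sym s : forall x y, EQ s x y -> EQ s y x.
Proof. induction s; simpl; auto. Qed.
Lemma EQ_trans s : forall x y z, EQ s x y -> EQ s y z -> EQ s x z.
Proof. induction s; simpl; eauto. Qed.

Lemma satR_eqT G s : forall (t u : term G s) e,
  satR P E (eqT t u) e <-> EQ s (eval P e t) (eval P e u).
Proof.
  revert G. induction s as [|s IHs r IHr]; intros G t u e; simpl; [reflexivity|].
  split; intros h d; specialize (h d); rewrite IHr in *; simpl in *;
    rewrite !eval_wk in *; exact h.
Qed.

(** Here the extensionality axioms of the theory enter: they make application well defined on the
    classes of [EQ]. *)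
Lemma EQ_ap s r (f : Dom P (s ⇒ r)) x y : EQ s x y -> EQ r (ap f x) (ap f y).
Proof.
  intros h. pose proof (E_ext s r f x y) as H. simpl in H. rewrite !satR_eqT in H.
  apply H, h.
Qed.

Definition collapse_cls {s} (x : Dom P s) := cls _ _ (EQ_refl s) (EQ_sym s) (EQ_trans s) x.

Definition collapse : structure := {|
  Dom s := quot (Dom P s) (EQ s);
  ap s r f x := collapse_cls (ap (rep _ _ f) (rep _ _ x));
  interp s c := collapse_cls (interp P c);
  ltD x y := ltD (rep _ _ x) (rep _ _ y) |}.

Lemma collapse_cls_eq s (x y : Dom P s) : collapse_cls x = collapse_cls y <-> EQ s x y.
Proof. apply cls_eq. Qed.

Lemma collapse_rep s (x : Dom collapse s) : exists y, x = collapse_cls y.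
Proof. exists (rep _ _ x). symmetry. exact (cls_rep _ _ (EQ_refl s) (EQ_sym s) (EQ_trans s) x). Qed.

Lemma collapse_rep_cls s (x : Dom P s) : EQ s x (rep _ _ (collapse_cls x)).
Proof. unfold collapse_cls. exact (rep_cls _ _ (EQ_refl s) (EQ_sym s) (EQ_trans s) x). Qed.

Lemma collapse_ap s r (f : Dom P (s ⇒ r)) (x : Dom P s) :
  @ap collapse _ _ (collapse_cls f) (collapse_cls x) = collapse_cls (ap f x).
Proof.
  apply collapse_cls_eq. apply EQ_sym. eapply EQ_trans.
  - apply (collapse_rep_cls _ f x).
  - apply EQ_ap, collapse_rep_cls.
Qed.

Lemma collapse_extensional : extensional collapse.
Proof.
  intros s r f g h. destruct (collapse_rep _ f) as [f' ->], (collapse_rep _ g) as [g' ->].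
  apply collapse_cls_eq. intros x. apply collapse_cls_eq.
  rewrite <- !collapse_ap. apply h.
Qed.

Lemma eval_collapse G s (t : term G s) e :
  eval collapse (fun r x => collapse_cls (e r x)) t = collapse_cls (eval P e t).
Proof.
  induction t; cbn [eval]; try reflexivity. rewrite IHt1, IHt2. apply collapse_ap.
Qed.

Lemma econs_collapse G s (d : Dom P s) (e : env (Dom P) G) :
  econs (D := Dom collapse) (collapse_cls d) (fun r x => collapse_cls (e r x)) =
  fun r x => collapse_cls (econs d e r x).
Proof. now apply env_ext_cons. Qed.

Lemma sat_collapse G (A : form G) : forall e,
  sat collapse A (fun r x => collapse_cls (e r x)) <-> satR P E A e.
Proof.
  induction A; intros e; cbn [satR]; rewrite ?eval_collapse, ?IHA1, ?IHA2; try reflexivity.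
  - apply collapse_cls_eq.
  - assert (h : forall x y, @ltD collapse (collapse_cls x) (collapse_cls y) <-> ltD x y).
    { intros x y. pose proof (collapse_rep_cls N x) as hx.
      pose proof (collapse_rep_cls N y) as hy. split; apply E_lt; auto. }
    apply h.
  - split; intros h d.
    + apply IHA. rewrite <- econs_collapse. apply h.
    + destruct (collapse_rep _ d) as [d' ->]. rewrite econs_collapse. apply IHA, h.
  - split; intros [d h].
    + destruct (collapse_rep _ d) as [d' ->]. exists d'. apply IHA.
      now rewrite <- econs_collapse.
    + exists (collapse_cls d). rewrite econs_collapse. now apply IHA.
Qed.

Lemma sat_collapse_closed (A : form []) : sat collapse A enil <-> satR P E A enil.
Proof.
  rewrite <- (sat_collapse [] A enil).
  now rewrite (env_nil (D := Dom collapse) (fun r x => collapse_cls (@enil (Dom P) r x))).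
Qed.
End ExtensionalCollapse.

Theorem completeness (T : theory) (A : form []) :
  (forall r t, T (ext_ax r t)) ->
  (forall M, extensional M -> models M T -> sat M A enil) -> T ⊢ A.
Proof.
  intros Hext HA. apply NNPP. intros unprovable.
  pose (P := pre T A). pose (E := pre_eq T A).
  (* Pure logic suffices to make equality and order compatible in the term model: each law below is
     derived without hypotheses and is therefore true there. *)
  assert (taut : forall G (B : form G) (e : env (Dom P) G), prv T [] B -> satR P E B e).
  { intros G B e h. apply pre_truth; [exact unprovable|]. apply Tr_closed with (2 := h). intros C []. }
  assert (E_refl : forall x : Dom P N, E x x).
  { intros x. apply (taut [N] (v0 ≐ v0) (econs x enil)), EqRefl. }
  assert (E_sym : forall x y : Dom P N, E x y -> E y x).
  { intros x y. apply (taut [N; N] (v0 ≐ v1 ⟶ v1 ≐ v0) (econs x (econs y enil))).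
    apply ImpI. change (v1 ≐ v0) with (inst (G := [N; N]) (v0 ≐ v1) v1).
    apply EqSubst with (t := v0); [apply Hyp; now left|apply EqRefl]. }
  assert (E_trans : forall x y z : Dom P N, E x y -> E y z -> E x z).
  { intros x y z.
    apply (taut [N; N; N] (v0 ≐ v1 ⟶ v1 ≐ v2 ⟶ v0 ≐ v2) (econs x (econs y (econs z enil)))).
    do 2 apply ImpI. change (v0 ≐ v2) with (inst (G := [N; N; N]) (v1 ≐ v0) v2).
    apply EqSubst with (t := v1); apply Hyp; simpl; auto. }
  assert (E_lt : forall x x' y y' : Dom P N, E x x' -> E y y' -> ltD x y -> ltD x' y').
  { intros x x' y y'.
    apply (taut [N; N; N; N] (v0 ≐ v1 ⟶ v2 ≐ v3 ⟶ v0 ≺ v2 ⟶ v1 ≺ v3)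
      (econs x (econs x' (econs y (econs y' enil))))).
    do 3 apply ImpI. change (v1 ≺ v3) with (inst (G := [N; N; N; N]) (v2 ≺ v0) v3).
    apply EqSubst with (t := v2); [apply Hyp; simpl; auto|].
    change (inst (v2 ≺ v0) v2) with (inst (G := [N; N; N; N]) (v0 ≺ v3) v1).
    apply EqSubst with (t := v0); apply Hyp; simpl; auto. }
  assert (E_ext : forall r t, satR P E (ext_ax r t) enil)
    by (intros; apply pre_axioms; [exact unprovable|apply Hext]).
  apply (pre_A0 T A unprovable).
  apply (sat_collapse_closed P E E_refl E_sym E_trans E_lt E_ext).
  apply HA; [now apply collapse_extensional|].
  intros B hB. apply sat_collapse_closed; auto. now apply pre_axioms.
Qed.

(** * The ordered field of fractions of a discretely ordered semiring *)

Record ordered_semiring (D : Type) (o l : D) (add mul : D -> D -> D) (lt : D -> D -> Prop) :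
  Prop := {
  osr_addA : forall x y z, add (add x y) z = add x (add y z);
  osr_addC : forall x y, add x y = add y x;
  osr_mulA : forall x y z, mul (mul x y) z = mul x (mul y z);
  osr_mulC : forall x y, mul x y = mul y x;
  osr_distr : forall x y z, mul x (add y z) = add (mul x y) (mul x z);
  osr_add0 : forall x, add x o = x;
  osr_mul0 : forall x, mul x o = o;
  osr_mul1 : forall x, mul x l = x;
  osr_trans : forall x y z, lt x y -> lt y z -> lt x z;
  osr_irrefl : forall x, ~ lt x x;
  osr_total : forall x y, lt x y \/ x = y \/ lt y x;
  osr_ltadd : forall x y z, lt x y -> lt (add x z) (add y z);
  osr_ltmul : forall x y z, lt o z -> lt x y -> lt (mul x z) (mul y z);
  osr_sub : forall x y, lt x y -> exists z, add x z = y;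
  osr_lt01 : lt o l;
  osr_discrete : forall x, lt o x -> lt l x \/ l = x;
  osr_ge0 : forall x, lt o x \/ o = x }.

Section Fractions.
Variables (D : Type) (o l : D) (add mul : D -> D -> D) (lt : D -> D -> Prop).
Hypothesis H : ordered_semiring D o l add mul lt.

Local Infix "+" := add.
Local Infix "*" := mul.
Local Infix "<" := lt.

Lemma osr_srt : semi_ring_theory o l add mul eq.
Proof.
  constructor; intros; try symmetry.
  - symmetry. rewrite (osr_addC _ _ _ _ _ _ H). apply (osr_add0 _ _ _ _ _ _ H).
  - apply (osr_addC _ _ _ _ _ _ H).
  - apply (osr_addA _ _ _ _ _ _ H).
  - symmetry. rewrite (osr_mulC _ _ _ _ _ _ H). apply (osr_mul1 _ _ _ _ _ _ H).
  - symmetry. rewrite (osr_mulC _ _ _ _ _ _ H). apply (osr_mul0 _ _ _ _ _ _ H).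
  - apply (osr_mulC _ _ _ _ _ _ H).
  - apply (osr_mulA _ _ _ _ _ _ H).
  - symmetry. rewrite !(fun x => osr_mulC _ _ _ _ _ _ H x p). apply (osr_distr _ _ _ _ _ _ H).
Qed.
Add Ring osr_ring : osr_srt.

Local Notation le x y := (lt x y \/ x = y).

Lemma osr_succ_pos c : o < c + l.
Proof.
  destruct (osr_ge0 _ _ _ _ _ _ H c) as [h|<-].
  - apply (osr_trans _ _ _ _ _ _ H) with c; [exact h|].
    pose proof (osr_ltadd _ _ _ _ _ _ H _ _ c (osr_lt01 _ _ _ _ _ _ H)) as h'.
    now replace (o + c) with c in h' by ring; replace (l + c) with (c + l) in h' by ring.
  - replace (o + l) with l by ring. apply (osr_lt01 _ _ _ _ _ _ H).
Qed.

Lemma osr_ltadd_iff x y z : x + z < y + z <-> x < y.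
Proof.
  split; [|apply (osr_ltadd _ _ _ _ _ _ H)]. intros h.
  destruct (osr_total _ _ _ _ _ _ H x y) as [h'|[->|h']]; [exact h'| |].
  - destruct (osr_irrefl _ _ _ _ _ _ H _ h).
  - apply (osr_ltadd _ _ _ _ _ _ H) with (z := z) in h'.
    destruct (osr_irrefl _ _ _ _ _ _ H (x + z)). eapply (osr_trans _ _ _ _ _ _ H); eauto.
Qed.

Lemma osr_addI x y z : x + z = y + z -> x = y.
Proof.
  intros h. destruct (osr_total _ _ _ _ _ _ H x y) as [h'|[h'|h']]; [|exact h'|];
    apply (osr_ltadd _ _ _ _ _ _ H) with (z := z) in h'; rewrite h in h';
    destruct (osr_irrefl _ _ _ _ _ _ H _ h').
Qed.

Lemma osr_ltmul_iff x y c : x * (c + l) < y * (c + l) <-> x < y.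
Proof.
  split; [|apply (osr_ltmul _ _ _ _ _ _ H), osr_succ_pos]. intros h.
  destruct (osr_total _ _ _ _ _ _ H x y) as [h'|[->|h']]; [exact h'| |].
  - destruct (osr_irrefl _ _ _ _ _ _ H _ h).
  - apply (osr_ltmul _ _ _ _ _ _ H) with (z := c + l) in h'; [|apply osr_succ_pos].
    destruct (osr_irrefl _ _ _ _ _ _ H (x * (c + l))). eapply (osr_trans _ _ _ _ _ _ H); eauto.
Qed.

Lemma osr_mulI x y c : x * (c + l) = y * (c + l) -> x = y.
Proof.
  intros h. destruct (osr_total _ _ _ _ _ _ H x y) as [h'|[h'|h']]; [|exact h'|];
    apply (osr_ltmul_iff _ _ c) in h'; rewrite h in h';
    destruct (osr_irrefl _ _ _ _ _ _ H _ h').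
Qed.

Lemma osr_pred x : o < x -> exists y, x = y + l.
Proof.
  intros h. destruct (osr_discrete _ _ _ _ _ _ H x h) as [h'|<-].
  - destruct (osr_sub _ _ _ _ _ _ H _ _ h') as [y <-]. exists y. ring.
  - exists o. ring.
Qed.

Lemma osr_sub_succ x y : x < y -> exists z, y = x + z + l.
Proof.
  intros h. destruct (osr_sub _ _ _ _ _ _ H _ _ h) as [z <-].
  destruct (osr_pred z) as [w ->].
  - apply (osr_ltadd_iff _ _ x). replace (o + x) with x by ring. now replace (z + x) with (x + z) by ring.
  - exists w. ring.
Qed.

Lemma osr_le_iff x y : le x y <-> exists z, y = x + z.
Proof.
  split.
  - intros [h1| ->]; [destruct (osr_sub_succ _ _ h1) as [z ->]; exists (z + l)|exists o]; ring.
  - intros [z ->]. destruct (osr_ge0 _ _ _ _ _ _ H z) as [h1|<-]; [left|right; ring].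
    apply (osr_ltadd_iff _ _ x) in h1.
    now replace (o + x) with x in h1 by ring; replace (z + x) with (x + z) in h1 by ring.
Qed.

(** [(a, b, c)] represents [(a - b) / (c + 1)]. *)
Inductive raw := Raw (a b c : D).

(** Cross-multiplication with the negative parts moved to the other side, since a semiring has no
    subtraction. Denominators of the form [c + l] are positive without any side condition. *)
Definition raw_eq (x y : raw) : Prop :=
  let (a, b, c) := x in let (a', b', c') := y in
  a * (c' + l) + b' * (c + l) = a' * (c + l) + b * (c' + l).

Lemma raw_eq_refl x : raw_eq x x.
Proof. destruct x; reflexivity. Qed.
Lemma raw_eq_sym x y : raw_eq x y -> raw_eq y x.
Proof. destruct x, y; simpl. intros h. rewrite <- h. ring. Qed.
Lemma raw_eq_trans x y z : raw_eq x y -> raw_eq y z -> raw_eq x z.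
Proof.
  destruct x as [a b c], y as [a' b' c'], z as [a'' b'' c'']; simpl; intros h1 h2.
  (* The middle fraction is eliminated by multiplying with its denominator and adding its negative
     part on both sides. *)
  apply (osr_mulI _ _ c'). apply (osr_addI _ _ (b' * (c + l) * (c'' + l))).
  transitivity ((c'' + l) * (a * (c' + l) + b' * (c + l)) + b'' * (c' + l) * (c + l)); [ring|].
  rewrite h1.
  transitivity ((c + l) * (a' * (c'' + l) + b'' * (c' + l)) + b * (c' + l) * (c'' + l)); [ring|].
  rewrite h2. ring.
Qed.

Definition fracT : Type := quot raw raw_eq.
Definition fr (a b c : D) : fracT := cls _ _ raw_eq_refl raw_eq_sym raw_eq_trans (Raw a b c).

Lemma fr_eq a b c a' b' c' :
  fr a b c = fr a' b' c' <->
  a * (c' + l) + b' * (c + l) = a' * (c + l) + b * (c' + l).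
Proof. apply cls_eq. Qed.

Lemma fr_ex (q : fracT) : exists a b c, q = fr a b c.
Proof.
  pose proof (cls_rep _ _ raw_eq_refl raw_eq_sym raw_eq_trans q) as h.
  destruct (rep _ _ q) as [a b c]. exists a, b, c. now rewrite <- h.
Qed.

(** The new denominator is [(c + l) * (c' + l)], whose predecessor is [c * c' + c + c']. *)
Definition fadd (x y : fracT) : fracT :=
  let (a, b, c) := rep _ _ x in let (a', b', c') := rep _ _ y in
  fr (a * (c' + l) + a' * (c + l)) (b * (c' + l) + b' * (c + l)) (c * c' + c + c').
Definition fmul (x y : fracT) : fracT :=
  let (a, b, c) := rep _ _ x in let (a', b', c') := rep _ _ y in
  fr (a * a' + b * b') (a * b' + b * a') (c * c' + c + c').
Definition fopp (x : fracT) : fracT := let (a, b, c) := rep _ _ x in fr b a c.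
Definition fnn (x : fracT) : Prop := let (a, b, c) := rep _ _ x in le b a.

Lemma fr_rep a b c : exists a' b' c', rep _ _ (fr a b c) = Raw a' b' c' /\
  a * (c' + l) + b' * (c + l) = a' * (c + l) + b * (c' + l).
Proof.
  pose proof (rep_cls _ _ raw_eq_refl raw_eq_sym raw_eq_trans (Raw a b c)) as h.
  change (cls _ _ raw_eq_refl raw_eq_sym raw_eq_trans (Raw a b c)) with (fr a b c) in h.
  destruct (rep _ _ (fr a b c)) as [a' b' c']. now exists a', b', c'.
Qed.

Lemma fadd_fr a b c a' b' c' : fadd (fr a b c) (fr a' b' c') =
  fr (a * (c' + l) + a' * (c + l)) (b * (c' + l) + b' * (c + l)) (c * c' + c + c').
Proof.
  unfold fadd. destruct (fr_rep a b c) as (d & e & f & -> & h1).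
  destruct (fr_rep a' b' c') as (d' & e' & f' & -> & h2). apply fr_eq.
  transitivity ((d * (c + l) + b * (f + l)) * (f' + l) * (c' + l) +
    (d' * (c' + l) + b' * (f' + l)) * (f + l) * (c + l)); [ring|].
  rewrite <- h1, <- h2. ring.
Qed.

Lemma fmul_fr a b c a' b' c' : fmul (fr a b c) (fr a' b' c') =
  fr (a * a' + b * b') (a * b' + b * a') (c * c' + c + c').
Proof.
  unfold fmul. destruct (fr_rep a b c) as (d & e & f & -> & h1).
  destruct (fr_rep a' b' c') as (d' & e' & f' & -> & h2).
  transitivity (fr (a * d' + b * e') (a * e' + b * d') (c * f' + c + f')); apply fr_eq.
  - transitivity ((f' + l) * (d' * (d * (c + l) + b * (f + l)) + e' * (a * (f + l) + e * (c + l))));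
      [ring|].
    rewrite <- h1. rewrite h1 at 2. ring.
  - transitivity ((c + l) * (a * (d' * (c' + l) + b' * (f' + l)) +
      b * (a' * (f' + l) + e' * (c' + l)))); [ring|].
    rewrite <- h2. rewrite h2 at 2. ring.
Qed.

Lemma fopp_fr a b c : fopp (fr a b c) = fr b a c.
Proof.
  unfold fopp. destruct (fr_rep a b c) as (d & e & f & -> & h1). apply fr_eq.
  transitivity (a * (f + l) + e * (c + l)); [ring|]. rewrite h1. ring.
Qed.

Lemma fnn_fr a b c : fnn (fr a b c) <-> le b a.
Proof.
  unfold fnn. destruct (fr_rep a b c) as (d & e & f & -> & h1).
  assert (h2 : lt e d <-> lt b a).
  { rewrite <- (osr_ltmul_iff e d c), <- (osr_ltmul_iff b a f).
    rewrite <- (osr_ltadd_iff (e * (c + l)) _ (a * (f + l))).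
    rewrite <- (osr_ltadd_iff (b * (f + l)) _ (d * (c + l))).
    replace (e * (c + l) + a * (f + l)) with (d * (c + l) + b * (f + l)) by (rewrite <- h1; ring).
    replace (d * (c + l) + b * (f + l)) with (b * (f + l) + d * (c + l)) by ring.
    now replace (d * (c + l) + a * (f + l)) with (a * (f + l) + d * (c + l)) by ring. }
  assert (h3 : e = d <-> b = a).
  { split; intros ->.
    - apply (osr_mulI _ _ f). apply (osr_addI _ _ (d * (c + l))).
      transitivity (d * (c + l) + b * (f + l)); [ring|]. now rewrite <- h1.
    - apply (osr_mulI _ _ c). apply (osr_addI _ _ (a * (f + l))).
      transitivity (a * (f + l) + e * (c + l)); [ring|]. rewrite h1. ring. }
  tauto.
Qed.

Definition f0 : fracT := fr o o o.
Definition f1 : fracT := fr l o o.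
(** Returning [x] itself when no inverse exists yields the convention that the inverse of zero is
    zero. *)
Definition finv (x : fracT) : fracT :=
  match excluded_middle_informative (exists y, fmul y x = f1) with
  | left h => proj1_sig (constructive_indefinite_description _ h)
  | right _ => x
  end.

Ltac fracs := repeat match goal with x : fracT |- _ =>
  let a := fresh "a" in let b := fresh "b" in let c := fresh "c" in
  destruct (fr_ex x) as (a & b & c & ->) end.
Ltac frac_ring := intros; fracs; unfold f0, f1;
  rewrite ?fadd_fr, ?fmul_fr, ?fopp_fr; rewrite ?fadd_fr, ?fmul_fr, ?fopp_fr;
  apply fr_eq; ring.

Lemma faddA x y z : fadd x (fadd y z) = fadd (fadd x y) z.
Proof. frac_ring. Qed.
Lemma faddC x y : fadd x y = fadd y x.
Proof. frac_ring. Qed.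
Lemma fadd0 x : fadd f0 x = x.
Proof. frac_ring. Qed.
Lemma faddN x : fadd (fopp x) x = f0.
Proof. frac_ring. Qed.
Lemma fmulA x y z : fmul x (fmul y z) = fmul (fmul x y) z.
Proof. frac_ring. Qed.
Lemma fmulC x y : fmul x y = fmul y x.
Proof. frac_ring. Qed.
Lemma fmul1 x : fmul f1 x = x.
Proof. frac_ring. Qed.
Lemma fmulDl x y z : fmul (fadd x y) z = fadd (fmul x z) (fmul y z).
Proof. frac_ring. Qed.

Lemma fone_neq0 : f1 <> f0.
Proof.
  unfold f0, f1. rewrite fr_eq. intros h. apply (osr_irrefl _ _ _ _ _ _ H o).
  replace o with (o * (o + l) + o * (o + l)) at 2 by ring. rewrite <- h.
  replace (l * (o + l) + o * (o + l)) with l by ring. apply (osr_lt01 _ _ _ _ _ _ H).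
Qed.

Lemma finvP x : x <> f0 -> fmul (finv x) x = f1.
Proof.
  intros hx. unfold finv. destruct excluded_middle_informative as [h|h];
    [now destruct constructive_indefinite_description|].
  exfalso. apply h. clear h. fracs. unfold f0, f1 in *. rewrite fr_eq in hx.
  destruct (osr_total _ _ _ _ _ _ H a b) as [h|[->|h]]; [| |];
    [|destruct hx; ring|]; apply osr_sub_succ in h as [z ->].
  (* Here the fraction is [- (z + 1) / (c + 1)], so its inverse is [- (c + 1) / (z + 1)]; the next
     case is the same with positive sign. *)
  - exists (fr o (c + l) z). rewrite fmul_fr. apply fr_eq. ring.
  - exists (fr (c + l) o z). rewrite fmul_fr. apply fr_eq. ring.
Qed.

Lemma finv0 : finv f0 = f0.
Proof.
  unfold finv. destruct excluded_middle_informative as [[y h]|h]; [exfalso|reflexivity].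
  apply fone_neq0. rewrite <- h. clear h. frac_ring.
Qed.

Lemma fnn_add x y : fnn x -> fnn y -> fnn (fadd x y).
Proof.
  destruct (fr_ex x) as (a & b & c & ->), (fr_ex y) as (a' & b' & c' & ->).
  rewrite fadd_fr, !fnn_fr. intros h h'.
  rewrite osr_le_iff in *. destruct h as [z ->], h' as [z' ->].
  exists (z * (c' + l) + z' * (c + l)). ring.
Qed.

Lemma fnn_mul x y : fnn x -> fnn y -> fnn (fmul x y).
Proof.
  fracs. rewrite fmul_fr, !fnn_fr. intros h h'.
  rewrite osr_le_iff in *. destruct h as [z ->], h' as [z' ->].
  exists (z * z'). ring.
Qed.

Lemma fnn_anti x : fnn x -> fnn (fopp x) -> x = f0.
Proof.
  fracs. rewrite fopp_fr, !fnn_fr. unfold f0. rewrite fr_eq.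
  intros [h| ->] [h'|h']; try (subst; ring).
  destruct (osr_irrefl _ _ _ _ _ _ H a). eapply (osr_trans _ _ _ _ _ _ H); eauto.
Qed.

Lemma fnn_total x : fnn x \/ fnn (fopp x).
Proof.
  fracs. rewrite fopp_fr, !fnn_fr.
  destruct (osr_total _ _ _ _ _ _ H a b) as [h|[->|h]]; auto.
Qed.

Definition fnat (x : D) : fracT := fr x o o.

Lemma fnat_add x y : fnat (x + y) = fadd (fnat x) (fnat y).
Proof. unfold fnat. rewrite fadd_fr. apply fr_eq. ring. Qed.
Lemma fnat_mul x y : fnat (x * y) = fmul (fnat x) (fnat y).
Proof. unfold fnat. rewrite fmul_fr. apply fr_eq. ring. Qed.
Lemma fnat_le x y : fnn (fadd (fnat y) (fopp (fnat x))) <-> le x y.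
Proof.
  unfold fnat. rewrite fopp_fr, fadd_fr, fnn_fr.
  now replace (o * (o + l) + x * (o + l)) with x by ring;
    replace (y * (o + l) + o * (o + l)) with y by ring.
Qed.
Lemma fr_fnat a b c : fmul (fr a b c) (fnat (c + l)) = fadd (fnat a) (fopp (fnat b)).
Proof. unfold fnat. rewrite fopp_fr, fadd_fr, fmul_fr. apply fr_eq. ring. Qed.
End Fractions.

(** * The fractions as a real field *)

Module FractionField.
Import ssreflect ssrfun ssrbool eqtype choice ssrnat order ssralg ssrnum.
Import Order.TTheory GRing.Theory Num.Theory.
Local Open Scope ring_scope.

Definition pbool (P : Prop) : bool := if excluded_middle_informative P then true else false.
Lemma pboolP (P : Prop) : reflect P (pbool P).
Proof. by rewrite /pbool; case: excluded_middle_informative => h; constructor. Qed.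

Section Field.
Variables (D : Type) (o l : D) (add mul : D -> D -> D) (lt : D -> D -> Prop).
Hypothesis H : ordered_semiring D o l add mul lt.

Definition K : Type := fracT D l add mul.

Lemma K_eqP : Equality.axiom (fun x y : K => pbool (x = y)).
Proof. move=> x y. exact: pboolP. Qed.
HB.instance Definition _ := hasDecEq.Build K K_eqP.

Definition K_find (P : pred K) (n : nat) : option K :=
  match excluded_middle_informative (exists x, P x) with
  | left h => Some (proj1_sig (constructive_indefinite_description _ h))
  | right _ => None
  end.
Lemma K_find_correct (P : pred K) n x : K_find P n = Some x -> P x.
Proof.
  rewrite /K_find; case: excluded_middle_informative => // h [<-].
  by case: constructive_indefinite_description.
Qed.
Lemma K_find_complete (P : pred K) : (exists x, P x) -> exists n, K_find P n.
Proof. by move=> h; exists 0%N; rewrite /K_find; case: excluded_middle_informative. Qed.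
Lemma K_find_ext (P Q : pred K) : P =1 Q -> K_find P =1 K_find Q.
Proof. by move=> h; have -> : P = Q by exact: functional_extensionality. Qed.
HB.instance Definition _ := hasChoice.Build K K_find_correct K_find_complete K_find_ext.

HB.instance Definition _ := GRing.isZmodule.Build K
  (faddA D o l add mul lt H) (faddC D o l add mul lt H)
  (fadd0 D o l add mul lt H) (faddN D o l add mul lt H).

Lemma K_one_neq0 : (f1 D o l add mul lt H : K) != 0.
Proof. by apply/eqP; apply: fone_neq0. Qed.
HB.instance Definition _ := GRing.Zmodule_isComNzRing.Build K
  (fmulA D o l add mul lt H) (fmulC D o l add mul lt H)
  (fmul1 D o l add mul lt H) (fmulDl D o l add mul lt H) K_one_neq0.

Lemma K_mulVf (x : K) : x != 0 -> (finv D o l add mul lt H x : K) * x = 1.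
Proof. by move/eqP => h; apply: finvP. Qed.
HB.instance Definition _ := GRing.ComNzRing_isField.Build K K_mulVf (finv0 D o l add mul lt H).

Definition K_nn (x : K) : bool := pbool (fnn D l add mul lt x).
Definition K_le (x y : K) : bool := K_nn (y - x).
Definition K_lt (x y : K) : bool := (y != x) && K_le x y.
Definition K_norm (x : K) : K := if K_nn x then x else - x.

Lemma K_le0 (x : K) : K_le 0 x = K_nn x.
Proof. by rewrite /K_le subr0. Qed.
Lemma K_le0_add (x y : K) : K_le 0 x -> K_le 0 y -> K_le 0 (x + y).
Proof. by rewrite !K_le0 => /pboolP hx /pboolP hy; apply/pboolP; apply: fnn_add. Qed.
Lemma K_le0_mul (x y : K) : K_le 0 x -> K_le 0 y -> K_le 0 (x * y).
Proof. by rewrite !K_le0 => /pboolP hx /pboolP hy; apply/pboolP; apply: fnn_mul. Qed.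
Lemma K_le0_anti (x : K) : K_le 0 x -> K_le x 0 -> x = 0.
Proof.
  by rewrite K_le0 /K_le sub0r => /pboolP hx /pboolP hy; apply: fnn_anti.
Qed.
Lemma K_sub_ge0 (x y : K) : K_le 0 (y - x) = K_le x y.
Proof. by rewrite K_le0. Qed.
Lemma K_le0_total (x : K) : K_le 0 x || K_le x 0.
Proof.
  rewrite K_le0 /K_le sub0r; apply/orP.
  by case: (fnn_total D o l add mul lt H x) => h; [left|right]; apply/pboolP.
Qed.
Lemma K_normN (x : K) : K_norm (- x) = K_norm x.
Proof.
  rewrite /K_norm opprK; case: ifP => h1; case: ifP => h2 //.
  - have -> : x = 0 by apply: K_le0_anti; rewrite ?K_le0 // /K_le sub0r.
    by rewrite oppr0.
  - by have := K_le0_total x; rewrite K_le0 /K_le sub0r h1 h2.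
Qed.
Lemma K_ge0_norm (x : K) : K_le 0 x -> K_norm x = x.
Proof. by rewrite K_le0 /K_norm => ->. Qed.
Lemma K_lt_def (x y : K) : K_lt x y = (y != x) && K_le x y.
Proof. by []. Qed.
HB.instance Definition _ := Num.IntegralDomain_isLeReal.Build K
  K_le0_add K_le0_mul K_le0_anti K_sub_ge0 K_le0_total K_normN K_ge0_norm K_lt_def.

(** The interface through which the field is used from here on: an ordered semiring embedding [i],
    and the fact that every element is a fraction of embedded numbers. The latter yields
    definability and the Archimedean property relative to [D]. *)
Lemma fraction_field : exists (K : realFieldType) (i : D -> K),
  i o = 0 /\ i l = 1 /\ (forall x y, i (add x y) = i x + i y) /\
  (forall x y, i (mul x y) = i x * i y) /\ (forall x y, lt x y <-> i x < i y) /\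
  (forall x y, i x = i y -> x = y) /\
  (forall q, exists a b c, q * (i c + 1) = i a - i b).
Proof.
  pose i : D -> K := fnat D o l add mul lt H. exists (K : realFieldType), i.
  have le_i x y : i x <= i y <-> lt x y \/ x = y.
    by rewrite -(fnat_le D o l add mul lt H); split => [/pboolP //|h]; apply/pboolP.
  have inj x y : i x = i y -> x = y.
    move=> h. have h1 := proj1 (le_i x y); have h2 := proj1 (le_i y x).
    rewrite h lexx in h1 h2.
    case: (h1 isT) => // lt1; case: (h2 isT) => // lt2.
    case: (osr_irrefl _ _ _ _ _ _ H x). exact: (osr_trans _ _ _ _ _ _ H _ _ _ lt1 lt2).
  split; first by [].
  split; first by [].
  split; first exact: fnat_add.
  split; first exact: fnat_mul.
  split.
    move=> x y; rewrite lt_neqAle; split.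
    - move=> h; apply/andP; split; last by apply/le_i; left.
      apply/eqP => /inj e. by rewrite e in h; apply: (osr_irrefl _ _ _ _ _ _ H y).
    - move/andP => [/eqP ne /le_i [//|e]]. by rewrite e in ne.
  split => //.
  move=> q; case: (fr_ex D o l add mul lt H q) => a [b [c ->]]; exists a, b, c.
  have := fr_fnat D o l add mul lt H a b c. by rewrite fnat_add.
Qed.
End Field.
End FractionField.

(** * Definability and primitive recursion inside an extensional model of the base theory *)

Module Arithmetic.
Import ssreflect ssrfun ssrbool eqtype choice ssrnat order ssralg ssrnum ring lra.
Import Order.TTheory GRing.Theory Num.Theory.
Local Open Scope ring_scope.

Lemma sat_eqT (M : structure) (HE : extensional M) s : forall G (t u : term G s) e,
  sat M (eqT t u) e <-> eval M e t = eval M e u.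
Proof.
  induction s as [|s IHs r IHr]; intros G t u e; simpl; [reflexivity|]. split.
  - intros h. apply HE. intros x. specialize (h x). rewrite IHr in h. simpl in h.
    by rewrite !eval_wk in h.
  - intros h d. rewrite IHr. simpl. by rewrite !eval_wk h.
Qed.

Section Model.
Variable M : structure.
Hypothesis HE : extensional M.
Hypothesis HM : models M RCA0w.

Definition nat0 : Dom M N := interp M CZero.
Definition nat1 : Dom M N := interp M COne.
Definition addN (x y : Dom M N) : Dom M N := ap (ap (interp M CAdd) x) y.
Definition mulN (x y : Dom M N) : Dom M N := ap (ap (interp M CMul) x) y.

Lemma model_osr : ordered_semiring (Dom M N) nat0 nat1 addN mulN (@ltD M).
Proof.
  have h A (hA : semiring_ax A) := HM _ (rca_semiring hA).
  constructor; intros.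
  - exact (h _ add_assoc x y z).
  - exact (h _ add_comm x y).
  - exact (h _ mul_assoc x y z).
  - exact (h _ mul_comm x y).
  - exact (h _ distr x y z).
  - exact (h _ add_zero x).
  - exact (h _ mul_zero x).
  - exact (h _ mul_one x).
  - exact (h _ Defs.lt_trans x y z (conj H H0)).
  - exact (h _ Defs.lt_irrefl x).
  - exact (h _ Defs.lt_total x y).
  - exact (h _ Defs.lt_add x y z H).
  - exact (h _ Defs.lt_mul x y z (conj H H0)).
  - exact (h _ Defs.lt_sub x y H).
  - exact (h _ zero_lt_one).
  - exact (h _ Defs.lt_discrete x H).
  - exact (h _ zero_le x).
Qed.

Lemma ap_Pi s r (x : Dom M s) (y : Dom M r) : ap (ap (interp M (CPi s r)) x) y = x.
Proof.
  exact (proj1 (sat_eqT M HE s _ _ _ _) (HM _ (rca_Pi s r) x y)).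
Qed.

Lemma ap_Sigma r s t (f : Dom M (r ⇒ s ⇒ t)) (g : Dom M (r ⇒ s)) (x : Dom M r) :
  ap (ap (ap (interp M (CSigma r s t)) f) g) x = ap (ap f x) (ap g x).
Proof.
  exact (proj1 (sat_eqT M HE t _ _ _ _) (HM _ (rca_Sigma r s t) f g x)).
Qed.

(** Definability with parameters from the model; [Def_lam] is bracket abstraction. *)
Inductive Def : forall G s, (env (Dom M) G -> Dom M s) -> Prop :=
| Def_var G s (x : var G s) : Def G s (fun e => e s x)
| Def_const G s (d : Dom M s) : Def G s (fun _ => d)
| Def_ap G s r (F1 : env (Dom M) G -> Dom M (s ⇒ r)) (F2 : env (Dom M) G -> Dom M s) :
    Def G (s ⇒ r) F1 -> Def G s F2 -> Def G r (fun e => ap (F1 e) (F2 e)).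
Arguments Def {G s} _.

(** The context is a variable of which the shape is inspected only in the conclusion, because
    induction on [Def] needs a general index. *)
Lemma Def_lam G' s (F : env (Dom M) G' -> Dom M s) : Def F ->
  match G' return (env (Dom M) G' -> Dom M s) -> Prop with
  | [] => fun _ => True
  | a :: G => fun F => exists F' : env (Dom M) G -> Dom M (a ⇒ s),
      Def F' /\ forall e x, ap (F' e) x = F (econs x e)
  end F.
Proof.
  induction 1 as [G s x|G s d|G s r F1 F2 h1 IH1 h2 IH2].
  - destruct G as [|a G]; [exact I|]. revert s x. apply var_case.
    + exists (fun _ => ap (ap (interp M (CSigma a (a ⇒ a) a)) (interp M (CPi a (a ⇒ a))))
        (interp M (CPi a a))).
      split; [apply Def_const|]. intros e x. by rewrite ap_Sigma ap_Pi.
    + intros r y. exists (fun e => ap (interp M (CPi r a)) (e r y)). split.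
      * exact: (Def_ap _ _ _ (fun _ => _) (fun e => e r y) (Def_const _ _ _) (Def_var _ _ _)).
      * intros e x. by rewrite ap_Pi.
  - destruct G as [|a G]; [exact I|]. exists (fun e => ap (interp M (CPi s a)) d).
    split; [apply Def_const|]. intros e x. by rewrite ap_Pi.
  - destruct G as [|a G]; [exact I|].
    destruct IH1 as (f1 & d1 & e1), IH2 as (f2 & d2 & e2).
    exists (fun e => ap (ap (interp M (CSigma a s r)) (f1 e)) (f2 e)). split.
    + apply: (Def_ap _ _ _ (fun e => ap (interp M (CSigma a s r)) (f1 e)) f2) => //.
      exact: (Def_ap _ _ _ (fun _ => _) f1 (Def_const _ _ _) d1).
    + intros e x. by rewrite ap_Sigma e1 e2.
Qed.

Definition inhab s : inhabited (Dom M s) := inhabits (eval M enil (dummy s)).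

(** [epsilon] makes abstraction total on all functions of the metatheory. It has its intended
    meaning for definable ones, hence the side condition of [ap_LAM]. *)
Definition LAM {a s} (f : Dom M a -> Dom M s) : Dom M (a ⇒ s) :=
  epsilon (inhab _) (fun g => forall x, ap g x = f x).

Lemma ap_LAM_ex a s (f : Dom M a -> Dom M s) g :
  (forall x, ap g x = f x) -> forall x, ap (LAM f) x = f x.
Proof. intros h. apply (epsilon_spec (inhab _) (fun g => forall x, ap g x = f x)). by exists g. Qed.

Lemma ap_LAM G a s (B : env (Dom M) G -> Dom M a -> Dom M s) :
  Def (G := a :: G) (fun e => B (etail e) (e a vz)) ->
  forall e x, ap (LAM (B e)) x = B e x.
Proof.
  move/Def_lam => [F' [_ h]] e. apply (ap_LAM_ex _ _ _ (F' e)). intros x. exact (h e x).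
Qed.

Lemma Def_ext G s (F F' : env (Dom M) G -> Dom M s) :
  (forall e, F e = F' e) -> Def F -> Def F'.
Proof. intros h. by have -> : F = F' by apply functional_extensionality. Qed.

Lemma Def_LAM G a s (B : env (Dom M) G -> Dom M a -> Dom M s) :
  Def (G := a :: G) (fun e => B (etail e) (e a vz)) -> Def (fun e => LAM (B e)).
Proof.
  intros hB. destruct (Def_lam _ _ _ hB) as (F' & d & h).
  apply: (Def_ext _ _ F') => // e. apply HE => x. rewrite h. symmetry.
  exact: (ap_LAM _ _ _ B hB).
Qed.

Lemma Def_ap1 G s r (f : Dom M (s ⇒ r)) (F : env (Dom M) G -> Dom M s) :
  Def F -> Def (fun e => ap f (F e)).
Proof. exact: (Def_ap _ _ _ (fun _ => f) F (Def_const _ _ _)). Qed.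

Lemma Def_add G (F1 F2 : env (Dom M) G -> Dom M N) :
  Def F1 -> Def F2 -> Def (fun e => addN (F1 e) (F2 e)).
Proof.
  intros h1 h2. apply: (Def_ap _ _ _ (fun e => ap (interp M CAdd) (F1 e)) F2) => //.
  exact: Def_ap1.
Qed.

Lemma Def_mul G (F1 F2 : env (Dom M) G -> Dom M N) :
  Def F1 -> Def F2 -> Def (fun e => mulN (F1 e) (F2 e)).
Proof.
  intros h1 h2. apply: (Def_ap _ _ _ (fun e => ap (interp M CMul) (F1 e)) F2) => //.
  exact: Def_ap1.
Qed.

Definition prec (F : Dom M N -> Dom M N -> Dom M N) (a n : Dom M N) : Dom M N :=
  ap (ap (ap (interp M (CRec N)) (LAM (fun m => LAM (fun r => F m r)))) a) n.

Lemma prec0 F a : prec F a nat0 = a.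
Proof. exact (HM _ rca_rec_zero _ a). Qed.

Lemma precS (F : Dom M N -> Dom M N -> Dom M N) a n :
  Def (G := [N; N]) (fun e => F (e N (vs vz)) (e N vz)) ->
  prec F a (addN n nat1) = F n (prec F a n).
Proof.
  intros h. rewrite /prec. rewrite (HM _ rca_rec_succ _ a n : ap _ (addN n nat1) = _) /=.
  rewrite -/(prec F a n).
  have h1 := ap_LAM [] _ _ (fun e m => LAM (fun r => F m r))
    (Def_LAM [N] _ _ (fun e r => F (e N vz) r) h) enil.
  by rewrite h1 (ap_LAM [N] _ _ (fun e r => F (e N vz) r) h (econs n enil)).
Qed.

Lemma Def_prec G (F : env (Dom M) G -> Dom M N -> Dom M N -> Dom M N) A B :
  Def (G := N :: N :: G) (fun e => F (etail (etail e)) (e N (vs vz)) (e N vz)) ->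
  Def A -> Def B -> Def (fun e => prec (F e) (A e) (B e)).
Proof.
  intros h hA hB. rewrite /prec.
  apply: (Def_ap _ _ _ (fun e => ap (ap (interp M (CRec N)) _) (A e)) B) => //.
  apply: (Def_ap _ _ _ (fun e => ap (interp M (CRec N)) _) A) => //.
  apply: Def_ap1. apply: Def_LAM.
  exact: (Def_LAM (N :: G) _ _ (fun e r => F (etail e) (e N vz) r)).
Qed.

(** A single instance of the induction scheme serves every later induction: both definable functions
    are represented by objects of the model, which become parameters of one equation. *)
Lemma ind_eq (F F' : Dom M N -> Dom M N) :
  Def (G := [N]) (fun e => F (e N vz)) -> Def (G := [N]) (fun e => F' (e N vz)) ->
  F nat0 = F' nat0 -> (forall n, F n = F' n -> F (addN n nat1) = F' (addN n nat1)) ->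
  forall n, F n = F' n.
Proof.
  move=> /Def_lam [f [_ hf]] /Def_lam [f' [_ hf']] h0 hS n.
  have hi := HM _ (@rca_ind [N ⇒ N; N ⇒ N] (v1 · v0 ≐ v2 · v0) I).
  have {}hi := proj1 (satR_closure _ _ _) hi (econs (f enil) (econs (f' enil) enil)).
  have {}hf x : ap (f enil) x = F x by exact: hf.
  have {}hf' x : ap (f' enil) x = F' x by exact: hf'.
  rewrite -hf -hf'. move: n. apply hi. split.
  - change (ap (f enil) nat0 = ap (f' enil) nat0). by rewrite hf hf'.
  - move=> m hm. change (ap (f enil) (addN m nat1) = ap (f' enil) (addN m nat1)).
    change (ap (f enil) m = ap (f' enil) m) in hm. rewrite !hf !hf' in hm *. exact: hS.
Qed.

Ltac def_base := first
  [ apply: Def_const | apply: Def_var | apply: Def_add | apply: Def_mul | apply: Def_prec ].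

Definition predN (n : Dom M N) : Dom M N := prec (fun m _ => m) nat0 n.
Definition monus (x y : Dom M N) : Dom M N := prec (fun _ r => predN r) x y.
(** Case distinction on whether [c] is zero, obtained from a recursion that ignores its previous
    value. *)
Definition sel (c a b : Dom M N) : Dom M N := prec (fun _ _ => b) a c.

Lemma Def_pred G (F : env (Dom M) G -> Dom M N) : Def F -> Def (fun e => predN (F e)).
Proof. move=> h. rewrite /predN. by repeat def_base. Qed.
Lemma Def_monus G (F1 F2 : env (Dom M) G -> Dom M N) :
  Def F1 -> Def F2 -> Def (fun e => monus (F1 e) (F2 e)).
Proof.
  move=> h1 h2. rewrite /monus. apply: Def_prec => //. apply: Def_pred. by repeat def_base.
Qed.

Lemma Def_wk G a s (F : env (Dom M) G -> Dom M s) :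
  Def F -> Def (G := a :: G) (fun e => F (etail e)).
Proof.
  induction 1 as [G s x|G s d|G s r F1 F2 h1 IH1 h2 IH2].
  - exact: (Def_var (a :: G) s (vs x)).
  - exact: Def_const.
  - exact: (Def_ap _ _ _ (fun e => F1 (etail e)) (fun e => F2 (etail e))).
Qed.

Lemma Def_sel G (C A B : env (Dom M) G -> Dom M N) :
  Def C -> Def A -> Def B -> Def (fun e => sel (C e) (A e) (B e)).
Proof.
  move=> h1 h2 h3. rewrite /sel. apply: Def_prec => //.
  exact: (Def_wk _ _ _ _ (Def_wk _ _ _ _ h3)).
Qed.

Ltac def1 := first
  [ assumption | apply: Def_sel | apply: Def_monus | apply: Def_pred | def_base ].

Lemma pred0 : predN nat0 = nat0.
Proof. exact: prec0. Qed.
Lemma predS n : predN (addN n nat1) = n.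
Proof. rewrite /predN precS //. by repeat def1. Qed.
Lemma sel0 a b : sel nat0 a b = a.
Proof. exact: prec0. Qed.
Lemma selS c a b : sel (addN c nat1) a b = b.
Proof. rewrite /sel precS //. by repeat def1. Qed.
Lemma monus0 x : monus x nat0 = x.
Proof. exact: prec0. Qed.
Lemma monusS x y : monus x (addN y nat1) = predN (monus x y).
Proof. rewrite /monus precS //. by repeat def1. Qed.

Let osr := model_osr.
Definition addNA x y z : addN (addN x y) z = addN x (addN y z) := osr_addA _ _ _ _ _ _ osr x y z.
Definition addNC x y : addN x y = addN y x := osr_addC _ _ _ _ _ _ osr x y.
Definition addN0 x : addN x nat0 = x := osr_add0 _ _ _ _ _ _ osr x.

Lemma monusSS x y : monus (addN x nat1) (addN y nat1) = monus x y.
Proof.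
  move: y. apply: ind_eq; try by repeat def1.
  - by rewrite monusS !monus0 predS.
  - move=> y h. by rewrite monusS h -monusS.
Qed.

Lemma monus_add x y : monus (addN x y) y = x.
Proof.
  move: y. apply: ind_eq; try by repeat def1.
  - by rewrite monus0 addN0.
  - move=> y h. by rewrite -addNA monusSS.
Qed.

Lemma monus_le x y : monus y (addN y x) = nat0.
Proof.
  move: y. apply: (ind_eq _ (fun=> nat0)); try by repeat def1.
  - rewrite addNC addN0. move: x. apply: (ind_eq _ (fun=> nat0)); try by repeat def1.
    + exact: monus0.
    + move=> x h. by rewrite monusS h pred0.
  - move=> y h. by rewrite addNA (addNC nat1) -addNA monusSS.
Qed.

Variable K : realFieldType.
Variable i : Dom M N -> K.
Hypothesis i0 : i nat0 = 0.
Hypothesis i1 : i nat1 = 1.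
Hypothesis iD : forall x y, i (addN x y) = i x + i y.
Hypothesis iM : forall x y, i (mulN x y) = i x * i y.
Hypothesis i_lt : forall x y, ltD x y <-> i x < i y.
Hypothesis i_inj : forall x y, i x = i y -> x = y.
Hypothesis i_frac : forall q, exists a b c, q * (i c + 1) = i a - i b.

Lemma i_ge0 x : 0 <= i x.
Proof.
  case: (osr_ge0 _ _ _ _ _ _ osr x) => [/i_lt|<-]; rewrite i0 //. by move/ltW.
Qed.

Lemma i_le x y : i x <= i y -> exists z, y = addN x z.
Proof.
  rewrite le_eqVlt => /orP [/eqP /i_inj ->|/i_lt].
  - exists nat0. by rewrite addN0.
  - move/(osr_sub _ _ _ _ _ _ osr) => [z <-]. by exists z.
Qed.

Lemma i_succ x : 0 < i x -> exists y, x = addN y nat1.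
Proof.
  rewrite -i0 => /i_lt /(osr_discrete _ _ _ _ _ _ osr) h.
  have : i nat1 <= i x by case: h => [/i_lt /ltW //|->].
  move/i_le => [z ->]. exists z. exact: addNC.
Qed.

Lemma i_lt_le x y : i x < i y -> i x + 1 <= i y.
Proof.
  move=> h. have [z e] := i_le _ _ (ltW h). move: h. rewrite e iD => h.
  have [w ->] : exists w, z = addN w nat1 by apply: i_succ; lra.
  rewrite iD i1. have := i_ge0 w. lra.
Qed.

Lemma i_add_eq0 x : x <> nat0 -> 0 < i x.
Proof.
  move=> h. rewrite lt_neqAle i_ge0 andbT. apply/eqP => e. apply h. apply: i_inj. by rewrite i0.
Qed.

Lemma sel_pos c a b : c <> nat0 -> sel c a b = b.
Proof. move/i_add_eq0/i_succ => [d ->]. exact: selS. Qed.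

(** Expresses the order by an equation, the source of all decidability below. *)
Lemma monus_lt x y : monus (addN x nat1) y = nat0 <-> i x < i y.
Proof.
  split.
  - move=> h. rewrite ltNge. apply/negP => /i_le [z e]. move: h.
    rewrite e addNA (addNC y) monus_add => h. have := i_ge0 z.
    have : i (addN z nat1) = 0 by rewrite h.
    rewrite iD i1. lra.
  - move/i_lt_le. rewrite -i1 -iD => /i_le [z ->]. exact: monus_le.
Qed.

Lemma i_monus x y : i y <= i x -> i (monus x y) = i x - i y.
Proof. move/i_le => [z ->]. rewrite (addNC y) monus_add iD. lra. Qed.

(** * Decidable predicates and definable field-valued functions *)

Definition Dec {G} (P : env (Dom M) G -> Prop) : Prop :=
  exists chi, Def chi /\ forall e, P e <-> chi e = nat0.

Lemma Dec_ext G (P Q : env (Dom M) G -> Prop) : (forall e, P e <-> Q e) -> Dec P -> Dec Q.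
Proof. move=> h [c [hc h1]]. exists c. split => // e. by rewrite -h h1. Qed.

Lemma Dec_lt G (F1 F2 : env (Dom M) G -> Dom M N) :
  Def F1 -> Def F2 -> Dec (fun e => i (F1 e) < i (F2 e)).
Proof.
  move=> h1 h2. exists (fun e => monus (addN (F1 e) nat1) (F2 e)). split.
  - by repeat def1.
  - move=> e. by rewrite monus_lt.
Qed.

Lemma nat1_neq0 : nat1 <> nat0.
Proof. move=> h. have : i nat1 = 0 by rewrite h i0. rewrite i1. lra. Qed.

Lemma Dec_not G (P : env (Dom M) G -> Prop) : Dec P -> Dec (fun e => ~ P e).
Proof.
  move=> [c [hc h]]. exists (fun e => sel (c e) nat1 nat0). split; first by repeat def1.
  move=> e. rewrite h. case: (classic (c e = nat0)) => hc0.
  - rewrite hc0 sel0. split => // h0. by case: nat1_neq0.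
  - by rewrite sel_pos.
Qed.

Lemma Dec_and G (P Q : env (Dom M) G -> Prop) : Dec P -> Dec Q -> Dec (fun e => P e /\ Q e).
Proof.
  move=> [c [hc h]] [d [hd h']]. exists (fun e => sel (c e) (d e) nat1).
  split; first by repeat def1.
  move=> e. rewrite h h'. case: (classic (c e = nat0)) => hc0.
  - rewrite hc0 sel0. tauto.
  - rewrite sel_pos //. split; first tauto. by move/nat1_neq0.
Qed.

(** Apply [ind_eq] to the characteristic function of [P] and the constant zero. *)
Lemma Dec_ind (P : Dom M N -> Prop) :
  Dec (G := [N]) (fun e => P (e N vz)) ->
  P nat0 -> (forall n, P n -> P (addN n nat1)) -> forall n, P n.
Proof.
  move=> [c [/Def_lam [f [_ hf]] h]] h0 hS n.
  have hP m : P m <-> ap (f enil) m = nat0 by rewrite hf -h.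
  apply/hP. move: n. apply: (ind_eq _ (fun=> nat0)).
  - apply: Def_ap1. by repeat def1.
  - by repeat def1.
  - by apply/hP.
  - move=> n /hP hn. apply/hP. exact: hS.
Qed.

(** A classical case distinction of the metatheory; by [Def_ifp] it does not leave the model when
    the condition is decidable. *)
Definition ifp {X} (P : Prop) (a b : X) : X :=
  if excluded_middle_informative P then a else b.

Lemma ifp_l X (P : Prop) (a b : X) : P -> ifp P a b = a.
Proof. rewrite /ifp. by case: excluded_middle_informative. Qed.
Lemma ifp_r X (P : Prop) (a b : X) : ~ P -> ifp P a b = b.
Proof. rewrite /ifp. by case: excluded_middle_informative. Qed.

Lemma Def_ifp G (P : env (Dom M) G -> Prop) (A B : env (Dom M) G -> Dom M N) :
  Dec P -> Def A -> Def B -> Def (fun e => ifp (P e) (A e) (B e)).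
Proof.
  move=> [c [hc h]] hA hB. apply: (Def_ext _ _ (fun e => sel (c e) (A e) (B e))).
  - move=> e. case: (classic (P e)) => hP.
    + by rewrite ifp_l // (proj1 (h e) hP) sel0.
    + rewrite ifp_r // sel_pos // => hc0. exact: (hP (proj2 (h e) hc0)).
  - by repeat def1.
Qed.

(** Elements of [K] are not objects of the model. A field-valued function counts as definable if
    both parts of its numerator and its denominator are. *)
Definition DefK {G} (F : env (Dom M) G -> K) : Prop :=
  exists a b c : env (Dom M) G -> Dom M N, Def a /\ Def b /\ Def c /\
    forall e, F e = (i (a e) - i (b e)) / (i (c e) + 1).

Lemma i_succ_neq0 x : i x + 1 != 0.
Proof. have := i_ge0 x. lra. Qed.

Lemma DefK_i G (F : env (Dom M) G -> Dom M N) : Def F -> DefK (fun e => i (F e)).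
Proof.
  move=> h. exists F, (fun=> nat0), (fun=> nat0). do ! split => //; try exact: Def_const.
  move=> e. rewrite i0. by field.
Qed.

Lemma DefK_const G (q : K) : DefK (fun _ : env (Dom M) G => q).
Proof.
  have [a [b [c h]]] := i_frac q.
  exists (fun=> a), (fun=> b), (fun=> c). do ! split => //; try exact: Def_const.
  move=> e. rewrite -h. field. exact: i_succ_neq0.
Qed.

Lemma DefK_add G (F1 F2 : env (Dom M) G -> K) :
  DefK F1 -> DefK F2 -> DefK (fun e => F1 e + F2 e).
Proof.
  move=> [a [b [c [ha [hb [hc h]]]]]] [a' [b' [c' [ha' [hb' [hc' h']]]]]].
  exists (fun e => addN (mulN (a e) (addN (c' e) nat1)) (mulN (a' e) (addN (c e) nat1))),
    (fun e => addN (mulN (b e) (addN (c' e) nat1)) (mulN (b' e) (addN (c e) nat1))),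
    (fun e => addN (mulN (c e) (c' e)) (addN (c e) (c' e))).
  do ! split; try by repeat def1.
  move=> e. rewrite h h' !(iD, iM) i1.
  have := i_ge0 (c e); have := i_ge0 (c' e) => h1 h2.
  field. apply/and3P; split; try exact: i_succ_neq0. nra.
Qed.

Lemma DefK_opp G (F : env (Dom M) G -> K) : DefK F -> DefK (fun e => - F e).
Proof.
  move=> [a [b [c [ha [hb [hc h]]]]]]. exists b, a, c. do ! split => //.
  move=> e. rewrite h. field. exact: i_succ_neq0.
Qed.

Lemma DefK_mul G (F1 F2 : env (Dom M) G -> K) :
  DefK F1 -> DefK F2 -> DefK (fun e => F1 e * F2 e).
Proof.
  move=> [a [b [c [ha [hb [hc h]]]]]] [a' [b' [c' [ha' [hb' [hc' h']]]]]].
  exists (fun e => addN (mulN (a e) (a' e)) (mulN (b e) (b' e))),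
    (fun e => addN (mulN (a e) (b' e)) (mulN (b e) (a' e))),
    (fun e => addN (mulN (c e) (c' e)) (addN (c e) (c' e))).
  do ! split; try by repeat def1.
  move=> e. rewrite h h' !(iD, iM).
  have := i_ge0 (c e); have := i_ge0 (c' e) => h1 h2.
  field. apply/and3P; split; try exact: i_succ_neq0. nra.
Qed.

Lemma DefK_inv G (F : env (Dom M) G -> Dom M N) : Def F -> DefK (fun e => (i (F e))^-1).
Proof.
  (* The numerator is [0] when [F e] is zero, in accordance with the inverse of zero in a field;
     otherwise the fraction is [1 / (predN (F e) + 1)]. *)
  move=> h. exists (fun e => sel (F e) nat0 nat1), (fun=> nat0), (fun e => predN (F e)).
  do ! split; try by repeat def1.
  move=> e. case: (classic (F e = nat0)) => hF.
  - rewrite hF sel0 i0 invr0. ring.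
  - rewrite sel_pos //. move/i_add_eq0/i_succ: hF => [d ->]. rewrite predS iD i0 i1.
    field. exact: i_succ_neq0.
Qed.

Lemma Dec_ltK G (F1 F2 : env (Dom M) G -> K) :
  DefK F1 -> DefK F2 -> Dec (fun e => F1 e < F2 e).
Proof.
  move=> [a [b [c [ha [hb [hc h]]]]]] [a' [b' [c' [ha' [hb' [hc' h']]]]]].
  apply: (Dec_ext _ (fun e =>
    i (addN (mulN (a e) (addN (c' e) nat1)) (mulN (b' e) (addN (c e) nat1))) <
    i (addN (mulN (a' e) (addN (c e) nat1)) (mulN (b e) (addN (c' e) nat1))))).
  - move=> e. rewrite h h' !(iD, iM) i1.
    have hc0 : 0 < i (c e) + 1 by have := i_ge0 (c e); lra.
    have hc0' : 0 < i (c' e) + 1 by have := i_ge0 (c' e); lra.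
    rewrite ltr_pdivrMr // mulrAC ltr_pdivlMr //. split; lra.
  - apply: Dec_lt; by repeat def1.
Qed.

Lemma Dec_leK G (F1 F2 : env (Dom M) G -> K) :
  DefK F1 -> DefK F2 -> Dec (fun e => F1 e <= F2 e).
Proof.
  move=> h1 h2. apply: (Dec_ext _ (fun e => ~ F2 e < F1 e)).
  - move=> e. rewrite leNgt. split; by move/negP.
  - apply: Dec_not. exact: Dec_ltK.
Qed.

Lemma Dec_eqK G (F1 F2 : env (Dom M) G -> K) :
  DefK F1 -> DefK F2 -> Dec (fun e => F1 e = F2 e).
Proof.
  move=> h1 h2. apply: (Dec_ext _ (fun e => F1 e <= F2 e /\ F2 e <= F1 e)).
  - move=> e. split; [move=> [??]; lra|by move=> ->].
  - by apply: Dec_and; apply: Dec_leK.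
Qed.

Lemma Dec_eq G (F1 F2 : env (Dom M) G -> Dom M N) :
  Def F1 -> Def F2 -> Dec (fun e => F1 e = F2 e).
Proof.
  move=> h1 h2. apply: (Dec_ext _ (fun e => i (F1 e) = i (F2 e))).
  - move=> e. split; [exact: i_inj|by move=> ->].
  - by apply: Dec_eqK; apply: DefK_i.
Qed.

Lemma eval_lam_ap G a s (t : term (a :: G) s) e x :
  ap (eval M e (lam a t)) x = eval M (econs x e) t.
Proof.
  induction t as [s y|s c|s r u IHu v IHv].
  - revert s y. apply var_case.
    + cbn. by rewrite ap_Sigma ap_Pi.
    + move=> s y. cbn. by rewrite ap_Pi.
  - cbn. by rewrite ap_Pi.
  - cbn. by rewrite ap_Sigma IHu IHv.
Qed.

Lemma eval_lam G a s (t : term (a :: G) s) e :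
  eval M e (lam a t) = LAM (fun x => eval M (econs x e) t).
Proof.
  apply: HE => x. rewrite (ap_LAM_ex _ _ _ _ (eval_lam_ap _ _ _ t e)). exact: eval_lam_ap.
Qed.

(** * Powers of two and the inversion of the pairing function *)

Definition powN (n : Dom M N) : Dom M N := prec (fun _ r => addN r r) nat1 n.

Lemma eval_pow2 G (t : term G N) e : eval M e (pow2 t) = powN (eval M e t).
Proof.
  rewrite /pow2 /powN /prec. cbn [eval]. do 2 f_equal. congr (ap _ _).
  rewrite eval_lam. congr LAM. apply functional_extensionality => n. exact: eval_lam.
Qed.

Lemma Def_pow G (F : env (Dom M) G -> Dom M N) : Def F -> Def (fun e => powN (F e)).
Proof. move=> h. rewrite /powN. by repeat def1. Qed.

Lemma powS n : i (powN (addN n nat1)) = 2 * i (powN n).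
Proof. rewrite /powN precS; last by repeat def1. rewrite iD. ring. Qed.

Lemma pow_ge n : i n + 1 <= i (powN n).
Proof.
  move: n. apply: (Dec_ind (fun n => i n + 1 <= i (powN n))).
  - apply: Dec_leK; [apply: DefK_add; [|exact: DefK_const]|]; apply: DefK_i;
      [exact: Def_var|apply: Def_pow; exact: Def_var].
  - rewrite /powN prec0 i0 i1. lra.
  - move=> n. rewrite powS iD i1. have := i_ge0 n. lra.
Qed.

(** The field element [2 ^ (- n)], the unit in which approximations are measured. *)
Definition hp (n : Dom M N) : K := (i (powN n))^-1.

Lemma pow_gt0 n : 0 < i (powN n).
Proof. have := pow_ge n; have := i_ge0 n. lra. Qed.
Lemma hp_gt0 n : 0 < hp n.
Proof. by rewrite /hp invr_gt0 pow_gt0. Qed.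
Lemma hp0 : hp nat0 = 1.
Proof. by rewrite /hp /powN prec0 i1 invr1. Qed.
Lemma hpS n : hp (addN n nat1) = hp n / 2.
Proof.
  rewrite /hp powS. have := pow_gt0 n => h. field. by rewrite lt0r_neq0.
Qed.

Lemma DefK_hp G (F : env (Dom M) G -> Dom M N) : Def F -> DefK (fun e => hp (F e)).
Proof. move=> h. exact: DefK_inv (Def_pow _ _ h). Qed.

(** The integer square root. A pair code [(a + b)^2 + a] lies below the square of [a + b + 1], so
    its root is [a + b], and subtraction then recovers both components. *)
Definition sqrtN (z : Dom M N) : Dom M N :=
  prec (fun n s => ifp (i (mulN (addN s nat1) (addN s nat1)) <= i (addN n nat1))
    (addN s nat1) s) nat0 z.
Definition fstN (z : Dom M N) : Dom M N := monus z (mulN (sqrtN z) (sqrtN z)).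
Definition sndN (z : Dom M N) : Dom M N := monus (sqrtN z) (fstN z).
Definition pairN (a b : Dom M N) : Dom M N := addN (mulN (addN a b) (addN a b)) a.

Lemma Def_sqrt_step G (F1 F2 : env (Dom M) G -> Dom M N) : Def F1 -> Def F2 ->
  Def (fun e => ifp (i (mulN (addN (F2 e) nat1) (addN (F2 e) nat1)) <= i (addN (F1 e) nat1))
    (addN (F2 e) nat1) (F2 e)).
Proof.
  move=> h1 h2. apply: Def_ifp; [apply: Dec_leK; apply: DefK_i| |]; by repeat def1.
Qed.

Lemma Def_sqrt G (F : env (Dom M) G -> Dom M N) : Def F -> Def (fun e => sqrtN (F e)).
Proof.
  move=> h. rewrite /sqrtN. apply: Def_prec => //; last exact: Def_const.
  apply: Def_sqrt_step; by repeat def1.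
Qed.

Lemma sqrtP z : i (sqrtN z) ^+ 2 <= i z < (i (sqrtN z) + 1) ^+ 2.
Proof.
  move: z. apply: (Dec_ind (fun z => i (sqrtN z) ^+ 2 <= i z < (i (sqrtN z) + 1) ^+ 2)).
  - apply: (Dec_ext _ (fun e => i (sqrtN (e N vz)) * i (sqrtN (e N vz)) <= i (e N vz) /\
      i (e N vz) < (i (sqrtN (e N vz)) + 1) * (i (sqrtN (e N vz)) + 1))).
    + move=> e. rewrite !expr2. split; [by move=> [-> ->]|by move/andP].
    + have h : DefK (G := [N]) (fun e => i (sqrtN (e N vz)))
        by apply: DefK_i; apply: Def_sqrt; exact: Def_var.
      have h' : DefK (G := [N]) (fun e => i (e N vz)) by apply: DefK_i; exact: Def_var.
      apply: Dec_and; [apply: Dec_leK => //; exact: DefK_mul|apply: Dec_ltK => //].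
      apply: DefK_mul; apply: DefK_add => //; exact: DefK_const.
  - rewrite /sqrtN prec0 i0. apply/andP; lra.
  - move=> n /andP [h1 h2]. rewrite {1 2}/sqrtN precS; last by apply: Def_sqrt_step; exact: Def_var.
    rewrite -/(sqrtN n). set s := sqrtN n in h1 h2 *.
    have hs := i_ge0 s.
    have {}h2 : i n + 1 <= i (mulN (addN s nat1) (addN s nat1)).
      by apply: i_lt_le; rewrite iM iD i1 -expr2.
    rewrite iM !iD i1 in h2 *.
    case: (classic ((i s + 1) * (i s + 1) <= i n + 1)) => h.
    + rewrite ifp_l // iD i1. apply/andP; split; nra.
    + rewrite ifp_r //. move/negP: h. rewrite -ltNge => h. apply/andP; split; nra.
Qed.

Lemma sqrt_pair a b : sqrtN (pairN a b) = addN a b.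
Proof.
  have ha := i_ge0 a. have hb := i_ge0 b.
  have /andP [h1 h2] := sqrtP (pairN a b). set s := sqrtN (pairN a b) in h1 h2 *.
  have hs := i_ge0 s.
  rewrite /pairN iD iM in h1 h2. set t := addN a b in h1 h2 *.
  have ht : i t = i a + i b by rewrite iD.
  apply: i_inj. apply/eqP; rewrite eq_le. apply/andP; split; rewrite leNgt; apply/negP.
  - move/i_lt_le => h. have : (i t + 1) ^+ 2 <= i s ^+ 2 by nra. nra.
  - move/i_lt_le => h. have : (i s + 1) ^+ 2 <= i t ^+ 2 by nra. nra.
Qed.

Lemma fst_pair a b : fstN (pairN a b) = a.
Proof.
  apply: i_inj. rewrite /fstN sqrt_pair i_monus /pairN ?iD ?iM ?iD; have := i_ge0 a; lra.
Qed.

Lemma snd_pair a b : sndN (pairN a b) = b.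
Proof.
  apply: i_inj. rewrite /sndN fst_pair sqrt_pair i_monus iD; have := i_ge0 b; lra.
Qed.

Lemma Def_pair G (F1 F2 : env (Dom M) G -> Dom M N) :
  Def F1 -> Def F2 -> Def (fun e => pairN (F1 e) (F2 e)).
Proof. move=> h1 h2. rewrite /pairN. by repeat def1. Qed.
Lemma Def_fst G (F : env (Dom M) G -> Dom M N) : Def F -> Def (fun e => fstN (F e)).
Proof.
  move=> h. have h' := Def_sqrt _ _ h. rewrite /fstN. by repeat def1.
Qed.
Lemma Def_snd G (F : env (Dom M) G -> Dom M N) : Def F -> Def (fun e => sndN (F e)).
Proof.
  move=> h. have h' := Def_sqrt _ _ h. have h'' := Def_fst _ _ h. rewrite /sndN. by repeat def1.
Qed.

(** * Codes of rationals and their values in the field *)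

Definition qcode (a b c : Dom M N) : Dom M N := pairN (pairN a b) c.
Definition valid (z : Dom M N) : Prop := exists a b c, z = qcode a b c.
Definition val (z : Dom M N) : K :=
  (i (fstN (fstN z)) - i (sndN (fstN z))) / (i (sndN z) + 1).
Definition recode (z : Dom M N) : Dom M N := qcode (fstN (fstN z)) (sndN (fstN z)) (sndN z).

Lemma val_qcode a b c : val (qcode a b c) = (i a - i b) / (i c + 1).
Proof. by rewrite /val /qcode !fst_pair !snd_pair. Qed.
Lemma val_recode z : val (recode z) = val z.
Proof. exact: val_qcode. Qed.
Lemma valid_qcode a b c : valid (qcode a b c).
Proof. by exists a, b, c. Qed.
(** Replaces the three existential quantifiers in [valid] by an equation, which is decidable. *)
Lemma valid_iff z : valid z <-> z = recode z.
Proof.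
  split; last by move=> ->; exact: valid_qcode.
  move=> [a [b [c ->]]]. by rewrite /recode /qcode !fst_pair !snd_pair.
Qed.

Lemma DefK_val G (F : env (Dom M) G -> Dom M N) : Def F -> DefK (fun e => val (F e)).
Proof.
  move=> h. have h1 := Def_fst _ _ h.
  apply: DefK_mul.
  - apply: DefK_add; [|apply: DefK_opp]; apply: DefK_i; [exact: Def_fst|exact: Def_snd].
  - have hS : Def (fun e => addN (sndN (F e)) nat1)
      by apply: Def_add; [exact: Def_snd|exact: Def_const].
    have := DefK_inv _ _ hS. congr DefK. apply functional_extensionality => e. by rewrite iD i1.
Qed.

Ltac defs := repeat first
  [ assumption
  | apply: DefK_const | apply: DefK_val | apply: DefK_hp | apply: DefK_i | apply: DefK_add
  | apply: DefK_opp | apply: DefK_mul | apply: DefK_inv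
  | apply: Dec_and | apply: Dec_not | apply: Dec_ltK | apply: Dec_leK | apply: Dec_eqK
  | apply: Dec_eq
  | apply: Def_const | apply: Def_var | apply: Def_ifp | apply: Def_fst | apply: Def_snd
  | apply: Def_pair | apply: Def_pow
  | apply: Def_sel | apply: Def_monus | apply: Def_pred | apply: Def_add | apply: Def_mul
  | apply: Def_prec | apply: Def_ap ].

Lemma Def_recode G (F : env (Dom M) G -> Dom M N) : Def F -> Def (fun e => recode (F e)).
Proof. move=> h. rewrite /recode /qcode. by defs. Qed.

Lemma Dec_valid G (F : env (Dom M) G -> Dom M N) : Def F -> Dec (fun e => valid (F e)).
Proof.
  move=> h. apply: (Dec_ext _ (fun e => F e = recode (F e))).
  - move=> e. by rewrite valid_iff.
  - apply: Dec_eq => //. exact: Def_recode.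
Qed.

Lemma hp_add n k : hp (addN n k) <= hp k.
Proof.
  move: n. apply: (Dec_ind (fun n => hp (addN n k) <= hp k)).
  - by defs.
  - by rewrite addNC addN0.
  - move=> n. rewrite addNA (addNC nat1) -addNA hpS. have := hp_gt0 (addN n k). lra.
Qed.

(** A positive fraction with denominator [c + 1] is at least [1 / (c + 1)], and [2 ^ (c + 1)]
    exceeds [c + 1]. Thus the field is Archimedean relative to the numbers of the model, standard or
    not. *)
Lemma hp_arch (q : K) : 0 < q -> exists n, hp n < q.
Proof.
  move=> h. have [a [b [c e]]] := i_frac q. exists (addN c nat1).
  have hc := i_ge0 c.
  have : i b + 1 <= i a by apply: i_lt_le; nra.
  have := pow_ge (addN c nat1). rewrite iD i1 => h1 h2.
  have h3 := pow_gt0 (addN c nat1).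
  rewrite /hp -(ltr_pM2r h3) mulVf; [nra|exact: lt0r_neq0].
Qed.
Lemma eval_wk6 G s (t : term G s) e a b c a' b' c' :
  eval M (econs c' (econs b' (econs a' (econs c (econs b (econs a e)))))) (wk6 (G := G) t) =
  eval M e t.
Proof. by rewrite /wk6 !eval_wk. Qed.

Lemma sat_rat_cmp (R : forall G : ctx, term G N -> term G N -> form G) RM
  (hR : forall G (t u : term G N) e, sat M (R G t u) e <-> RM (eval M e t) (eval M e u))
  G (q r d n : term G N) e :
  sat M (rat_cmp R q r d n) e <-> exists a b c a' b' c',
    eval M e q = qcode a b c /\ eval M e r = qcode a' b' c' /\
    RM (mulN (powN (eval M e n)) (addN (mulN a (addN c' nat1)) (mulN b' (addN c nat1))))
       (addN (mulN (powN (eval M e n)) (addN (mulN a' (addN c nat1)) (mulN b (addN c' nat1))))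
             (mulN (eval M e d) (mulN (addN c nat1) (addN c' nat1)))).
Proof.
  split; move=> [a [b [c [a' [b' [c' [h1 [h2 h3]]]]]]]];
    exists a, b, c, a', b', c'; set E := econs c' (econs b' (econs a' (econs c (econs b (econs a e))))).
  - have w1 : eval M E (wk6 q) = eval M e q by exact: eval_wk6.
    have w2 : eval M E (wk6 r) = eval M e r by exact: eval_wk6.
    have w3 : eval M E (wk6 n) = eval M e n by exact: eval_wk6.
    have w4 : eval M E (wk6 d) = eval M e d by exact: eval_wk6.
    rewrite -w1 -w2. split; [exact h1|split; [exact h2|]].
    move/hR: h3 => /= h3. rewrite -w3 -w4 -eval_pow2. exact h3.
  - have w1 : eval M E (wk6 q) = eval M e q by exact: eval_wk6.
    have w2 : eval M E (wk6 r) = eval M e r by exact: eval_wk6.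
    have w3 : eval M E (wk6 n) = eval M e n by exact: eval_wk6.
    have w4 : eval M E (wk6 d) = eval M e d by exact: eval_wk6.
    rewrite -w1 -w2 in h1 h2. split; [exact h1|split; [exact h2|]].
    apply/hR. rewrite -w3 -w4 -eval_pow2 in h3. exact h3.
Qed.

(** The two sides of the multiplied-out inequality differ by a positive multiple of the difference
    of the fractions, so both inequalities have the same truth value. *)
Lemma rat_cross (a b c a' b' c' d p : K) : 0 <= c -> 0 <= c' -> 0 < p ->
  (p * (a' * (c + 1) + b * (c' + 1)) + d * ((c + 1) * (c' + 1)) -
     p * (a * (c' + 1) + b' * (c + 1)))
  = ((a' - b') / (c' + 1) + d * p^-1 - (a - b) / (c + 1)) * (p * ((c + 1) * (c' + 1))).
Proof. move=> h1 h2 h3. field. by apply/and3P; split; lra. Qed.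

Lemma sat_rat_lt G (q r d n : term G N) e :
  sat M (rat_lt q r d n) e <-> valid (eval M e q) /\ valid (eval M e r) /\
    val (eval M e q) < val (eval M e r) + i (eval M e d) * hp (eval M e n).
Proof.
  rewrite /rat_lt (sat_rat_cmp _ (@ltD M)) //.
  have key a b c a' b' c' : ltD
    (mulN (powN (eval M e n)) (addN (mulN a (addN c' nat1)) (mulN b' (addN c nat1))))
    (addN (mulN (powN (eval M e n)) (addN (mulN a' (addN c nat1)) (mulN b (addN c' nat1))))
             (mulN (eval M e d) (mulN (addN c nat1) (addN c' nat1)))) <->
    val (qcode a b c) < val (qcode a' b' c') + i (eval M e d) * hp (eval M e n).
  { have hc := i_ge0 c; have hc' := i_ge0 c'; have hpos := pow_gt0 (eval M e n).
    rewrite i_lt !(iD, iM) i1 !val_qcode -subr_gt0 rat_cross // pmulr_lgt0 ?subr_gt0 //.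
    by rewrite !mulr_gt0 //; lra. }
  split.
  - move=> [a [b [c [a' [b' [c' [-> [-> /key h]]]]]]]]. split; first exact: valid_qcode.
    by split; first exact: valid_qcode.
  - move=> [[a [b [c ->]]] [[a' [b' [c' ->]]] /key h]]. by exists a, b, c, a', b', c'.
Qed.

Lemma sat_rat_le G (q r d n : term G N) e :
  sat M (rat_le q r d n) e <-> valid (eval M e q) /\ valid (eval M e r) /\
    val (eval M e q) <= val (eval M e r) + i (eval M e d) * hp (eval M e n).
Proof.
  have le_iff x y : (ltD x y \/ x = y) <-> i x <= i y.
  { rewrite le_eqVlt i_lt. split.
    - by move=> [->|->]; rewrite ?eqxx ?orbT.
    - by move/orP => [/eqP /i_inj ->|->]; [right|left]. }
  rewrite /rat_le (sat_rat_cmp _ (fun x y => ltD x y \/ x = y)) //.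
  have key a b c a' b' c' : (fun x y => ltD x y \/ x = y)
    (mulN (powN (eval M e n)) (addN (mulN a (addN c' nat1)) (mulN b' (addN c nat1))))
    (addN (mulN (powN (eval M e n)) (addN (mulN a' (addN c nat1)) (mulN b (addN c' nat1))))
             (mulN (eval M e d) (mulN (addN c nat1) (addN c' nat1)))) <->
    val (qcode a b c) <= val (qcode a' b' c') + i (eval M e d) * hp (eval M e n).
  { have hc := i_ge0 c; have hc' := i_ge0 c'; have hpos := pow_gt0 (eval M e n).
    rewrite le_iff !(iD, iM) i1 !val_qcode -subr_ge0 rat_cross // pmulr_lge0 ?subr_ge0 //.
    by rewrite !mulr_gt0 //; lra. }
  split.
  - move=> [a [b [c [a' [b' [c' [-> [-> /key h]]]]]]]]. split; first exact: valid_qcode.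
    by split; first exact: valid_qcode.
  - move=> [[a [b [c ->]]] [[a' [b' [c' ->]]] /key h]]. by exists a, b, c, a', b', c'.
Qed.

(** * Reals of the model, expressed in the field of fractions *)

Definition isR (x : Dom M N -> Dom M N) : Prop := forall n k,
  valid (x n) /\ valid (x (addN n k)) /\
  val (x n) < val (x (addN n k)) + hp n /\ val (x (addN n k)) < val (x n) + hp n.

Definition inI (x : Dom M N -> Dom M N) : Prop :=
  isR x /\ forall n, 0 <= val (x n) + 2 * hp n /\ val (x n) <= 1 + 2 * hp n.

Definition eqR (x y : Dom M N -> Dom M N) : Prop := forall n,
  valid (x n) /\ valid (y n) /\
  val (x n) <= val (y n) + 2 * hp n /\ val (y n) <= val (x n) + 2 * hp n.

Lemma i2 : i (addN nat1 nat1) = 2.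
Proof. rewrite iD i1. lra. Qed.

Lemma sat_is_real G (t : term G (N ⇒ N)) e : sat M (is_real t) e <-> isR (ap (eval M e t)).
Proof.
  split.
  - move=> h n k. have [h1 h2] := h n k. move/sat_rat_lt: h1 => h1. move/sat_rat_lt: h2 => h2.
    cbn in h1, h2. rewrite !eval_wk in h1 h2. rewrite -/nat1 i1 mul1r in h1 h2.
    by move: h1 h2 => [h1 [h2 h3]] [_ [_ h4]].
  - move=> h n k. have [h1 [h2 [h3 h4]]] := h n k.
    by split; apply/sat_rat_lt; cbn; rewrite !eval_wk -/nat1 i1 mul1r.
Qed.

Lemma sat_real_eq G (t u : term G (N ⇒ N)) e :
  sat M (real_eq t u) e <-> eqR (ap (eval M e t)) (ap (eval M e u)).
Proof.
  split.
  - move=> h n. have [h1 h2] := h n. move/sat_rat_le: h1 => h1. move/sat_rat_le: h2 => h2.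
    cbn in h1, h2. rewrite !eval_wk in h1 h2.
    rewrite -/nat1 -/(addN nat1 nat1) i2 in h1 h2.
    by move: h1 h2 => [h1 [h2 h3]] [_ [_ h4]].
  - move=> h n. have [h1 [h2 [h3 h4]]] := h n.
    by split; apply/sat_rat_le; cbn; rewrite !eval_wk -/nat1 -/(addN nat1 nat1) i2.
Qed.

Lemma sat_real_le G (t u : term G (N ⇒ N)) e :
  sat M (real_le t u) e <-> forall n, valid (ap (eval M e t) n) /\ valid (ap (eval M e u) n) /\
    val (ap (eval M e t) n) <= val (ap (eval M e u) n) + 2 * hp n.
Proof.
  split.
  - move=> h n. move/sat_rat_le: (h n) => h1.
    cbn in h1. rewrite !eval_wk in h1. by rewrite -/nat1 -/(addN nat1 nat1) i2 in h1.
  - move=> h n. apply/sat_rat_le. cbn. rewrite !eval_wk -/nat1 -/(addN nat1 nat1) i2. exact: h.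
Qed.

Lemma eval_real_zero G e n : ap (eval M e (@real_zero G)) n = qcode nat0 nat0 nat0.
Proof. exact: eval_lam_ap. Qed.
Lemma eval_real_one G e n : ap (eval M e (@real_one G)) n = qcode nat1 nat0 nat0.
Proof. exact: eval_lam_ap. Qed.

Lemma sat_in_I G (t : term G (N ⇒ N)) e : sat M (in_I t) e <-> inI (ap (eval M e t)).
Proof.
  have v0 : val (qcode nat0 nat0 nat0) = 0 by rewrite val_qcode subrr mul0r.
  have v1 : val (qcode nat1 nat0 nat0) = 1 by rewrite val_qcode i0 i1; field.
  split.
  - move=> [/sat_is_real h1 [/sat_real_le h2 /sat_real_le h3]]. split => // n.
    have [_ [_ {}h2]] := h2 n. have [_ [_ {}h3]] := h3 n.
    by rewrite eval_real_zero v0 in h2; rewrite eval_real_one v1 in h3.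
  - move=> [h1 h2]. split; first by apply/sat_is_real.
    have hv n : valid (ap (eval M e t) n) by case: (h1 n nat0).
    split; apply/sat_real_le => n; have [h3 h4] := h2 n.
    + rewrite eval_real_zero v0. do ! split => //. exact: valid_qcode.
    + rewrite eval_real_one v1. do ! split => //. exact: valid_qcode.
Qed.

Lemma eqR_refl x : isR x -> eqR x x.
Proof. move=> h n. have [h1 [h2 [h3 h4]]] := h n nat0. have := hp_gt0 n. do ! split => //; lra. Qed.

Lemma eqR_sym x y : eqR x y -> eqR y x.
Proof. move=> h n. by have [h1 [h2 [h3 h4]]] := h n. Qed.

(** At a single index the two errors would add up to [4 * hp n]. The comparison is made at a late
    index [n + m] instead, and the Cauchy bounds of [x] and [z] lead back to [n] at a cost of
    [2 * hp n]. *)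
Lemma eqR_trans x y z : isR x -> isR z -> eqR x y -> eqR y z -> eqR x z.
Proof.
  have key x' y' z' n : isR x' -> isR z' -> eqR x' y' -> eqR y' z' ->
    val (x' n) <= val (z' n) + 2 * hp n.
  { move=> hx hz hxy hyz. rewrite leNgt. apply/negP => h.
    (* The divisor [4] covers the two errors of size [2 * hp (n + m)]. *)
    have [m hm] := hp_arch ((val (x' n) - (val (z' n) + 2 * hp n)) / 4) ltac:(lra).
    have [_ [_ [h1 _]]] := hx n m. have [_ [_ [_ h2]]] := hz n m.
    have [_ [_ [h3 _]]] := hxy (addN n m). have [_ [_ [h4 _]]] := hyz (addN n m).
    have := hp_add n m. lra. }
  move=> hx hz hxy hyz n. have [h1 _] := hx n nat0. have [h2 _] := hz n nat0.
  do ! split => //; first exact: (key x y z).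
  by apply: (key z y x) => //; apply: eqR_sym.
Qed.

(** * Normalization of arbitrary functions to reals of the unit interval *)

(** [recode] ensures that the result is a valid code even where the value is left unchanged. *)
Definition clamp (z : Dom M N) : Dom M N :=
  ifp (val z < 0) (qcode nat0 nat0 nat0) (ifp (1 < val z) (qcode nat1 nat0 nat0) (recode z)).

Lemma Def_clamp G (F : env (Dom M) G -> Dom M N) : Def F -> Def (fun e => clamp (F e)).
Proof. move=> h. rewrite /clamp /recode /qcode. by defs. Qed.

Lemma clampP z : [\/ val z < 0 /\ val (clamp z) = 0, 1 < val z /\ val (clamp z) = 1 |
  0 <= val z <= 1 /\ val (clamp z) = val z].
Proof.
  rewrite /clamp. case: (classic (val z < 0)) => h1.
  { rewrite ifp_l // val_qcode subrr mul0r. by constructor 1. }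
  rewrite ifp_r //. case: (classic (1 < val z)) => h2.
  { rewrite ifp_l // val_qcode i0 i1. constructor 2. split => //. by field. }
  rewrite ifp_r // val_recode. constructor 3. split => //.
  move/negP: h1. move/negP: h2. rewrite -!leNgt. by move=> -> ->.
Qed.

Lemma valid_clamp z : valid (clamp z).
Proof.
  rewrite /clamp /ifp. do 2 case: excluded_middle_informative => ?; exact: valid_qcode.
Qed.

Lemma clamp_bounds z : 0 <= val (clamp z) <= 1.
Proof. case: (clampP z) => [[_ ->]|[_ ->]|[h ->]] //; apply/andP; lra. Qed.

Lemma clamp_lipschitz y z d : 0 < d -> val y < val z + d -> val (clamp y) < val (clamp z) + d.
Proof.
  move=> hd h. case: (clampP y) => [[h1 ->]|[h1 ->]|[/andP [h1 h1'] ->]];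
    case: (clampP z) => [[h2 ->]|[h2 ->]|[/andP [h2 h2'] ->]]; lra.
Qed.

(** The clamped values [x (n + 1)] are followed as long as they stay within [2 ^ (- n)]
    of their predecessor, so that the result is a real in the unit interval for every [x]. *)
Definition norm_step (x : Dom M (N ⇒ N)) (n r : Dom M N) : Dom M N :=
  ifp (val r < val (clamp (ap x (addN (addN n nat1) nat1))) + hp (addN n nat1) /\
       val (clamp (ap x (addN (addN n nat1) nat1))) < val r + hp (addN n nat1))
    (clamp (ap x (addN (addN n nat1) nat1))) r.

Definition norm (x : Dom M (N ⇒ N)) (n : Dom M N) : Dom M N :=
  prec (norm_step x) (clamp (ap x (addN nat0 nat1))) n.

(** Normalization as an object of the model, so that it can be a parameter of the choice formula. *)
Definition normM : Dom M ((N ⇒ N) ⇒ N ⇒ N) := LAM (fun x => LAM (fun n => norm x n)).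

Lemma Def_norm_step G (X : env (Dom M) G -> Dom M (N ⇒ N)) (F1 F2 : env (Dom M) G -> Dom M N) :
  Def X -> Def F1 -> Def F2 -> Def (fun e => norm_step (X e) (F1 e) (F2 e)).
Proof.
  move=> hX h1 h2. rewrite /norm_step.
  have hc : Def (fun e => clamp (ap (X e) (addN (addN (F1 e) nat1) nat1)))
    by apply: Def_clamp; defs.
  by defs.
Qed.

Lemma Def_norm G (X : env (Dom M) G -> Dom M (N ⇒ N)) (F : env (Dom M) G -> Dom M N) :
  Def X -> Def F -> Def (fun e => norm (X e) (F e)).
Proof.
  move=> hX hF. rewrite /norm. apply: Def_prec => //.
  - apply: Def_norm_step; try exact: Def_var. exact: (Def_wk _ _ _ _ (Def_wk _ _ _ _ hX)).
  - apply: Def_clamp. by defs.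
Qed.

Lemma ap_normM x n : ap (ap normM x) n = norm x n.
Proof.
  have h : Def (G := [N; N ⇒ N]) (fun e => norm (e (N ⇒ N) (vs vz)) (e N vz))
    by apply: Def_norm; exact: Def_var.
  rewrite /normM (ap_LAM [] _ _ (fun _ x => LAM (fun n => norm x n)) _ enil); last first.
    exact: (Def_LAM [N ⇒ N] _ _ (fun e n => norm (e (N ⇒ N) vz) n)).
  exact: (ap_LAM [N ⇒ N] _ _ (fun e n => norm (e (N ⇒ N) vz) n) h (econs x enil)).
Qed.

Lemma normS x n : norm x (addN n nat1) = norm_step x n (norm x n).
Proof.
  rewrite /norm precS //. apply: Def_norm_step; [exact: Def_const|exact: Def_var|exact: Def_var].
Qed.

Lemma Def_norm1 x : Def (G := [N]) (fun e => norm x (e N vz)).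
Proof. apply: Def_norm; [exact: Def_const|exact: Def_var]. Qed.

Lemma valid_norm x n : valid (norm x n).
Proof.
  move: n. apply: (Dec_ind (fun n => valid (norm x n))).
  - apply: Dec_valid. exact: Def_norm1.
  - rewrite /norm prec0. exact: valid_clamp.
  - move=> n h. rewrite normS /norm_step.
    match goal with |- context [ifp ?P ?a ?b] => case: (classic P) => hP end.
    + rewrite ifp_l //. exact: valid_clamp.
    + by rewrite ifp_r.
Qed.

Lemma norm_bounds x n : 0 <= val (norm x n) <= 1.
Proof.
  suff [h1 h2] : 0 <= val (norm x n) /\ val (norm x n) <= 1 by rewrite h1.
  move: n. apply: (Dec_ind (fun n => 0 <= val (norm x n) /\ val (norm x n) <= 1)).
  - have h := Def_norm1 x. by defs.
  - rewrite /norm prec0. by apply/andP; exact: clamp_bounds.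
  - move=> n h. rewrite normS /norm_step.
    match goal with |- context [ifp ?P ?a ?b] => case: (classic P) => hP end.
    + rewrite ifp_l //. by apply/andP; exact: clamp_bounds.
    + by rewrite ifp_r.
Qed.

Lemma norm_close x n :
  val (norm x n) < val (norm x (addN n nat1)) + hp (addN n nat1) /\
  val (norm x (addN n nat1)) < val (norm x n) + hp (addN n nat1).
Proof.
  rewrite normS /norm_step.
  match goal with |- context [ifp ?P ?a ?b] => case: (classic P) => hP end.
  - by rewrite ifp_l.
  - rewrite ifp_r //. have := hp_gt0 (addN n nat1). lra.
Qed.

Lemma norm_inI x : inI (norm x).
Proof.
  have hb n : 0 <= val (norm x n) + 2 * hp n /\ val (norm x n) <= 1 + 2 * hp n.
  { have /andP [h1 h2] := norm_bounds x n. have := hp_gt0 n. lra. }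
  split => // n k.
  (* The steps have size at most [hp (j + 1)], which telescopes to [hp n - hp (addN n k)]. This
     sharper bound can be proved by induction, and it leaves a margin for the strict inequality. *)
  suff [h1 h2] : val (norm x n) <= val (norm x (addN n k)) + (hp n - hp (addN n k)) /\
    val (norm x (addN n k)) <= val (norm x n) + (hp n - hp (addN n k)).
  { have := hp_gt0 (addN n k). do ! split; try exact: valid_norm; lra. }
  move: k. apply: (Dec_ind (fun k =>
    val (norm x n) <= val (norm x (addN n k)) + (hp n - hp (addN n k)) /\
    val (norm x (addN n k)) <= val (norm x n) + (hp n - hp (addN n k)))).
  - have h := Def_norm _ _ (fun e : env (Dom M) [N] => addN n (e N vz))
      (Def_const _ _ x) ltac:(by defs). by defs.
  - rewrite addN0. lra.
  - move=> k. rewrite -addNA. have := norm_close x (addN n k). rewrite hpS. lra.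
Qed.

(** For a real the test in [norm_step] never fails, since clamping does not increase distances. The
    shift by one costs [hp n], and clamping moves a value by at most [2 * hp (n + 1) = hp n], which
    together is the permitted [2 * hp n]. *)
Lemma norm_eqR x : inI (ap x) -> eqR (norm x) (ap x).
Proof.
  move=> [hx hb].
  have track : forall n, norm x n = clamp (ap x (addN n nat1)).
  { apply: (ind_eq (norm x) (fun n => clamp (ap x (addN n nat1)))).
    - exact: Def_norm1.
    - apply: Def_clamp. by defs.
    - by rewrite /norm prec0.
    - move=> n e. rewrite normS /norm_step e ifp_l //.
      have [_ [_ [h1 h2]]] := hx (addN n nat1) nat1.
      by split; apply: clamp_lipschitz => //; exact: hp_gt0. }
  move=> n. rewrite track. have [h1 [_ [h3 h4]]] := hx n nat1.
  split; first exact: valid_clamp. split => //.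
  have := hb (addN n nat1). rewrite hpS => h5. have := hp_gt0 n.
  case: (clampP (ap x (addN n nat1))) => [[h6 ->]|[h6 ->]|[/andP [h6 h6'] ->]]; lra.
Qed.

(** * The diagonal real of a sequence *)

Section Cantor.
Variable X : Dom M (N ⇒ N ⇒ N).

Let three := addN (addN nat1 nat1) nat1.
Let four := addN three nat1.
Let i3 : i three = 3. Proof. rewrite /three !iD i1. lra. Qed.
Let i4 : i four = 4. Proof. rewrite /four iD i3 i1. lra. Qed.

(** The interval of stage [n] is [[w n, w n + d n]] with [d n = 4 ^ (- n)]; its first or last
    quarter is kept, whichever is farther away from the approximation [X n (2 n + 4)]. *)
Definition cantor_den (n : Dom M N) : Dom M N :=
  prec (fun _ r => addN (mulN four r) three) nat0 n.
Definition cantor_d (n : Dom M N) : K := (i (addN (cantor_den n) nat1))^-1.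
(** Is the approximation of [X n] to the right of the midpoint of the interval with left end
    [i r * cantor_d n]? The index [2 n + 4] makes [hp] equal to [cantor_d n / 16]. *)
Definition cantor_far (n r : Dom M N) : Prop :=
  (i r + 2^-1) * cantor_d n < val (ap (ap X n) (addN (addN n n) four)).
(** The base-four expansion of the diagonal real, with digits [0] and [3], as a numerator over
    [4 ^ n]. *)
Definition cantor_num (n : Dom M N) : Dom M N :=
  prec (fun n r => addN (mulN four r) (ifp (cantor_far n r) nat0 three)) nat0 n.
Definition cantor_w (n : Dom M N) : K := i (cantor_num n) * cantor_d n.

Lemma Def_cantor_den G (F : env (Dom M) G -> Dom M N) : Def F -> Def (fun e => cantor_den (F e)).
Proof. move=> h. rewrite /cantor_den. by defs. Qed.
Lemma DefK_cantor_d G (F : env (Dom M) G -> Dom M N) : Def F -> DefK (fun e => cantor_d (F e)).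
Proof. move=> h. have := Def_cantor_den _ _ h. rewrite /cantor_d => h'. by defs. Qed.
Lemma Def_cantor_step G (F1 F2 : env (Dom M) G -> Dom M N) : Def F1 -> Def F2 ->
  Def (fun e => addN (mulN four (F2 e)) (ifp (cantor_far (F1 e) (F2 e)) nat0 three)).
Proof.
  move=> h1 h2. have h3 := DefK_cantor_d _ _ h1. rewrite /cantor_far. by defs.
Qed.
Lemma Def_cantor_num G (F : env (Dom M) G -> Dom M N) : Def F -> Def (fun e => cantor_num (F e)).
Proof.
  move=> h. rewrite /cantor_num. apply: Def_prec => //; last exact: Def_const.
  apply: Def_cantor_step; exact: Def_var.
Qed.
Lemma DefK_cantor_w G (F : env (Dom M) G -> Dom M N) : Def F -> DefK (fun e => cantor_w (F e)).
Proof.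
  move=> h. have h1 := DefK_cantor_d _ _ h. have h2 := Def_cantor_num _ _ h.
  rewrite /cantor_w. by defs.
Qed.

Lemma cantor_d_gt0 n : 0 < cantor_d n.
Proof. rewrite /cantor_d invr_gt0 iD i1. have := i_ge0 (cantor_den n). lra. Qed.

Lemma cantor_dS n : cantor_d (addN n nat1) = cantor_d n / 4.
Proof.
  rewrite /cantor_d /cantor_den precS; last by defs.
  rewrite -/(cantor_den n). have := i_ge0 (cantor_den n) => h.
  have -> : i (addN (addN (mulN four (cantor_den n)) three) nat1) = 4 * (i (cantor_den n) + 1)
    by rewrite iD (iD (mulN four _)) iM i3 i4 i1; ring.
  rewrite iD i1. field. lra.
Qed.

Lemma cantor_d_hp n : cantor_d n = hp (addN n n).
Proof.
  have h1 : Def (G := [N]) (fun e => e N vz) by exact: Def_var.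
  have h2 := DefK_cantor_d _ _ h1.
  move: n. apply: (Dec_ind (fun n => cantor_d n = hp (addN n n))).
  - by defs.
  - rewrite addN0 hp0 /cantor_d /cantor_den prec0 iD i0 i1 add0r. exact: invr1.
  - move=> n h. rewrite cantor_dS h.
    have -> : addN (addN n nat1) (addN n nat1) = addN (addN (addN n n) nat1) nat1
      by apply: i_inj; rewrite !iD; ring.
    rewrite !hpS. by field.
Qed.

Lemma cantor_wS n : cantor_w (addN n nat1) =
  cantor_w n + ifp (cantor_far n (cantor_num n)) 0 (3 * (cantor_d n / 4)).
Proof.
  rewrite /cantor_w {1}/cantor_num precS; last by apply: Def_cantor_step; exact: Def_var.
  rewrite -/(cantor_num n) cantor_dS (iD (mulN four _)) iM i4.
  case: (classic (cantor_far n (cantor_num n))) => h.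
  - rewrite !ifp_l // i0. by field.
  - rewrite (ifp_r _ _ nat0) // (ifp_r _ _ 0) // i3. by field.
Qed.

Lemma cantor_nested n k : cantor_w n <= cantor_w (addN n k) /\
  cantor_w (addN n k) + cantor_d (addN n k) <= cantor_w n + cantor_d n.
Proof.
  have h1 : Def (G := [N]) (fun e => addN n (e N vz)) by defs.
  have h2 := DefK_cantor_d _ _ h1. have h3 := DefK_cantor_w _ _ h1.
  move: k. apply: (Dec_ind (fun k => cantor_w n <= cantor_w (addN n k) /\
    cantor_w (addN n k) + cantor_d (addN n k) <= cantor_w n + cantor_d n)).
  - by defs.
  - rewrite addN0. lra.
  - move=> k. rewrite -addNA cantor_wS cantor_dS. have := cantor_d_gt0 (addN n k).
    case: (classic (cantor_far (addN n k) (cantor_num (addN n k)))) => h.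
    + rewrite ifp_l //. lra.
    + rewrite ifp_r //. lra.
Qed.

(** The shift by one makes the interval length [cantor_d (n + 1)] strictly smaller than [hp n]. *)
Definition cantor_real (n : Dom M N) : Dom M N :=
  qcode (cantor_num (addN n nat1)) nat0 (cantor_den (addN n nat1)).

Lemma val_cantor n : val (cantor_real n) = cantor_w (addN n nat1).
Proof. by rewrite /cantor_real val_qcode /cantor_w /cantor_d i0 subr0 iD i1. Qed.

Lemma cantor_inI : inI cantor_real.
Proof.
  have hw0 : cantor_w nat0 = 0 by rewrite /cantor_w /cantor_num prec0 i0 mul0r.
  have hd0 : cantor_d nat0 = 1
    by rewrite /cantor_d /cantor_den prec0 iD i0 i1 add0r; exact: invr1.
  split.
  - move=> n k. split; first exact: valid_qcode. split; first exact: valid_qcode.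
    rewrite !val_cantor addNA (addNC k) -addNA.
    have := cantor_nested (addN n nat1) k. have := cantor_d_gt0 (addN (addN n nat1) k).
    have : cantor_d (addN n nat1) < hp n.
    { rewrite cantor_dS cantor_d_hp. have := hp_add n n. have := hp_gt0 n. lra. }
    lra.
  - move=> n. rewrite val_cantor.
    have := cantor_nested nat0 (addN n nat1). rewrite (addNC nat0) addN0 hw0 hd0.
    have := hp_gt0 n. have := cantor_d_gt0 (addN n nat1). lra.
Qed.

(** The kept quarter is at distance at least [cantor_d n / 4] from the approximation of [X n],
    whereas equality of the reals would allow only [2 * hp (2 n + 4) = cantor_d n / 8]. *)
Lemma cantor_avoids n : ~ eqR cantor_real (ap (ap X n)).
Proof.
  move=> h. have [_ [_ h1]] := h (addN (addN n n) four). rewrite val_cantor in h1.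
  have hk : addN (addN (addN n n) four) nat1 = addN (addN n nat1) (addN n four).
  { apply: i_inj. rewrite !iD. ring. }
  have h2 := cantor_nested (addN n nat1) (addN n four). rewrite -hk in h2.
  rewrite cantor_wS (cantor_dS n) in h2.
  have h3 : hp (addN (addN n n) four) = cantor_d n / 16.
  { rewrite cantor_d_hp /four /three -!addNA !hpS. by field. }
  rewrite h3 in h1. have h4 := cantor_d_gt0 n.
  have h5 := cantor_d_gt0 (addN (addN (addN n n) four) nat1).
  move: h1 h2 => [h1 h1'] [h2 h2'].
  clear hk.
  case: (classic (cantor_far n (cantor_num n))) => hf.
  - rewrite ifp_l // in h2 h2'. rewrite /cantor_far mulrDl -/(cantor_w n) in hf. lra.
  - rewrite ifp_r // in h2 h2'. move/negP: hf. rewrite -leNgt mulrDl -/(cantor_w n) => hf. lra.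
Qed.

Lemma cantor : exists y : Dom M (N ⇒ N), inI (ap y) /\ forall n, ~ eqR (ap y) (ap (ap X n)).
Proof.
  exists (LAM cantor_real).
  have -> : ap (LAM cantor_real) = cantor_real.
  { apply functional_extensionality => n.
    apply: (ap_LAM [] _ _ (fun _ n => cantor_real n) _ enil).
    rewrite /cantor_real /qcode. apply: Def_pair.
    - apply: Def_pair; last exact: Def_const. apply: Def_cantor_num. by defs.
    - apply: Def_cantor_den. by defs. }
  split; [exact: cantor_inI|exact: cantor_avoids].
Qed.
End Cantor.

(** * The statement [NBI] in a model, and the first half of the theorem *)

Lemma sat_NBI : sat M NBI enil <-> forall Y : Dom M ((N ⇒ N) ⇒ N),
  (forall x y, inI (ap x) -> inI (ap y) -> eqR (ap x) (ap y) -> ap Y x = ap Y y) ->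
  (exists x y, inI (ap x) /\ inI (ap y) /\ ~ eqR (ap x) (ap y) /\ ap Y x = ap Y y) \/
  (exists n, forall x, inI (ap x) -> ap Y x <> n).
Proof.
  have hI G (t : term G (N ⇒ N)) e := sat_in_I G t e.
  have hR G (t u : term G (N ⇒ N)) e := sat_real_eq G t u e.
  split => h Y hY.
  - case: (h Y).
    + move=> x y /hI hx /hI hy /hR hxy. exact: (hY x y hx hy hxy).
    + move=> [x [y [/hI hx [/hI hy [hxy e]]]]]. left. exists x, y. do ! split => //.
      move=> hn. apply hxy. by apply/hR.
    + move=> [n hn]. right. exists n => x hx. apply (hn x). by apply/hI.
  - case: (h Y).
    + move=> x y hx hy hxy. apply: (hY x y); by [apply/hI|apply/hR].
    + move=> [x [y [hx [hy [hxy e]]]]]. left. exists x, y.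
      split; first by apply/hI. split; first by apply/hI. split => //. by move/hR.
    + move=> [n hn]. right. exists n => x /hI hx. exact: hn.
Qed.

Lemma bijection_contradiction :
  (forall A, QFAC N (N ⇒ N) A -> sat M A enil) -> sat M NBI enil.
Proof.
  move=> hAC. apply/sat_NBI => Y hY.
  case: (classic (exists n, forall x, inI (ap x) -> ap Y x <> n)) => [h|h]; [by right|left].
  have hn n : exists x, ap Y (ap normM x) = n.
  { apply NNPP => h1. apply h. exists n => x hx e. apply h1. exists x. rewrite -e.
    have en : ap (ap normM x) = norm x
      by apply functional_extensionality => m; exact: ap_normM.
    apply: hY => //; rewrite en; [exact: norm_inI|exact: norm_eqR]. }
  (* The formula says [Y (norm x) = n]: [v0] is [x], [v1] is [n], and the parameters [v2] and [v3]
     are [Y] and [normM]. *)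
  have hX := hAC _ (@qfac N (N ⇒ N) [(N ⇒ N) ⇒ N; (N ⇒ N) ⇒ N ⇒ N]
    (v2 · (v3 · v0) ≐ v1) I).
  have {hX} := proj1 (satR_closure _ _ _) hX (econs Y (econs normM enil)).
  case; first exact: hn.
  move=> X hX.
  have {}hX n : ap Y (ap normM (ap X n)) = n by exact: hX.
  have [Z hZ] : exists Z : Dom M (N ⇒ N ⇒ N), forall n, ap Z n = ap normM (ap X n).
  { exists (LAM (fun n => ap normM (ap X n))).
    apply: (ap_LAM [] _ _ (fun _ n => ap normM (ap X n)) _ enil). by defs. }
  have [y [hy hd]] := cantor Z.
  exists y, (ap Z (ap Y y)). split => //. split; last first.
    split; first exact: hd. by rewrite hZ hX.
  rewrite hZ. have -> : ap (ap normM (ap X (ap Y y))) = norm (ap X (ap Y y))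
    by apply functional_extensionality => m; exact: ap_normM.
  exact: norm_inI.
Qed.
End Model.
End Arithmetic.

Lemma NBI_from_choice : union RCA0w (QFAC N ty1) ⊢ NBI.
Proof.
  apply completeness; [intros r t; left; apply rca_ext|].
  intros M HE HT.
  assert (HM : models M RCA0w) by (intros A hA; apply HT; now left).
  destruct (FractionField.fraction_field _ _ _ _ _ _ (Arithmetic.model_osr M HM))
    as (K & i & i0 & i1 & iD & iM & i_lt & i_inj & i_frac).
  apply (Arithmetic.bijection_contradiction M HE HM K i i0 i1 iD iM i_lt i_inj i_frac). intros A hA. apply HT. now right.
Qed.

Definition unit_real (M : structure) (x : Dom M ty1) : Prop := sat M (in_I v0) (econs x enil).
Definition same_real (M : structure) (x y : Dom M ty1) : Prop :=
  sat M (real_eq v1 v0) (econs y (econs x enil)).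

(** Collects, without mention of the field, what the second half has to know about the reals of a
    model. *)
Lemma model_reals (M : structure) : extensional M -> models M RCA0w ->
  (forall x, unit_real M x -> same_real M x x) /\
  (forall x y, same_real M x y -> same_real M y x) /\
  (forall x y z, unit_real M x -> unit_real M z ->
    same_real M x y -> same_real M y z -> same_real M x z) /\
  (forall X : Dom M (N ⇒ ty1), exists y, unit_real M y /\ forall n, ~ same_real M y (ap X n)) /\
  (sat M NBI enil <-> forall Y : Dom M ty2,
    (forall x y, unit_real M x -> unit_real M y -> same_real M x y -> ap Y x = ap Y y) ->
    (exists x y, unit_real M x /\ unit_real M y /\ ~ same_real M x y /\ ap Y x = ap Y y) \/
    (exists n, forall x, unit_real M x -> ap Y x <> n)).
Proof.
  intros HE HM.
  destruct (FractionField.fraction_field _ _ _ _ _ _ (Arithmetic.model_osr M HM))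
    as (K & i & i0 & i1 & iD & iM & i_lt & i_inj & i_frac).
  assert (hI : unit_real M = fun x => Arithmetic.inI M K i (ap x)).
  { apply functional_extensionality; intros x. apply propositional_extensionality.
    exact (Arithmetic.sat_in_I M HE HM K i i0 i1 iD iM i_lt i_inj i_frac _ v0 (econs x enil)). }
  assert (hR : same_real M = fun x y => Arithmetic.eqR M K i (ap x) (ap y)).
  { apply functional_extensionality; intros x. apply functional_extensionality; intros y.
    apply propositional_extensionality.
    exact (Arithmetic.sat_real_eq M HE HM K i i0 i1 iD iM i_lt i_inj i_frac _ v1 v0 (econs y (econs x enil))). }
  rewrite hI, hR. split; [|split; [|split; [|split]]].
  - intros x [hx _]. exact (Arithmetic.eqR_refl M HE HM K i i0 i1 iD iM i_lt i_inj i_frac _ hx).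
  - intros x y. apply Arithmetic.eqR_sym.
  - intros x y z [hx _] [hz _]. exact (Arithmetic.eqR_trans M HE HM K i i0 i1 iD iM i_lt i_inj i_frac _ _ _ hx hz).
  - intros X. exact (Arithmetic.cantor M HE HM K i i0 i1 iD iM i_lt i_inj i_frac X).
  - exact (Arithmetic.sat_NBI M HE HM K i i0 i1 iD iM i_lt i_inj i_frac).
Qed.

(** * Models of plots *)

Definition nfun : Type := nat -> nat.
Definition pfst (n : nat) : nat := fst (of_nat n).
Definition psnd (n : nat) : nat := snd (of_nat n).
Definition pr (a b : nat) : nat := to_nat (a, b).
Lemma pfst_pr a b : pfst (pr a b) = a.
Proof. unfold pfst, pr. now rewrite cancel_of_to. Qed.
Lemma psnd_pr a b : psnd (pr a b) = b.
Proof. unfold psnd, pr. now rewrite cancel_of_to. Qed.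

Definition sec (h : nfun) (n : nat) : nfun := fun m => h (pr n m).

Definition charb (P : Prop) : nat := if excluded_middle_informative P then 0 else 1.
Lemma charb_iff P : charb P = 0 <-> P.
Proof. unfold charb. destruct excluded_middle_informative; split; intros; tauto || discriminate. Qed.

Definition least (P : nat -> Prop) : nat :=
  epsilon (inhabits 0) (fun n => P n /\ forall m, P m -> n <= m).
Lemma least_spec (P : nat -> Prop) n : P n -> P (least P).
Proof.
  intros h. apply (epsilon_spec (inhabits 0) (fun n => P n /\ forall m, P m -> n <= m)).
  revert h. induction (Wf_nat.lt_wf n) as [n _ IH]. intros h.
  destruct (classic (exists m, m < n /\ P m)) as [(m & h1 & h2)|h1]; [eauto|].
  exists n. split; [exact h|]. intros m hm.
  destruct (Nat.le_gt_cases n m); [assumption|]. destruct h1; eauto.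
Qed.

(** The clauses from [cl_eq] on give quantifier-free formulas characteristic functions along plots,
    [cl_least] then yields choice for numbers, and [cl_rec] the recursor. Several arguments are
    coded by [pr]. *)
Inductive closed_under (E : nfun -> Prop) : Prop := {
  cl_id : E (fun n => n);
  cl_const : forall c, E (fun _ => c);
  cl_comp : forall f g, E f -> E g -> E (fun n => f (g n));
  cl_pair : forall f g, E f -> E g -> E (fun n => pr (f n) (g n));
  cl_fst : E pfst;
  cl_snd : E psnd;
  cl_add : forall f g, E f -> E g -> E (fun n => f n + g n);
  cl_mul : forall f g, E f -> E g -> E (fun n => f n * g n);
  cl_rec : forall h g, E h -> E g ->
    E (fun n => nat_rec (fun _ => nat) (pfst (g n)) (fun k r => h (pr n (pr k r))) (psnd (g n)));
  cl_least : forall h, E h -> E (fun n => least (fun y => h (pr n y) = 0));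
  cl_eq : forall f g, E f -> E g -> E (fun n => charb (f n = g n));
  cl_lt : forall f g, E f -> E g -> E (fun n => charb (f n < g n));
  cl_and : forall f g, E f -> E g -> E (fun n => charb (f n = 0 /\ g n = 0));
  cl_or : forall f g, E f -> E g -> E (fun n => charb (f n = 0 \/ g n = 0));
  cl_imp : forall f g, E f -> E g -> E (fun n => charb (f n = 0 -> g n = 0)) }.

Section Plots.
Variable E : nfun -> Prop.
Hypothesis clE : closed_under E.

(** A set with distinguished sequences closed under reparametrization, in the manner of
    diffeological spaces; the function spaces below are again such spaces. *)
Record space : Type := {
  pt :> Type;
  plot : (nat -> pt) -> Prop;
  plot_const : forall x, plot (fun _ => x);
  plot_re : forall F e, plot F -> E e -> plot (fun n => F (e n)) }.

Definition sp_nat : space := {|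
  pt := nat; plot := E; plot_const := cl_const E clE; plot_re := cl_comp E clE |}.

Definition arr_pt (A B : space) : Type :=
  {f : A -> B | forall x, plot A x -> plot B (fun n => f (x n))}.
(** The reparametrization [e] is quantified here so that [arr_re] holds. *)
Definition arr_plot (A B : space) (F : nat -> arr_pt A B) : Prop :=
  forall x e, plot A x -> E e -> plot B (fun n => proj1_sig (F (e n)) (x n)).

Lemma arr_const A B x : arr_plot A B (fun _ => x).
Proof. intros y e hy _. apply (proj2_sig x), hy. Qed.
Lemma arr_re A B F e : arr_plot A B F -> E e -> arr_plot A B (fun n => F (e n)).
Proof.
  intros hF he x d hx hd. apply (hF x (fun n => e (d n)) hx). now apply (cl_comp E clE).
Qed.

Definition sp_arr (A B : space) : space := {|
  pt := arr_pt A B; plot := arr_plot A B;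
  plot_const := arr_const A B; plot_re := arr_re A B |}.

Definition sap {A B : space} (f : sp_arr A B) (x : A) : B := proj1_sig f x.

Lemma plot_ap A B (F : nat -> sp_arr A B) x :
  plot (sp_arr A B) F -> plot A x -> plot B (fun n => sap (F n) (x n)).
Proof. intros hF hx. exact (hF x (fun n => n) hx (cl_id E clE)). Qed.

Lemma arr_ext A B (f g : sp_arr A B) : (forall x, sap f x = sap g x) -> f = g.
Proof.
  intros h. apply eq_sig_hprop; [intros; apply proof_irrelevance|].
  now apply functional_extensionality.
Qed.

Definition mk1 {A B : space} (f : A -> B)
  (H : forall x, plot A x -> plot B (fun n => f (x n))) : sp_arr A B := exist _ f H.

Definition mk2 {A B C : space} (f : A -> B -> C)
  (H : forall x y, plot A x -> plot B y -> plot C (fun n => f (x n) (y n))) :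
  sp_arr A (sp_arr B C).
Proof.
  refine (mk1 (fun a => mk1 (f a) (fun y => H _ y (plot_const A a))) _).
  abstract (intros x hx y e hy he; apply (H (fun n => x (e n))); [now apply plot_re|exact hy]).
Defined.

Definition mk3 {A B C D : space} (f : A -> B -> C -> D)
  (H : forall x y z, plot A x -> plot B y -> plot C z -> plot D (fun n => f (x n) (y n) (z n))) :
  sp_arr A (sp_arr B (sp_arr C D)).
Proof.
  refine (mk1 (fun a => mk2 (f a) (fun y z => H _ y z (plot_const A a))) _).
  abstract (intros x hx y e hy he z d hz hd;
    apply (H (fun n => x (e (d n))) (fun n => y (d n))); [|now apply plot_re|exact hz];
    apply (plot_re A x (fun n => e (d n)) hx); now apply (cl_comp E clE)).
Defined.

Fixpoint sp (s : ty) : space :=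
  match s with N => sp_nat | s' ⇒ r => sp_arr (sp s') (sp r) end.

Definition recf (f : sp (N ⇒ N ⇒ N)) (a m : nat) : nat :=
  nat_rec (fun _ => nat) a (fun k r => sap (A := sp_nat) (sap (A := sp_nat) f k) r) m.

(** [cl_rec] iterates one function of [E], so the plot [f] and its two arguments are first merged
    into the function [h] of a coded triple. *)
Lemma plot_recf (f : nat -> sp (N ⇒ N ⇒ N)) (a m : nat -> nat) :
  plot (sp (N ⇒ N ⇒ N)) f -> E a -> E m -> E (fun n => recf (f n) (a n) (m n)).
Proof.
  intros hf ha hm.
  pose (h k := sap (A := sp_nat) (sap (A := sp_nat) (f (pfst k)) (pfst (psnd k))) (psnd (psnd k))).
  assert (hh : E h).
  { apply (plot_ap sp_nat sp_nat (fun k => sap (A := sp_nat) (f (pfst k)) (pfst (psnd k)))).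
    - apply (plot_ap sp_nat (sp (N ⇒ N)) (fun k => f (pfst k))).
      + apply (plot_re (sp (N ⇒ N ⇒ N)) f); [exact hf|exact (cl_fst E clE)].
      + exact (cl_comp E clE pfst psnd (cl_fst E clE) (cl_snd E clE)).
    - exact (cl_comp E clE psnd psnd (cl_snd E clE) (cl_snd E clE)). }
  pose proof (cl_rec E clE h _ hh (cl_pair E clE a m ha hm)) as H.
  replace (fun n => recf (f n) (a n) (m n)) with
    (fun n => nat_rec (fun _ => nat) (pfst (pr (a n) (m n))) (fun k r => h (pr n (pr k r)))
      (psnd (pr (a n) (m n)))); [exact H|].
  apply functional_extensionality; intros n. rewrite pfst_pr, psnd_pr.
  unfold recf. f_equal. apply functional_extensionality; intros k.
  apply functional_extensionality; intros r. unfold h.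
  now repeat (rewrite psnd_pr || rewrite pfst_pr).
Qed.

(** At types other than [N] no axiom governs the recursor, and it simply returns the starting
    value. *)
Definition sp_rec (s : ty) : sp ((N ⇒ s ⇒ s) ⇒ s ⇒ N ⇒ s) :=
  match s return sp ((N ⇒ s ⇒ s) ⇒ s ⇒ N ⇒ s) with
  | N => mk3 (A := sp (N ⇒ N ⇒ N)) (B := sp_nat) (C := sp_nat) (D := sp_nat) recf plot_recf
  | s' => mk3 (A := sp (N ⇒ s' ⇒ s')) (B := sp s') (C := sp_nat) (D := sp s')
      (fun _ a _ => a) (fun _ y _ _ hy _ => hy)
  end.

Definition sp_Sigma (r s t : ty) : sp ((r ⇒ s ⇒ t) ⇒ (r ⇒ s) ⇒ r ⇒ t) :=
  mk3 (A := sp (r ⇒ s ⇒ t)) (B := sp (r ⇒ s)) (C := sp r) (D := sp t)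
    (fun f g x => sap (sap f x) (sap g x))
    (fun f g x hf hg hx => plot_ap (sp s) (sp t) (fun n => sap (f n) (x n)) _
      (plot_ap (sp r) (sp (s ⇒ t)) f x hf hx) (plot_ap (sp r) (sp s) g x hg hx)).

Definition sp_cst (s : ty) (c : cst s) : sp s :=
  match c in cst s return sp s with
  | CZero => 0
  | COne => 1
  | CAdd => mk2 (A := sp_nat) (B := sp_nat) (C := sp_nat) Nat.add (cl_add E clE)
  | CMul => mk2 (A := sp_nat) (B := sp_nat) (C := sp_nat) Nat.mul (cl_mul E clE)
  | CPi s r => mk2 (A := sp s) (B := sp r) (C := sp s) (fun x _ => x) (fun _ _ hx _ => hx)
  | CSigma r s t => sp_Sigma r s t
  | CRec s => sp_rec s
  end.

Definition plots : structure := {|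
  Dom s := sp s;
  ap s r f x := sap f x;
  interp := sp_cst;
  ltD := Nat.lt |}.

Lemma plots_extensional : extensional plots.
Proof. intros s r f g h. now apply arr_ext. Qed.

Lemma plot_eval G s (t : term G s) (e : nat -> env (Dom plots) G) :
  (forall r x, plot (sp r) (fun n => e n r x)) ->
  plot (sp s) (fun n => eval plots (e n) t).
Proof.
  intros he. induction t; simpl.
  - apply he.
  - apply plot_const.
  - now apply plot_ap.
Qed.

Lemma plot_econs G s (d : nat -> sp s) (e : nat -> env (Dom plots) G) :
  plot (sp s) d -> (forall r x, plot (sp r) (fun n => e n r x)) ->
  forall r x, plot (sp r) (fun n => econs (D := Dom plots) (d n) (e n) r x).
Proof. intros hd he. apply var_case; auto. Qed.

Lemma qf_char G (A : form G) : qf A -> forall e : nat -> env (Dom plots) G,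
  (forall r x, plot (sp r) (fun n => e n r x)) ->
  exists c, E c /\ forall n, sat plots A (e n) <-> c n = 0.
Proof.
  induction A; simpl; intros hA e he; try tauto.
  - exists (fun n => charb (eval plots (e n) t = eval plots (e n) t0)).
    split; [|intros n; symmetry; apply charb_iff].
    apply (cl_eq E clE); now apply (plot_eval _ N).
  - exists (fun n => charb (Nat.lt (eval plots (e n) t) (eval plots (e n) t0))).
    split; [|intros n; symmetry; apply charb_iff].
    apply (cl_lt E clE); now apply (plot_eval _ N).
  - exists (fun _ => 1). split; [exact (cl_const E clE 1)|intros; split; [tauto|discriminate]].
  - destruct (IHA1 (proj1 hA) e he) as (c & hc & h1), (IHA2 (proj2 hA) e he) as (d & hd & h2).
    eexists. split; [apply (cl_and E clE c d hc hd)|].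
    intros n. rewrite charb_iff, h1, h2. reflexivity.
  - destruct (IHA1 (proj1 hA) e he) as (c & hc & h1), (IHA2 (proj2 hA) e he) as (d & hd & h2).
    eexists. split; [apply (cl_or E clE c d hc hd)|].
    intros n. rewrite charb_iff, h1, h2. reflexivity.
  - destruct (IHA1 (proj1 hA) e he) as (c & hc & h1), (IHA2 (proj2 hA) e he) as (d & hd & h2).
    eexists. split; [apply (cl_imp E clE c d hc hd)|].
    intros n. rewrite charb_iff, h1, h2. reflexivity.
Qed.

(** The choice functional takes the least witness. To see that it preserves plots, the truth of [A]
    at [x n] and [y] is written as [c (pr n y) = 0] with [c] in [E], to which [cl_least] applies. *)
Lemma plots_qfac A : QFAC ty1 N A -> sat plots A enil.
Proof.
  intros hA. destruct hA as [G A hA]. rewrite satR_closure. intros e h. cbn [satR] in h.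
  pose (Phi (x : sp ty1) := least (fun y => sat plots A
    (econs (D := Dom plots) (s := N) y (econs (D := Dom plots) (s := ty1) x e)))).
  assert (hPhi : forall x, plot (sp ty1) x -> plot sp_nat (fun n => Phi (x n))).
  { intros x hx.
    destruct (qf_char _ A hA (fun k => econs (D := Dom plots) (s := N) (psnd k)
      (econs (D := Dom plots) (s := ty1) (x (pfst k)) e))) as (c & hc & h1).
    { apply plot_econs; [exact (cl_snd E clE)|]. apply plot_econs.
      - exact (plot_re (sp ty1) x pfst hx (cl_fst E clE)).
      - intros r y. apply plot_const. }
    pose proof (cl_least E clE c hc) as H. simpl.
    replace (fun n => Phi (x n)) with (fun n => least (fun y => c (pr n y) = 0)); [exact H|].
    apply functional_extensionality; intros n. unfold Phi. f_equal.
    apply functional_extensionality; intros y. apply propositional_extensionality.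
    rewrite <- h1. now rewrite pfst_pr, psnd_pr. }
  exists (mk1 (A := sp ty1) (B := sp_nat) Phi hPhi). intros x. rewrite satR_fsubst.
  destruct (h x) as [y hy].
  match goal with |- satR _ _ _ ?e' => replace e' with
    (econs (D := Dom plots) (s := N) (Phi x) (econs (D := Dom plots) (s := ty1) x e)) end.
  - apply (least_spec (fun y => sat plots A (econs (D := Dom plots) (s := N) y
      (econs (D := Dom plots) (s := ty1) x e))) y hy).
  - symmetry. apply env_ext_cons; [reflexivity|]. now apply var_case.
Qed.

Lemma plots_semiring A : semiring_ax A -> sat plots A enil.
Proof.
  destruct 1; simpl; intros; unfold sap; simpl; try lia.
  - apply Nat.mul_lt_mono_pos_r; apply H.
  - exists (d0 - d). lia.
Qed.

Lemma plots_models : models plots RCA0w.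
Proof.
  intros A hA. destruct hA as [A hA|s r|r s t| | |r t|G A hA|A hA].
  - now apply plots_semiring.
  - intros x y. apply (Arithmetic.sat_eqT plots plots_extensional). reflexivity.
  - intros f g x. apply (Arithmetic.sat_eqT plots plots_extensional). reflexivity.
  - intros f a. reflexivity.
  - intros f a n. simpl. unfold sap; simpl. unfold recf.
    now rewrite Nat.add_1_r.
  - intros f x y h. apply (Arithmetic.sat_eqT plots plots_extensional) in h.
    apply (Arithmetic.sat_eqT plots plots_extensional). simpl in *. congruence.
  (* The numbers are standard, so induction holds for any formula. *)
  - rewrite satR_closure. intros e [h0 hS]. rewrite satR_inst in h0. intros n.
    induction n as [|n IH]; [exact h0|].
    specialize (hS n IH). rewrite satR_fsubst in hS.
    match type of hS with satR _ _ _ ?e' => replace e' with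
      (econs (D := Dom plots) (s := N) (S n) e) in hS end; [exact hS|].
    apply env_ext_cons; [|reflexivity]. unfold esubst; simpl. unfold sap; simpl. lia.
  - now apply plots_qfac.
Qed.
End Plots.

(** * Second-order formulas *)

Lemma tsubst_up_wk {G D : ctx} (f : subst G D) r s (t : term G s) :
  tsubst (up (s := r) f) (wk t) = wk (tsubst f t).
Proof. unfold wk. now rewrite !tsubst_tsubst. Qed.

(** The normal form is generated by recursion on [k], so its behaviour under substitution needs an
    induction. It allows [S_ax] to be reduced to a formula with one function variable. *)
Lemma fsubst_alternation ex k : forall G D (s : subst G D) (f : term G ty1) gs,
  fsubst s (alternation ex k f gs) = alternation ex k (tsubst s f) (map (tsubst s) gs).
Proof.
  revert ex. induction k as [|k IH]; intros ex G D s f gs.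
  - assert (h : tsubst (up (s := N) s)
        (wk f · code_tuple (map (fun g => bar (wk g) v0) gs)) =
      wk (tsubst s f) · code_tuple (map (fun g => bar (wk g) v0) (map (tsubst s) gs))).
    { cbn [tsubst]. f_equal; [apply tsubst_up_wk|].
      assert (hb : forall g, tsubst (up (s := N) s) (bar (wk g) v0) = bar (wk (tsubst s g)) v0).
      { intros g. rewrite <- tsubst_up_wk. reflexivity. }
      induction gs as [|g [|g' gs] IHg]; [reflexivity|apply hb|].
      cbn [map code_tuple] in *. unfold code_pair in *. cbn [tsubst]. now rewrite hb, IHg. }
    destruct ex; cbn [alternation fsubst]; f_equal; f_equal; exact h.
  - assert (h : fsubst (up (s := ty1) s)
        (alternation (negb ex) k (wk f) (map wk gs ++ [v0])) =
      alternation (negb ex) k (wk (tsubst s f)) (map wk (map (tsubst s) gs) ++ [v0])).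
    { rewrite IH, tsubst_up_wk, map_app, !map_map. do 2 f_equal.
      apply map_ext. intros g. apply tsubst_up_wk. }
    destruct ex; cbn [alternation fsubst]; f_equal; exact h.
Qed.

(** Only quantified variables are restricted. Constants of higher type may occur in terms; they
    correspond to each other in the models compared below. *)
Fixpoint second_order {G} (A : form G) : Prop :=
  match A with
  | Eq _ _ | Lt _ _ | Bot => True
  | And B C | Or B C | Imp B C => second_order B /\ second_order C
  | All s B | Ex s B => (s = N \/ s = ty1) /\ second_order B
  end.

Lemma second_order_alternation ex k : forall G (f : term G ty1) gs,
  second_order (alternation ex k f gs).
Proof.
  revert ex. induction k as [|k IH]; intros [|] G f gs; simpl; auto.
Qed.

(** * A countable model with Skolem functions *)

Lemma full_closed : closed_under (fun _ => True).
Proof. constructor; auto. Qed.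
Definition full : structure := plots (fun _ => True) full_closed.
Definition mkf (f : nfun) : Dom full ty1 :=
  mk1 (fun _ => True) full_closed (A := sp_nat _ full_closed) (B := sp_nat _ full_closed) f (fun _ _ => I).

(** Being a real is judged in [full], because the operations that generate the countable set refer
    to it before that set exists. Absoluteness later identifies it with the notion of the small
    model. *)
Definition unitF (f : nfun) : Prop := unit_real full (mkf f).
Definition sameF (f g : nfun) : Prop := same_real full (mkf f) (mkf g).

Fixpoint var_index {G s} (x : var G s) : nat :=
  match x with vz => 0 | vs y => S (var_index y) end.

Definition conv (s : ty) (f : nfun) : Dom full s :=
  match s return Dom full s with
  | N => f 0
  | N ⇒ N => mkf f
  | s' => eval full enil (dummy s')
  end.
(** A single function codes a whole environment, one section per variable, so that Skolem operations
    need only one argument. *)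
Definition denv (G : ctx) (h : nfun) : env (Dom full) G :=
  fun s x => conv s (sec h (var_index x)).

Definition push_seq (y h : nfun) : nfun :=
  fun n => match pfst n with 0 => y (psnd n) | S i => h (pr i (psnd n)) end.
Lemma sec_cons0 y h : sec (push_seq y h) 0 = y.
Proof.
  apply functional_extensionality; intros n. unfold sec, push_seq. now rewrite pfst_pr, psnd_pr.
Qed.
Lemma sec_consS y h i : sec (push_seq y h) (S i) = sec h i.
Proof.
  apply functional_extensionality; intros n. unfold sec, push_seq. now rewrite pfst_pr, psnd_pr.
Qed.

Definition interleave (h g : nfun) : nfun :=
  fun n => if Nat.even (pfst n) then h (pr (Nat.div2 (pfst n)) (psnd n))
    else g (pr (Nat.div2 (pfst n)) (psnd n)).
Lemma sec_even h g i : sec (interleave h g) (2 * i) = sec h i.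
Proof.
  apply functional_extensionality; intros n. unfold sec, interleave.
  rewrite pfst_pr, psnd_pr, Nat.div2_double.
  now replace (Nat.even (2 * i)) with true by (symmetry; apply Nat.even_spec; now exists i).
Qed.
Lemma sec_odd h g i : sec (interleave h g) (S (2 * i)) = sec g i.
Proof.
  apply functional_extensionality; intros n. unfold sec, interleave.
  rewrite pfst_pr, psnd_pr, Nat.div2_succ_double.
  now rewrite Nat.even_succ, Nat.odd_mul.
Qed.

Definition coinfinite (v : nfun) : Prop := forall n, exists m, n <= m /\ forall i, v i <> m.

Definition numbering (h v : nfun) : Prop :=
  (forall i, unitF (sec h i)) /\
  (forall i j, sameF (sec h i) (sec h j) <-> v i = v j) /\ coinfinite v.

(** A choice by [epsilon], made once for all functions, so that the set of plots can be closed under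
    it. Suitable values exist by [numbering_extend]. *)
Definition renumber (h v : nfun) : nfun :=
  epsilon (inhabits v) (fun v' => numbering h v' /\ forall i, v' (2 * i) = v i).

(** A numbering assigns a value to every section, so sections that are no reals of the unit interval
    are replaced by [x]. *)
Definition sanitize (g x : nfun) : nfun :=
  fun n => if excluded_middle_informative (unitF (sec g (pfst n))) then g n else x (psnd n).
Lemma sec_sanitize_l g x i : unitF (sec g i) -> sec (sanitize g x) i = sec g i.
Proof.
  intros h. apply functional_extensionality; intros n. unfold sec at 1, sanitize.
  rewrite pfst_pr. now destruct excluded_middle_informative.
Qed.
Lemma sec_sanitize_r g x i : ~ unitF (sec g i) -> sec (sanitize g x) i = x.
Proof.
  intros h. apply functional_extensionality; intros n. unfold sec at 1, sanitize.
  rewrite pfst_pr, psnd_pr. now destruct excluded_middle_informative.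
Qed.

(** The sequence [h] of a stage and its values [v] arrive packed as [p n = pr (h n) (v (pfst n))],
    so [v j] is read off at [pr j 0]. The result is the sequence of values of the sections of
    [g]. *)
Definition lookup (p g : nfun) : nfun :=
  fun n => if excluded_middle_informative (unitF (sec g n))
    then psnd (p (pr (least (fun j => sameF (sec g n) (sec (fun k => pfst (p k)) j))) 0))
    else 0.

Inductive basic_op : Type :=
| o_comp | o_pair | o_add | o_mul | o_rec | o_least | o_eq | o_lt | o_and | o_or | o_imp
| o_cons_nat | o_cons | o_interleave | o_renumber | o_sanitize | o_lookup.

(** [o_skolem] makes second-order formulas absolute, and [o_truth] puts the truth values of a
    formula along a sequence of functions into the set, as the functionals of [S_ax] require. *)
Inductive op : Type :=
| o_basic : basic_op -> op
| o_skolem : forall G : ctx, form (ty1 :: G) -> op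
| o_truth : form [ty1] -> op.

Definition op_den (o : op) (f g : nfun) : nfun :=
  match o with
  | o_basic o_comp => fun n => f (g n)
  | o_basic o_pair => fun n => pr (f n) (g n)
  | o_basic o_add => fun n => f n + g n
  | o_basic o_mul => fun n => f n * g n
  | o_basic o_rec => fun n =>
      nat_rec (fun _ => nat) (pfst (g n)) (fun k r => f (pr n (pr k r))) (psnd (g n))
  | o_basic o_least => fun n => least (fun y => f (pr n y) = 0)
  | o_basic o_eq => fun n => charb (f n = g n)
  | o_basic o_lt => fun n => charb (f n < g n)
  | o_basic o_and => fun n => charb (f n = 0 /\ g n = 0)
  | o_basic o_or => fun n => charb (f n = 0 \/ g n = 0)
  | o_basic o_imp => fun n => charb (f n = 0 -> g n = 0)
  | o_basic o_cons_nat => fun n => match n with 0 => f 0 | S m => g m end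
  | o_basic o_cons => push_seq f g
  | o_basic o_interleave => interleave f g
  | o_basic o_renumber => renumber f g
  | o_basic o_sanitize => sanitize f g
  | o_basic o_lookup => lookup f g
  | o_skolem G A =>
      epsilon (inhabits f) (fun w => sat full A (econs (D := Dom full) (s := ty1) (mkf w) (denv G f)))
  | o_truth A => fun n => charb (sat full A (econs (D := Dom full) (s := ty1) (mkf (sec f n)) enil))
  end.

Inductive code : Type :=
| c_id | c_fst | c_snd
| c_const : nat -> code
| c_op : op -> code -> code -> code.

Fixpoint den (c : code) : nfun :=
  match c with
  | c_id => fun n => n
  | c_fst => pfst
  | c_snd => psnd
  | c_const k => fun _ => k
  | c_op o a b => op_den o (den a) (den b)
  end.

Lemma countable_op : countable op.
Proof.
  apply countable_surj with (Y := (nat * ({G : ctx & form (ty1 :: G)} * form [ty1]))%type)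
    (e := fun p => match p with
      | (0, _) => o_basic o_comp | (1, _) => o_basic o_pair | (2, _) => o_basic o_add
      | (3, _) => o_basic o_mul | (4, _) => o_basic o_rec | (5, _) => o_basic o_least
      | (6, _) => o_basic o_eq | (7, _) => o_basic o_lt | (8, _) => o_basic o_and
      | (9, _) => o_basic o_or | (10, _) => o_basic o_imp | (11, _) => o_basic o_cons_nat
      | (12, _) => o_basic o_cons | (13, _) => o_basic o_interleave
      | (14, _) => o_basic o_renumber | (15, _) => o_basic o_sanitize
      | (16, _) => o_basic o_lookup
      | (17, (existT _ G A, _)) => o_skolem G A
      | (_, (_, A)) => o_truth A end).
  - assert (d : {G : ctx & form (ty1 :: G)} * form [ty1]) by exact (existT (fun G => form (ty1 :: G)) [] Bot, Bot).
    intros [o|G A|A].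
    + destruct o; [exists (0, d)|exists (1, d)|exists (2, d)|exists (3, d)|exists (4, d)
        |exists (5, d)|exists (6, d)|exists (7, d)|exists (8, d)|exists (9, d)|exists (10, d)
        |exists (11, d)|exists (12, d)|exists (13, d)|exists (14, d)|exists (15, d)
        |exists (16, d)]; reflexivity.
    + now exists (17, (existT (fun G => form (ty1 :: G)) G A, Bot)).
    + now exists (18, (existT (fun G => form (ty1 :: G)) [] Bot, A)).
  - apply countable_prod; [apply countable_nat|]. apply countable_prod; [|apply countable_form].
    apply countable_sigT; [|intros; apply countable_form].
    destruct countable_ty as [f hf].
    exists (fix c (G : ctx) := match G with [] => 0 | s :: G' => S (to_nat (f s, c G')) end).
    induction x as [|s x IH]; destruct y as [|s' y]; intros h; try discriminate; [reflexivity|].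
    apply eq_add_S, to_nat_inj in h. injection h as h1 h2. f_equal; auto.
Qed.

Lemma countable_code : countable code.
Proof.
  destruct countable_op as [f hf].
  exists (fix c (x : code) := match x with
    | c_id => to_nat (0, 0) | c_fst => to_nat (1, 0) | c_snd => to_nat (2, 0)
    | c_const k => to_nat (3, k)
    | c_op o a b => to_nat (4, to_nat (f o, to_nat (c a, c b))) end).
  induction x as [| | |k|o a IHa b IHb]; destruct y as [| | |k'|o' a' b']; intros h;
    apply to_nat_inj in h; try discriminate; try reflexivity; injection h as h; [now subst|].
  apply to_nat_inj in h. injection h as h1 h2. apply to_nat_inj in h2. injection h2 as h2 h3.
  f_equal; auto.
Qed.

Definition El (f : nfun) : Prop := exists c, den c = f.

Lemma El_op o f g : El f -> El g -> El (op_den o f g).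
Proof. intros [c <-] [d <-]. now exists (c_op o c d). Qed.

Lemma El_closed : closed_under El.
Proof.
  constructor.
  - now exists c_id.
  - intros k. now exists (c_const k).
  - intros f g. apply (El_op (o_basic o_comp)).
  - intros f g. apply (El_op (o_basic o_pair)).
  - now exists c_fst.
  - now exists c_snd.
  - intros f g. apply (El_op (o_basic o_add)).
  - intros f g. apply (El_op (o_basic o_mul)).
  - intros f g. apply (El_op (o_basic o_rec)).
  - intros f hf. apply (El_op (o_basic o_least) f f hf hf).
  - intros f g. apply (El_op (o_basic o_eq)).
  - intros f g. apply (El_op (o_basic o_lt)).
  - intros f g. apply (El_op (o_basic o_and)).
  - intros f g. apply (El_op (o_basic o_or)).
  - intros f g. apply (El_op (o_basic o_imp)).
Qed.

Definition small : structure := plots El El_closed.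
Lemma small_extensional : extensional small.
Proof. apply plots_extensional. Qed.
Lemma small_models : models small RCA0w.
Proof. apply plots_models. Qed.

Definition mks (f : nfun) (h : El f) : Dom small ty1 :=
  mk1 El El_closed (A := sp_nat _ El_closed) (B := sp_nat _ El_closed) f
    (fun x hx => cl_comp El El_closed f x h hx).
Definition fn (f : Dom small ty1) : nfun := proj1_sig f.
Lemma fn_El f : El (fn f).
Proof. exact (proj2_sig f (fun n => n) (cl_id El El_closed)). Qed.

(** * Absoluteness of second-order formulas *)

(** A logical relation, since at higher types neither model is part of the other; it still relates
    the values of all terms. *)
Fixpoint rel (s : ty) : Dom small s -> Dom full s -> Prop :=
  match s return Dom small s -> Dom full s -> Prop with
  | N => fun x y => x = y
  | s' ⇒ r => fun f g => forall x y, rel s' x y -> rel r (@ap small _ _ f x) (@ap full _ _ g y)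
  end.

Lemma rel_ty1 (f : Dom small ty1) (g : Dom full ty1) : rel ty1 f g <-> g = mkf (fn f).
Proof.
  split.
  - intros h. apply arr_ext. intros x. symmetry. apply (h x x eq_refl).
  - intros -> x y ->. reflexivity.
Qed.

Lemma rel_cst s (c : cst s) : rel s (interp small c) (interp full c).
Proof.
  destruct c; cbn [rel]; try reflexivity.
  - now intros x ? <- y ? <-.
  - now intros x ? <- y ? <-.
  - intros x y h x' y' _. exact h.
  - intros f f' hf g g' hg x x' hx. apply (hf x x' hx). apply (hg x x' hx).
  - destruct s as [|s r]; cbn [rel].
    + intros f f' hf a ? <- m ? <-. simpl. unfold sap; simpl. unfold recf.
      induction m as [|m IH]; simpl; [reflexivity|]. now apply (hf m m eq_refl).
    + intros f f' hf a a' ha m m' _. exact ha.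
Qed.

Lemma rel_eval G s (t : term G s) (e : env (Dom small) G) (e' : env (Dom full) G) :
  (forall r x, rel r (e r x) (e' r x)) -> rel s (eval small e t) (eval full e' t).
Proof.
  intros he. induction t; simpl; [apply he|apply rel_cst|]. now apply IHt1.
Qed.

Lemma rel_econs G s d d' (e : env (Dom small) G) (e' : env (Dom full) G) :
  rel s d d' -> (forall r x, rel r (e r x) (e' r x)) ->
  forall r x, rel r (econs (D := Dom small) d e r x) (econs (D := Dom full) d' e' r x).
Proof. intros hd he. apply var_case; auto. Qed.

Definition so_ctx (G : ctx) : Prop := forall s, var G s -> s = N \/ s = ty1.

Lemma env_code G : so_ctx G -> forall e : env (Dom small) G,
  exists h, El h /\ forall s x, rel s (e s x) (denv G h s x).
Proof.
  induction G as [|s G IH]; intros hG e.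
  - exists (fun n => n). split; [apply (cl_id El El_closed)|intros s x; destruct (var_nil _ x)].
  - destruct (IH (fun r x => hG r (vs x)) (etail e)) as (h & hh & hr).
    assert (hy : exists y, El y /\ rel s (e s vz) (conv s y)).
    { destruct (hG s vz) as [hs|hs]; subst s.
      - exists (fun _ => e N vz). split; [apply (cl_const El El_closed)|reflexivity].
      - exists (fn (e ty1 vz)). split; [apply fn_El|]. now apply rel_ty1. }
    destruct hy as (y & hy & hry).
    exists (push_seq y h). split; [exact (El_op (o_basic o_cons) y h hy hh)|].
    apply var_case.
    + unfold denv; simpl. now rewrite sec_cons0.
    + intros r x. unfold denv; simpl. rewrite sec_consS. apply hr.
Qed.

Lemma rel_det s (x : Dom small s) y y' : s = N \/ s = ty1 -> rel s x y -> rel s x y' -> y = y'.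
Proof.
  intros [->| ->].
  - simpl. congruence.
  - rewrite !rel_ty1. congruence.
Qed.

(** The Tarski-Vaught criterion: the parameters are coded by one element of the set, and the Skolem
    operation applied to it stays in the set. *)
Lemma skolem G (A : form (ty1 :: G)) e (e' : env (Dom full) G) :
  so_ctx G -> (forall s x, rel s (e s x) (e' s x)) ->
  (exists g : Dom full ty1, sat full A (econs g e')) ->
  exists f : Dom small ty1, sat full A (econs (D := Dom full) (s := ty1) (mkf (fn f)) e').
Proof.
  intros hG he [g hg]. destruct (env_code G hG e) as (h & hh & hr).
  assert (E : e' = denv G h).
  { apply env_ext. intros s x. apply (rel_det s (e s x)); auto. }
  subst e'.
  pose proof (El_op (o_skolem G A) h h hh hh) as hw.
  exists (mks _ hw). unfold fn; simpl proj1_sig.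
  apply (epsilon_spec (inhabits h) (fun w =>
    sat full A (econs (D := Dom full) (s := ty1) (mkf w) (denv G h)))).
  exists (proj1_sig g).
  replace (mkf (proj1_sig g)) with g; [exact hg|now apply arr_ext].
Qed.

(** For a universal function quantifier, a counterexample in [full] is pulled back by the Skolem
    function of the negation. *)
Lemma absolute G (A : form G) : second_order A -> so_ctx G -> forall e e',
  (forall s x, rel s (e s x) (e' s x)) -> sat small A e <-> sat full A e'.
Proof.
  assert (hcons : forall G s, s = N \/ s = ty1 -> so_ctx G -> so_ctx (s :: G))
    by (intros G' s hs hG'; unfold so_ctx; apply var_case; auto).
  induction A; intros hA hG e e' he; cbn [satR second_order] in *.
  - rewrite (rel_eval _ N t e e' he), (rel_eval _ N t0 e e' he). reflexivity.
  - rewrite (rel_eval _ N t e e' he), (rel_eval _ N t0 e e' he). reflexivity.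
  - reflexivity.
  - rewrite (IHA1 (proj1 hA) hG e e' he), (IHA2 (proj2 hA) hG e e' he). reflexivity.
  - rewrite (IHA1 (proj1 hA) hG e e' he), (IHA2 (proj2 hA) hG e e' he). reflexivity.
  - rewrite (IHA1 (proj1 hA) hG e e' he), (IHA2 (proj2 hA) hG e e' he). reflexivity.
  - destruct hA as [hs hA].
    assert (IH : forall d d', rel s d d' -> sat small A (econs d e) <-> sat full A (econs d' e'))
      by (intros; apply IHA; auto using rel_econs).
    destruct hs as [-> | ->].
    + split; intros h d; apply (IH d d eq_refl), h.
    + split; intros h d.
      * apply NNPP. intros hd.
        destruct (skolem G (Not A) e e' hG he) as [f hf]; [now exists d|].
        apply hf. apply (IH f); [now apply rel_ty1|apply h].
      * apply (IH d (mkf (fn d))); [now apply rel_ty1|apply h].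
  - destruct hA as [hs hA].
    assert (IH : forall d d', rel s d d' -> sat small A (econs d e) <-> sat full A (econs d' e'))
      by (intros; apply IHA; auto using rel_econs).
    destruct hs as [-> | ->].
    + split; intros [d h]; exists d; apply (IH d d eq_refl), h.
    + split.
      * intros [d h]. exists (mkf (fn d)). apply (IH d); [now apply rel_ty1|exact h].
      * intros h. destruct (skolem G A e e' hG he h) as [f hf].
        exists f. apply (IH f (mkf (fn f))); [now apply rel_ty1|exact hf].
Qed.

Lemma so_ctx1 : so_ctx [ty1].
Proof. unfold so_ctx. apply var_case; [auto|intros r y; destruct (var_nil _ y)]. Qed.

Lemma so_ctx2 : so_ctx [ty1; ty1].
Proof. unfold so_ctx. apply var_case; [auto|apply so_ctx1]. Qed.

Lemma rel_enil r x : rel r (@enil (Dom small) r x) (@enil (Dom full) r x).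
Proof. destruct (var_nil _ x). Qed.

Lemma absolute1 (A : form [ty1]) (f : Dom small ty1) : second_order A ->
  sat small A (econs f enil) <->
  sat full A (econs (D := Dom full) (s := ty1) (mkf (fn f)) enil).
Proof.
  intros hA. apply absolute; [exact hA|exact so_ctx1|].
  apply rel_econs; [now apply rel_ty1|apply rel_enil].
Qed.

Lemma unit_real_small f : unit_real small f <-> unitF (fn f).
Proof. apply absolute1. cbn. intuition. Qed.

Lemma same_real_small f g : same_real small f g <-> sameF (fn f) (fn g).
Proof.
  apply absolute; [cbn; intuition|exact so_ctx2|].
  apply rel_econs; [now apply rel_ty1|].
  apply rel_econs; [now apply rel_ty1|apply rel_enil].
Qed.

(** Currying: plots of functions are the sections of single elements of [El], so there are only
    countably many of them. *)
Lemma plot_small (h : nfun) : El h <-> exists F : nat -> Dom small ty1,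
  plot El (sp El El_closed ty1) F /\ h = fun k => fn (F (pfst k)) (psnd k).
Proof.
  split.
  - intros hh.
    assert (hs : forall n, El (sec h n)).
    { intros n. apply (cl_comp El El_closed h (fun m => pr n m) hh).
      exact (cl_pair El El_closed (fun _ => n) (fun m => m)
        (cl_const El El_closed n) (cl_id El El_closed)). }
    exists (fun n => mks (sec h n) (hs n)). split.
    + intros x e hx he. unfold mks; simpl. unfold sec.
      apply (cl_comp El El_closed h (fun n => pr (e n) (x n)) hh).
      now apply (cl_pair El El_closed).
    + apply functional_extensionality; intros k. unfold fn, mks; simpl. unfold sec.
      f_equal. unfold pr, pfst, psnd. now rewrite <- surjective_pairing, cancel_to_of.
  - intros (F & hF & ->). exact (hF psnd pfst (cl_snd El El_closed) (cl_fst El El_closed)).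
Qed.

Lemma plot_sec (F : nat -> Dom small ty1) : plot El (sp El El_closed ty1) F ->
  exists h, El h /\ forall n, fn (F n) = sec h n.
Proof.
  intros hF. exists (fun k => fn (F (pfst k)) (psnd k)). split; [apply plot_small; eauto|].
  intros n. apply functional_extensionality; intros m. unfold sec. now rewrite pfst_pr, psnd_pr.
Qed.

(** The functional is truth in [small]. By absoluteness it agrees along a plot with [o_truth], so it
    preserves plots. *)
Lemma small_S_ax k : sat small (S_ax k) enil.
Proof.
  pose (A := Sigma1 k (G := [ty1]) v0).
  assert (hA : second_order A) by apply second_order_alternation.
  assert (hS : forall F, plot El (sp El El_closed ty1) F ->
    El (fun n => charb (sat small A (econs (F n) enil)))).
  { intros F hF. destruct (plot_sec F hF) as (h & hh & e).
    pose proof (El_op (o_truth A) h h hh hh) as H.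
    replace (fun n => charb (sat small A (econs (F n) enil))) with (op_den (o_truth A) h h);
      [exact H|].
    apply functional_extensionality; intros n. simpl. f_equal.
    apply propositional_extensionality. rewrite absolute1 by exact hA. now rewrite e. }
  exists (mk1 El El_closed (A := sp El El_closed ty1) (B := sp_nat El El_closed)
    (fun f => charb (sat small A (econs (D := Dom small) (s := ty1) f enil))) hS).
  intros f.
  assert (hsub : Sigma1 k (G := [ty1; ty2]) v0 = fsubst (scons v0 snil) A)
    by (unfold A, Sigma1; rewrite fsubst_alternation; reflexivity).
  unfold Iff. cbn [satR]. rewrite hsub, satR_fsubst.
  match goal with |- context [satR small eq A ?e] => replace e with
    (econs (D := Dom small) (s := ty1) f enil) end.
  - simpl. unfold sap; simpl. rewrite charb_iff. split; [|tauto].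
    unfold charb. destruct excluded_middle_informative; auto.
  - symmetry. apply env_ext_cons; [reflexivity|]. intros r x; destruct (var_nil _ x).
Qed.

Lemma small_Z2w : models small Z2w.
Proof.
  intros A (k & _ & [hA|<-]); [now apply small_models|apply small_S_ax].
Qed.

(** * A bijection between the unit interval and the numbers *)

Lemma coinfinite_enum v : coinfinite v -> exists c : nfun,
  (forall n i, v i <> c n) /\ forall n m, n < m -> c n < c m.
Proof.
  intros hv.
  pose (g n := proj1_sig (constructive_indefinite_description _ (hv n))).
  assert (hg : forall n, n <= g n /\ forall i, v i <> g n)
    by (intros n; unfold g; now destruct constructive_indefinite_description).
  pose (c := fix c n := match n with 0 => g 0 | S n => g (S (c n)) end).
  exists c. split.
  - intros [|n]; apply hg.
  - assert (hS : forall n, c n < c (S n)) by (intros n; apply (hg (S (c n)))).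
    intros n m h. induction h as [|m h IH]; [apply hS|]. specialize (hS m). lia.
Qed.

(** Old reals sit at the even indices and keep their values. A new class with least index [j]
    receives [c (2 * j)], where [c] enumerates numbers free so far; equal reals thus share a value,
    and all [c (2 * n + 1)] remain free. *)
Lemma numbering_extend (r : nat -> nat -> Prop) (v : nfun) :
  (forall i, r i i) -> (forall i j, r i j -> r j i) ->
  (forall i j k, r i j -> r j k -> r i k) ->
  (forall i j, r (2 * i) (2 * j) <-> v i = v j) -> coinfinite v ->
  exists v' : nfun, (forall i, v' (2 * i) = v i) /\
    (forall i j, r i j <-> v' i = v' j) /\ coinfinite v'.
Proof.
  intros rr rs rt hv hc. destruct (coinfinite_enum v hc) as (c & c1 & c2).
  assert (c3 : forall n m, c n = c m -> n = m).
  { intros n m h. destruct (Nat.lt_trichotomy n m) as [h'|[h'|h']]; [|exact h'|];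
      apply c2 in h'; lia. }
  pose (v' k := match excluded_middle_informative (exists i, r k (2 * i)) with
    | left h => v (proj1_sig (constructive_indefinite_description _ h))
    | right _ => c (2 * least (r k)) end).
  assert (hold : forall k i, r k (2 * i) -> v' k = v i).
  { intros k i h. unfold v'. destruct excluded_middle_informative as [h'|h'];
      [|destruct h'; eauto].
    destruct constructive_indefinite_description as [j hj]; simpl. apply hv. eauto. }
  assert (hnew : forall k, ~ (exists i, r k (2 * i)) -> v' k = c (2 * least (r k))).
  { intros k h. unfold v'. now destruct excluded_middle_informative. }
  assert (hleast : forall k, r k (least (r k))) by (intros k; now apply (least_spec (r k) k)).
  exists v'. split; [auto|split].
  - intros k l.
    destruct (classic (exists i, r k (2 * i))) as [[i hi]|hk],
      (classic (exists i, r l (2 * i))) as [[j hj]|hl].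
    + rewrite (hold k i hi), (hold l j hj), <- hv. split; eauto.
    + rewrite (hold k i hi), (hnew l hl). split; [|intros e; now destruct (c1 _ _ e)].
      intros h. destruct hl. eauto.
    + rewrite (hold l j hj), (hnew k hk). split; [|intros e; symmetry in e; now destruct (c1 _ _ e)].
      intros h. destruct hk. eauto.
    + rewrite (hnew k hk), (hnew l hl). split.
      * intros h. do 2 f_equal. f_equal. apply functional_extensionality; intros j.
        apply propositional_extensionality. split; eauto.
      * intros h. apply c3 in h. assert (e : least (r k) = least (r l)) by lia.
        apply rt with (least (r k)); [apply hleast|]. rewrite e. apply rs, hleast.
  - intros n. exists (c (2 * n + 1)). split.
    + assert (h : forall m, m <= c m).
      { induction m as [|m IH]; [lia|]. pose proof (c2 m (S m) (Nat.lt_succ_diag_r m)). lia. }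
      specialize (h (2 * n + 1)). lia.
    + intros k e. destruct (classic (exists i, r k (2 * i))) as [[i hi]|hk].
      * rewrite (hold k i hi) in e. now destruct (c1 _ _ e).
      * rewrite (hnew k hk) in e. apply c3 in e. lia.
Qed.

(** This and the next facts are read off from [small], a model of the base theory, and translated by
    absoluteness. *)
Lemma real_refl f : El f -> unitF f -> sameF f f.
Proof.
  intros hf hI. pose proof (proj1 (model_reals small small_extensional small_models) (mks f hf)) as h.
  rewrite unit_real_small, same_real_small in h. exact (h hI).
Qed.

Lemma real_sym f g : El f -> El g -> sameF f g -> sameF g f.
Proof.
  intros hf hg. pose proof (proj1 (proj2 (model_reals small small_extensional small_models))
    (mks f hf) (mks g hg)) as h.
  rewrite !same_real_small in h. exact h.
Qed.

Lemma real_trans f g k : El f -> El g -> El k -> unitF f -> unitF k ->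
  sameF f g -> sameF g k -> sameF f k.
Proof.
  intros hf hg hk. pose proof (proj1 (proj2 (proj2
    (model_reals small small_extensional small_models))) (mks f hf) (mks g hg) (mks k hk)) as h.
  rewrite !same_real_small, !unit_real_small in h. exact h.
Qed.

Lemma real_cantor h : El h -> exists y, El y /\ unitF y /\ forall n, ~ sameF y (sec h n).
Proof.
  intros hh.
  assert (H : forall x y, El x -> El y -> El (fun n => h (pr (x n) (y n))))
    by (intros x y hx hy; apply (cl_comp El El_closed h); auto; now apply (cl_pair El El_closed)).
  pose (X := mk2 El El_closed (A := sp_nat El El_closed) (B := sp_nat El El_closed)
    (C := sp_nat El El_closed) (fun a b => h (pr a b)) H).
  destruct (proj1 (proj2 (proj2 (proj2 (model_reals small small_extensional small_models)))) X)
    as (y & h1 & h2).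
  exists (fn y). split; [apply fn_El|]. split; [now apply unit_real_small|].
  intros n hn. apply (h2 n). now apply same_real_small.
Qed.

Lemma El_sec h n : El h -> El (sec h n).
Proof.
  intros hh. apply (cl_comp El El_closed h (fun m => pr n m) hh).
  exact (cl_pair El El_closed _ _ (cl_const El El_closed n) (cl_id El El_closed)).
Qed.

Lemma El_enum : exists en : nat -> nfun, (forall n, El (en n)) /\ forall f, El f -> exists n, en n = f.
Proof.
  destruct (countable_enum _ countable_code) as [e he].
  exists (fun n => match e n with Some c => den c | None => den c_id end). split.
  - intros n. destruct (e n) as [c|]; [now exists c|now exists c_id].
  - intros f [c <-]. destruct (he c) as [n hn]. exists n. now rewrite hn.
Qed.

(** * The stages of the construction *)

(** Both sequences lie in [El], so the values along any sequence covered by a stage can be computed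
    inside [El] from that stage alone. *)
Record stage : Type := {
  st_h : nfun;
  st_v : nfun;
  st_hE : El st_h;
  st_vE : El st_v;
  st_num : numbering st_h st_v }.

(** Positions may change, since stages are extended by interleaving and by prepending. *)
Definition extends (s t : stage) : Prop :=
  forall i, exists j, sec (st_h t) j = sec (st_h s) i /\ st_v t j = st_v s i.

Lemma extends_trans s t u : extends s t -> extends t u -> extends s u.
Proof.
  intros h1 h2 i. destruct (h1 i) as (j & e1 & e2), (h2 j) as (k & e3 & e4).
  exists k. split; congruence.
Qed.

(** A stage lists infinitely many sections, so the start is one real repeated forever, with value
    [0]. *)
Lemma stage_init : inhabited stage.
Proof.
  destruct (real_cantor (fun n => n) (cl_id El El_closed)) as (x & hx & hI & _).
  assert (hs : forall i, sec (fun n => x (psnd n)) i = x).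
  { intros i. apply functional_extensionality; intros n. unfold sec. now rewrite psnd_pr. }
  constructor. refine {| st_h := fun n => x (psnd n); st_v := fun _ => 0 |}.
  - exact (cl_comp El El_closed x psnd hx (cl_snd El El_closed)).
  - apply (cl_const El El_closed).
  - split; [intros i; now rewrite hs|split].
    + intros i j. rewrite !hs. split; [reflexivity|intros _; now apply real_refl].
    + intros n. exists (S n). split; [lia|discriminate].
Qed.

(** Sections of [g] that are no reals are replaced by a real already listed; the result is
    interleaved with the old sequence and numbered by [renumber]. *)
Lemma stage_add (s : stage) g : El g -> exists t, extends s t /\
  forall i, unitF (sec g i) -> exists j, sec (st_h t) j = sec g i.
Proof.
  intros hg. destruct s as [h v hh hv [n1 [n2 n3]]].
  pose (g' := sanitize g (sec h 0)).
  assert (hg' : El g') by (apply (El_op (o_basic o_sanitize)); auto using El_sec).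
  assert (hgI : forall i, unitF (sec g' i)).
  { intros i. destruct (classic (unitF (sec g i))) as [hi|hi].
    - unfold g'. now rewrite sec_sanitize_l.
    - unfold g'. now rewrite sec_sanitize_r. }
  pose (h' := interleave h g').
  assert (hh' : El h') by (apply (El_op (o_basic o_interleave)); auto).
  assert (hI : forall i, unitF (sec h' i)).
  { intros i. destruct (Nat.Even_or_Odd i) as [[j ->]|[j ->]]; unfold h'.
    - rewrite sec_even. apply n1.
    - rewrite Nat.add_1_r, sec_odd. apply hgI. }
  assert (hv' : numbering h' (renumber h' v) /\ forall i, renumber h' v (2 * i) = v i).
  { apply (epsilon_spec (inhabits v) (fun v' => numbering h' v' /\ forall i, v' (2 * i) = v i)).
    destruct (numbering_extend (fun i j => sameF (sec h' i) (sec h' j)) v)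
      as (v' & e1 & e2 & e3); auto.
    - intros i. apply real_refl; auto using El_sec.
    - intros i j. apply real_sym; auto using El_sec.
    - intros i j k. apply real_trans; auto using El_sec.
    - intros i j. unfold h'. rewrite !sec_even. apply n2.
    - exists v'. split; [split; [exact hI|split; [exact e2|exact e3]]|exact e1]. }
  exists {| st_h := h'; st_v := renumber h' v; st_hE := hh';
    st_vE := El_op (o_basic o_renumber) h' v hh' hv; st_num := proj1 hv' |}.
  split.
  - intros i. exists (2 * i). simpl st_h. simpl st_v. split; [apply sec_even|apply hv'].
  - intros i hi. exists (S (2 * i)). simpl st_h. unfold h'. rewrite sec_odd.
    now apply sec_sanitize_l.
Qed.

(** If [n] is still free, Cantor's theorem in the model supplies a real that is not listed; it is
    put in front with the value [n]. *)
Lemma stage_hit (s : stage) n : exists t, extends s t /\ exists j, st_v t j = n.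
Proof.
  destruct (classic (exists j, st_v s j = n)) as [h0|h0].
  { exists s. split; [intros i; now exists i|exact h0]. }
  destruct s as [h v hh hv [n1 [n2 n3]]]; simpl in h0.
  destruct (real_cantor h hh) as (y & hy & hyI & hyd).
  assert (hv' : El (fun k => match k with 0 => n | S m => v m end)).
  { exact (El_op (o_basic o_cons_nat) (fun _ => n) v (cl_const El El_closed n) hv). }
  assert (hnum : numbering (push_seq y h) (fun k => match k with 0 => n | S m => v m end)).
  { split; [|split].
    - intros [|i]; [now rewrite sec_cons0|rewrite sec_consS; apply n1].
    - intros [|i] [|j]; rewrite ?sec_cons0, ?sec_consS.
      + split; [reflexivity|intros _; now apply real_refl].
      + split; [intros e; now destruct (hyd j)|intros e; destruct h0; now exists j].
      + split; [intros e; destruct (hyd i); apply real_sym; auto using El_sec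
          |intros e; destruct h0; now exists i].
      + apply n2.
    (* Free numbers above [n] are taken, as [n] itself has just been used. *)
    - intros m. destruct (n3 (max m (S n))) as (k & hk & hk'). exists k.
      split; [lia|]. intros [|i]; [lia|apply hk']. }
  exists {| st_h := push_seq y h; st_hE := El_op (o_basic o_cons) y h hy hh; st_vE := hv';
    st_num := hnum |}.
  split; [intros i; exists (S i); simpl; split; [apply sec_consS|reflexivity]|now exists 0].
Qed.

Lemma stage_step (s : stage) g n : El g -> exists t, extends s t /\
  (forall i, unitF (sec g i) -> exists j, sec (st_h t) j = sec g i) /\ exists j, st_v t j = n.
Proof.
  intros hg. destruct (stage_add s g hg) as (t & h1 & h2), (stage_hit t n) as (u & h3 & h4).
  exists u. split; [eapply extends_trans; eauto|split; [|exact h4]].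
  intros i hi. destruct (h2 i hi) as [j hj], (h3 j) as (k & hk & _). exists k. congruence.
Qed.

(** The step from stage [k] adds the [k]-th element of [El], read as a sequence, and makes [k] a
    value. Along a sequence so treated, [Y] is given by [lookup] in a single stage. *)
Lemma unit_bijection : exists Y : nfun -> nat,
  (forall x y, El x -> El y -> unitF x -> unitF y -> (sameF x y <-> Y x = Y y)) /\
  (forall n, exists x, El x /\ unitF x /\ Y x = n) /\
  (forall g, El g -> El (fun n => Y (sec g n))).
Proof.
  destruct El_enum as (en & en1 & en2). destruct stage_init as [s0].
  pose (next s k := proj1_sig (constructive_indefinite_description _ (stage_step s (en k) k (en1 k)))).
  assert (hnext : forall s k, extends s (next s k) /\
    (forall i, unitF (sec (en k) i) -> exists j, sec (st_h (next s k)) j = sec (en k) i) /\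
    exists j, st_v (next s k) j = k)
    by (intros s k; unfold next; now destruct constructive_indefinite_description).
  pose (st := fix st k := match k with 0 => s0 | S k => next (st k) k end).
  assert (hst : forall k l, k <= l -> extends (st k) (st l)).
  { intros k l h. induction h as [|l h IH]; [intros i; now exists i|].
    apply extends_trans with (1 := IH), (hnext (st l) l). }
  (* The value of a real may be read at any stage that lists an equal real; [hV] moves two such
     readings to the later of the two stages. *)
  pose (V x n := exists k j, sameF x (sec (st_h (st k)) j) /\ st_v (st k) j = n).
  assert (hV : forall x y n m, El x -> El y -> unitF x -> unitF y -> V x n -> V y m ->
    (sameF x y <-> n = m)).
  { intros x y n m hx hy ix iy (k & j & e1 & <-) (k' & j' & e2 & <-).
    destruct (hst k (max k k') ltac:(lia) j) as (i & a1 & a2).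
    destruct (hst k' (max k k') ltac:(lia) j') as (i' & a3 & a4).
    rewrite <- a1 in e1. rewrite <- a3 in e2. rewrite <- a2, <- a4.
    destruct (st (max k k')) as [h v hh hv [n1 [n2 n3]]]; simpl in *.
    rewrite <- n2. split; intros e.
    - apply real_trans with x; auto using El_sec; [apply real_sym; auto using El_sec|].
      apply real_trans with y; auto using El_sec.
    - apply real_trans with (sec h i); auto using El_sec.
      apply real_trans with (sec h i'); auto using El_sec. apply real_sym; auto using El_sec. }
  assert (hVex : forall g, El g -> exists k, forall i, unitF (sec g i) ->
    exists j, sec (st_h (st k)) j = sec g i).
  { intros g hg. destruct (en2 g hg) as [k <-]. exists (S k). apply (hnext (st k) k). }
  assert (hVtot : forall x, El x -> unitF x -> exists n, V x n).
  { intros x hx ix.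
    (* A single real is treated as a constant sequence. *)
    destruct (hVex (fun n => x (psnd n)) (cl_comp El El_closed x psnd hx (cl_snd El El_closed)))
      as (k & hk).
    assert (e : sec (fun n => x (psnd n)) 0 = x)
      by (apply functional_extensionality; intros n; unfold sec; now rewrite psnd_pr).
    destruct (hk 0) as [j hj]; rewrite e in *; [exact ix|].
    exists (st_v (st k) j), k, j. rewrite hj. split; [now apply real_refl|reflexivity]. }
  (* The default [0] agrees with that of [lookup]. *)
  pose (Y x := if excluded_middle_informative (unitF x) then epsilon (inhabits 0) (V x) else 0).
  assert (hY : forall x, El x -> unitF x -> V x (Y x)).
  { intros x hx ix. unfold Y. destruct excluded_middle_informative; [|tauto].
    apply epsilon_spec. auto. }
  exists Y. split; [|split].
  - intros x y hx hy ix iy. apply hV; auto.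
  - intros n. destruct (hnext (st n) n) as (_ & _ & j & hj).
    change (next (st n) n) with (st (S n)) in hj.
    exists (sec (st_h (st (S n))) j).
    assert (e1 : El (sec (st_h (st (S n))) j)) by (apply El_sec, st_hE).
    assert (e2 : unitF (sec (st_h (st (S n))) j)) by apply st_num.
    split; [exact e1|split; [exact e2|]].
    apply (hV _ _ _ _ e1 e1 e2 e2); auto using real_refl.
    exists (S n), j. split; [now apply real_refl|exact hj].
  - intros g hg. destruct (hVex g hg) as [k hk].
    pose (p n := pr (st_h (st k) n) (st_v (st k) (pfst n))).
    assert (hp : El p).
    { apply (cl_pair El El_closed); [apply st_hE|].
      exact (cl_comp El El_closed _ pfst (st_vE _) (cl_fst El El_closed)). }
    pose proof (El_op (o_basic o_lookup) p g hp hg) as H.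
    replace (fun n => Y (sec g n)) with (op_den (o_basic o_lookup) p g); [exact H|].
    apply functional_extensionality; intros n. simpl. unfold lookup.
    assert (e : (fun m => pfst (p m)) = st_h (st k)).
    { apply functional_extensionality; intros m. unfold p. apply pfst_pr. }
    rewrite e. unfold p at 1. rewrite psnd_pr, pfst_pr.
    destruct excluded_middle_informative as [i1|i1].
    + destruct (hk n i1) as [j hj].
      assert (hl : sameF (sec g n) (sec (st_h (st k))
          (least (fun j => sameF (sec g n) (sec (st_h (st k)) j))))).
      { apply (least_spec (fun j => sameF (sec g n) (sec (st_h (st k)) j)) j).
        rewrite hj. apply real_refl; auto using El_sec. }
      assert (e1 : El (sec g n)) by now apply El_sec.
      apply (hV _ _ _ _ e1 e1 i1 i1); auto using real_refl.
      eexists k, _. split; [exact hl|reflexivity].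
    + unfold Y. now destruct excluded_middle_informative.
Qed.

Lemma small_not_NBI : ~ sat small NBI enil.
Proof.
  intros h. destruct unit_bijection as (Y & Y1 & Y2 & Y3).
  assert (hY : forall F, plot El (sp El El_closed ty1) F -> El (fun n => Y (fn (F n)))).
  { intros F hF. destruct (plot_sec F hF) as (g & hg & e).
    replace (fun n => Y (fn (F n))) with (fun n => Y (sec g n)); [now apply Y3|].
    apply functional_extensionality; intros n. now rewrite e. }
  pose (YM := mk1 El El_closed (A := sp El El_closed ty1) (B := sp_nat El El_closed)
    (fun f => Y (fn f)) hY).
  apply (proj2 (proj2 (proj2 (proj2 (model_reals small small_extensional small_models)))))
    with (Y := YM) in h.
  - destruct h as [(x & y & ix & iy & d & e)|(n & hn)].
    + apply d. apply same_real_small. apply Y1; try apply fn_El; try now apply unit_real_small.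
      exact e.
    + destruct (Y2 n) as (x & hx & ix & e). apply (hn (mks x hx)); [now apply unit_real_small|].
      exact e.
  - intros x y ix iy e. apply Y1; try apply fn_El; try now apply unit_real_small.
    now apply same_real_small.
Qed.

Theorem theorem3p28 :
  (union RCA0w (QFAC N (Arr N N)) ⊢ NBI) /\ ~ (Z2w ⊢ NBI).
Proof.
  split; [exact NBI_from_choice|].
  intros h. apply small_not_NBI.
  exact (soundness small Z2w [] [] NBI small_Z2w h enil (fun B hB => match hB with end)).
Qed.
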